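(* Let $a\ge0$ and let $(q,r)$ be $a$-admissible. There is $C(a,r)>0$ such that for every $F\in\mathbb S^+$, the function $T_a(F)(x)=\int_{\mathbb R}S_a(-t)\big(F(\cdot,t)\big)(x)\,dt$ satisfies $$\|T_a(F)\|_{L^2_a}\le C(a,r)\|F\|_{L^{q'}_tL^{r'}_a}.$$
   Context: $\mathbb R^+=(0,\infty)$, $d\omega_a(x)=x^a\,dx$, $L^r_a=L^r(\mathbb R^+,d\omega_a)$, $\|u\|_{L^q_tL^r_a}=(\int_{\mathbb R}\|u(\cdot,t)\|_{L^r_a}^q\,dt)^{1/q}$; primes denote conjugate exponents. A pair $(q,r)$ is $a$-admissible if $r>2$, additionally $r<\frac{2(a+1)}{a-1}$ when $a>1$, and $\frac2q=(a+1)(\frac12-\frac1r)$. $\mathbb S^+$ is the set of $F\in C^\infty(\mathbb R^+\times\mathbb R;\mathbb C)$ with $\sup_{k+\ell\le p}\sup_{(x,t)}(1+x^2+t^2)^{p/2}|(x^{-1}\partial_x)^k\partial_t^\ell F(x,t)|<\infty$ for every $p\in\mathbb N_0$. Kernel: for $x,y>0$, $S_a(x,y,t)=\frac{e^{-i(a+1)\pi/4}}{(2|t|)^{(a+1)/2}}\big(\frac{xy}{2|t|}\big)^{\frac{1-a}2}J_{\frac{a-1}2}\big(\frac{xy}{2|t|}\big)e^{i\frac{x^2+y^2}{4|t|}}$ if $t>0$, its analogue with $e^{i(a+1)\pi/4}$ and $e^{-i\frac{x^2+y^2}{4|t|}}$ if $t<0$ ($J_\nu$ Bessel function of the first kind);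 $S_a(t)\varphi(x)=\int_0^\infty S_a(x,y,t)\varphi(y)\,d\omega_a(y)$, $S_a(0)=\mathrm{Id}$. *)

(* Defs.v *)
From HB Require Import structures.
From mathcomp Require Import all_boot all_order all_algebra.
From mathcomp Require Import all_classical all_reals all_analysis.
Set Implicit Arguments. Unset Strict Implicit. Unset Printing Implicit Defensive.
Import Order.TTheory GRing.Theory Num.Theory.
Import numFieldNormedType.Exports.
Local Open Scope classical_set_scope.
Local Open Scope ring_scope.

Section Defs.
Variable R : realType.

Local Notation mu := (@lebesgue_measure R).

Definition cplx := (R * R)%type.
Definition cmul (z w : cplx) : cplx := (z.1 * w.1 - z.2 * w.2, z.1 * w.2 + z.2 * w.1).
Definition cscale (c : R) (z : cplx) : cplx := (c * z.1, c * z.2).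
Definition cexpi (th : R) : cplx := (cos th, sin th).
Definition cabs (z : cplx) : R := Num.sqrt (z.1 ^+ 2 + z.2 ^+ 2).
Definition cint (D : set R) (f : R -> cplx) : cplx :=
  (Rintegral mu D (fun y => (f y).1), Rintegral mu D (fun y => (f y).2)).

Definition Gamma (s : R) : R :=
  Rintegral mu `]0, +oo[ (fun u => u `^ (s - 1) * expR (- u)).

(* J_nu(z) = sum_k (-1)^k / (k! Gamma(k+nu+1)) (z/2)^(2k+nu), for z > 0 *)
Definition besselJ (nu z : R) : R :=
  limn (series (fun k : nat =>
    (-1) ^+ k / ((k`!)%:R * Gamma (k%:R + nu + 1)) * (z / 2) `^ (2 * k%:R + nu))).

Definition Sker (a x y t : R) : cplx :=
  let w := x * y / (2 * `|t|) in
  let K := (2 * `|t|) `^ (- ((a + 1) / 2)) * w `^ ((1 - a) / 2) * besselJ ((a - 1) / 2) w in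
  if 0 < t then
    cscale K (cmul (cexpi (- ((a + 1) * pi / 4))) (cexpi ((x ^+ 2 + y ^+ 2) / (4 * `|t|))))
  else
    cscale K (cmul (cexpi ((a + 1) * pi / 4)) (cexpi (- ((x ^+ 2 + y ^+ 2) / (4 * `|t|))))).

Definition Sop (a t : R) (phi : R -> cplx) (x : R) : cplx :=
  if t == 0 then phi x
  else cint `]0, +oo[ (fun y => cscale (y `^ a) (cmul (Sker a x y t) (phi y))).

Definition Top (a : R) (F : R -> R -> cplx) (x : R) : cplx :=
  cint setT (fun t => Sop a (- t) (fun y => F y t) x).

Definition Lnorm_a (a r : R) (phi : R -> cplx) : \bar R :=
  poweR (\int[mu]_(y in `]0, +oo[) ((cabs (phi y)) `^ r * y `^ a)%:E) r^-1.

Definition mixnorm (a q r : R) (F : R -> R -> cplx) : \bar R :=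
  poweR (\int[mu]_(t in [set: R]) poweR (Lnorm_a a r (fun y => F y t)) q) q^-1.

Definition conjexp (p : R) : R := p / (p - 1).

Definition admissible (a q r : R) : Prop :=
  2 < r /\ (1 < a -> r < 2 * (a + 1) / (a - 1)) /\
  2 / q = (a + 1) * (2^-1 - r^-1).

Definition dX (F : R -> R -> cplx) : R -> R -> cplx :=
  fun x t => derive1 (fun s => F s t) x.
Definition dT (F : R -> R -> cplx) : R -> R -> cplx :=
  fun x t => derive1 (fun s => F x s) t.
Definition xdX (F : R -> R -> cplx) : R -> R -> cplx :=
  fun x t => x^-1 *: dX F x t.

Definition iterD (w : seq bool) (F : R -> R -> cplx) : R -> R -> cplx :=
  foldr (fun b G => if b then dX G else dT G) F w.

Definition smooth_pos (F : R -> R -> cplx) : Prop :=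
  forall (w : seq bool) (x t : R), 0 < x ->
    derivable (fun s => iterD w F s t) x 1 /\
    derivable (fun s => iterD w F x s) t 1 /\
    {for (x, t), continuous (fun p : R * R => iterD w F p.1 p.2)}.

Definition inSplus (F : R -> R -> cplx) : Prop :=
  smooth_pos F /\
  forall p : nat, exists M : R, forall (k l : nat), (k + l <= p)%N ->
    forall x t : R, 0 < x ->
      (1 + x ^+ 2 + t ^+ 2) `^ (p%:R / 2) *
        cabs (iter k xdX (iter l dT F) x t) <= M.

End Defs.

(* Main.v *)
Require Import Defs.
From HB Require Import structures.
From mathcomp Require Import all_boot all_order all_algebra.
From mathcomp Require Import all_classical all_reals all_analysis.
From mathcomp Require Import measurable_realfun lebesgue_integral_under.
From mathcomp Require Import ring lra.
Set Implicit Arguments. Unset Strict Implicit. Unset Printing Implicit Defensive.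
Import Order.TTheory GRing.Theory Num.Theory.
Import numFieldNormedType.Exports.
Local Open Scope classical_set_scope.
Local Open Scope ring_scope.

(* The square of the norm of [T F] is the double time integral of the forms
   [<S(-t) F_t, S(-s) F_s>], regularised by a Gaussian [e^(-eps x^2)] and by a
   cut-off of [t] near [0] and infinity, both removed at the end by Fatou.
   Write [U w = w^(-nu) J_nu w].  The kernel of such a form is the integral of
   [e^(-p x^2) U(al x) U(be x) x^a] with [p] complex; scaling [al] and [be] by
   [l] and adding the same integral for [U'] gives an energy that decreases
   in [l], hence the dispersive bound [C |t - s|^(-(a+1)/2)].  For [t = s] the
   kernel is nonnegative and its integral against a Gaussian is explicit, so
   Schur's test bounds the forms on [L^2].  Real interpolation of the two bounds
   (layer-cake decomposition, splitting one function at a height depending on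
   the level of the other) gives [C |t - s|^(-2/q)] on [L^r'], and the
   Hardy-Littlewood-Sobolev inequality in time concludes. *)

(** * Integrals on the half-line *)

Section Calculus.
Context {R : realType}.
Implicit Types (f g F : R -> R) (x y c : R).
Local Notation mu := (@lebesgue_measure R).
Local Notation Dp := (`]0%R, +oo[%classic : set R).

(** The phases of the kernels at times t and s combine to b x^2 with b = 1/(4t) - 1/(4s) = (s -
    t)/(4ts), while the prefactors multiply to (4|t||s|)^(-(a+1)/2). A bound by |b|^(-(a+1)/2), the
    size of the bare moment of e^(-p x^2) x^a with p = eps + i b, is therefore exactly the
    dispersive decay. The energy argument reaches it by real calculus: the integrals of products of
    U and U' inherit a first-order system from Bessel's equation, and every complex quantity is
    carried as two real integrals. All constants are uniform in the Gaussian and in the time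
    cut-off, which only serve to make each exchange of integrals legitimate. The time integral
    defining T F need not be shown to converge: at each x it is either absolutely convergent, and
    then the truncations tend to it, or has the default value 0, which is compatible with Fatou's
    lemma. The exponents fit exactly: at p = r' the interpolated decay is 2/q, admissibility places
    it in ]0, 1[, and the exponent that Hardy-Littlewood-Sobolev requires for this decay is q'. *)

Lemma is_derive1M f g x df dg :
  is_derive x 1 f df -> is_derive x 1 g dg ->
  is_derive x 1 (fun y => f y * g y) (df * g x + f x * dg).
Proof.
move=> hf hg; apply: is_derive_eq; rewrite /GRing.scale /=; ring.
Qed.

Lemma is_derive1D f g x df dg :
  is_derive x 1 f df -> is_derive x 1 g dg ->
  is_derive x 1 (fun y => f y + g y) (df + dg).
Proof. by move=> hf hg; exact: is_deriveD. Qed.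

Lemma is_derive1_fcomp f g x df dg :
  is_derive (g x) 1 f df -> is_derive x 1 g dg ->
  is_derive x 1 (fun y => f (g y)) (df * dg).
Proof. by move=> hf hg; exact: (is_derive1_comp (f := f) (g := g)). Qed.

Lemma is_derive1_Zl c x : is_derive x 1 (fun y => c * y) c.
Proof.
by apply: (is_derive_eq (is_derive1M (is_derive_cst c x 1) (is_derive_id x 1)));
  rewrite mul0r add0r mulr1.
Qed.

Lemma is_derive1_Ml c f x df :
  is_derive x 1 f df -> is_derive x 1 (fun y => c * f y) (c * df).
Proof.
move=> h; apply: (is_derive_eq (is_derive1M (is_derive_cst c x 1) h)).
by rewrite mul0r add0r.
Qed.

Lemma is_derive1_exp n x : is_derive x 1 (fun y : R => y ^+ n.+1) (n.+1%:R * x ^+ n).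
Proof.
elim: n => [|n IH]; first by rewrite expr0 mulr1; exact: is_derive_id.
rewrite (_ : (fun y => _) = (fun y => y * y ^+ n.+1)); last by apply/funext => y; rewrite exprS.
apply: (is_derive_eq (is_derive1M (is_derive_id x 1) IH)).
by rewrite mul1r mulrCA -exprS [in RHS](mulrS 1) mulrDl mul1r.
Qed.

Lemma is_derive1_continuous f x df :
  is_derive x 1 f df -> {for x, continuous f}.
Proof. by move=> [h _]; apply/differentiable_continuous/derivable1_diffP. Qed.

Lemma nincr_pos f df :
  (forall x, 0 < x -> is_derive x 1 f (df x)) ->
  (forall x, 0 < x -> df x <= 0) ->
  forall x y, 0 < x -> x <= y -> f y <= f x.
Proof.
move=> fd d0 x y x0; rewrite le_eqVlt => /predU1P[->//|xy].
have [||c] := @MVT _ f df x y xy.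
- move=> z; rewrite in_itv/= => /andP[xz _]; exact: fd (lt_trans x0 xz).
- apply: derivable_within_continuous => z; rewrite in_itv/= => /andP[xz _].
  by have [] := fd z (lt_le_trans x0 xz).
rewrite in_itv/= => /andP[xc cy] E.
rewrite -subr_le0 E; apply: mulr_le0_ge0; last by rewrite subr_ge0 ltW.
by apply: d0; exact: lt_trans x0 xc.
Qed.

(** The energies differentiated below contain a term in 1/x, so their derivative is available only
    for x > 0; right-continuity at 0 carries the comparison to the value at 0. *)
Lemma nincr_from0 f df :
  (forall x, 0 < x -> is_derive x 1 f (df x)) ->
  (forall x, 0 < x -> df x <= 0) -> f x @[x --> 0^'+] --> f 0 ->
  forall x, 0 <= x -> f x <= f 0.
Proof.
move=> fd d0 f0 x; rewrite le_eqVlt => /predU1P[<-//|x0].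
apply: (cvgr_to_ge f0).
by near=> y; apply: (nincr_pos fd d0) => //; near: y; exact: nbhs_right_le.
Unshelve. all: end_near. Qed.

Lemma Rintegral_derive0 F f :
  (forall x, 0 < x -> is_derive x 1 F (f x)) ->
  (forall x, 0 < x -> {for x, continuous f}) ->
  mu.-integrable Dp (EFin \o f) ->
  F x @[x --> 0^'+] --> (0 : R) -> F x @[x --> +oo] --> (0 : R) ->
  \int[mu]_(x in Dp) f x = 0.
Proof.
move=> dF cf intf F0 Foo.
(* The fundamental theorem is applied on [1/(n+1), n+2] and dominated convergence passes to the
   limit; the shift to n+2 keeps the interval nondegenerate at n = 0. *)
pose a_ (n : nat) : R := n.+1%:R^-1; pose b_ (n : nat) : R := n.+2%:R.
have a0 n : 0 < a_ n by rewrite invr_gt0 ltr0n.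
have ab n : a_ n < b_ n.
  rewrite (@le_lt_trans _ _ 1)// /a_ ?invf_le1 ?ler1n ?ltr1n//.
have Iab n : (\int[mu]_(x in `[a_ n, b_ n]) (f x)%:E = (F (b_ n) - F (a_ n))%:E)%E.
  rewrite EFinB; apply: continuous_FTC2 => //.
  - apply: continuous_in_subspaceT => x; rewrite inE/= in_itv/= => /andP[ax _].
    by apply: cf; exact: lt_le_trans ax.
  - split.
    + move=> x; rewrite in_itv/= => /andP[ax _].
      by have [] := dF x (lt_trans (a0 n) ax).
    + apply: cvg_at_right_filter; exact: (is_derive1_continuous (dF _ (a0 n))).
    + apply: cvg_at_left_filter.
      exact: (is_derive1_continuous (dF _ (lt_trans (a0 n) (ab n)))).
  - move=> x; rewrite in_itv/= => /andP[ax _].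
    by rewrite derive1E; have [_] := dF x (lt_trans (a0 n) ax).
have lim1 : (F (b_ n) - F (a_ n) @[n --> \oo] --> (0 : R)).
  rewrite -[0 in X in _ --> X](subr0 (0 : R)); apply: cvgB.
  - apply: (cvg_comp _ _ _ Foo); rewrite /b_.
    apply/cvgryPge => A; near=> n; rewrite (@le_trans _ _ n%:R)//.
      by near: n; exact: nbhs_infty_ger.
    by rewrite ler_nat (leq_trans (leqnSn _)).
  - move/cvg_at_rightP : F0; apply; split => //.
    exact: cvg_harmonic.
have mf : measurable_fun Dp f by apply/measurable_EFinP; case/integrableP: intf.
have lim2 : (\int[mu]_(x in Dp) ((f \_ `[a_ n, b_ n]) x)%:E @[n --> \oo] -->
   \int[mu]_(x in Dp) (f x)%:E)%E.
  apply: (@dominated_cvg _ _ _ mu Dp _ (fun n x => ((f \_ `[a_ n, b_ n]) x)%:E)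
     (EFin \o f) (fun x => `|f x|%:E)) => //.
  - move=> n; apply/measurable_EFinP.
    apply/measurable_restrict => //.
    by apply: measurable_funS mf => //; exact: subIsetl.
  - move=> x; rewrite /= in_itv/= andbT => x0.
    apply: cvg_near_cst; near=> n; rewrite patchE mem_set//= in_itv/=; apply/andP; split.
    + rewrite -[leRHS]invrK lef_pV2 ?posrE ?invr_gt0//.
      rewrite (@le_trans _ _ n%:R) ?ler_nat//; near: n; exact: nbhs_infty_ger.
    + apply: (@le_trans _ _ (n%:R : R)); last by rewrite ler_nat (leq_trans (leqnSn _)).
      by near: n; exact: nbhs_infty_ger.
  - by apply: integrable_abse intf.
  - move=> n x _; rewrite lee_fin patchE; case: ifPn => // _.
    by rewrite normr0.
have E2 : (fun n => \int[mu]_(x in Dp) ((f \_ `[a_ n, b_ n]) x)%:E)%E =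
          (fun n => (F (b_ n) - F (a_ n))%:E).
  apply/funext => n; rewrite -Iab.
  rewrite [RHS]integral_mkcond [LHS]integral_mkcond.
  apply: eq_integral => x _; rewrite !patchE.
  case: ifPn => xD; first by case: ifPn.
  rewrite ifN//; apply: contra xD; rewrite !inE/= !in_itv/= andbT => /andP[+ _].
  exact: lt_le_trans.
rewrite E2 in lim2.
have := cvg_unique _ lim2 (cvg_EFin _ lim1).
move=> H; rewrite /Rintegral H //. 
by apply: nearW.
Unshelve. all: end_near. Qed.

End Calculus.

(** * Power weights on the half-line: improper integrals, domination, integrals with a parameter *)

Section PowerIntegrals.
Context {R : realType}.
Implicit Types (f g F : R -> R) (x y c s eps m e r : R).
Local Notation mu := (@lebesgue_measure R).
Local Notation Dp := (`]0%R, +oo[%classic : set R).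

Lemma measurable_Dp : measurable Dp.
Proof. exact: measurable_itv. Qed.

Lemma ler_powRl r x y : 0 <= r -> 0 <= x -> x <= y -> x `^ r <= y `^ r.
Proof.
move=> r0 x0 xy; have /= h := @ge0_ler_powR R r r0 x y.
by apply: h; rewrite ?nnegrE// (le_trans x0).
Qed.

Lemma powRDp x r s : 0 < x -> x `^ (r + s) = x `^ r * x `^ s.
Proof. by move=> x0; apply: powRD; apply/implyP => _; rewrite gt_eqF. Qed.

Lemma powRm2 x : 0 <= x -> x `^ (- 2) = (x ^+ 2)^-1.
Proof. by move=> x0; rewrite -(powR_invn 2 x0). Qed.

Lemma measurable_fun_pos f :
  (forall x, 0 < x -> {for x, continuous f}) -> measurable_fun Dp f.
Proof.
move=> cf; apply: open_continuous_measurable_fun; first exact: interval_open.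
by move=> x; rewrite inE/= in_itv/= andbT; exact: cf.
Qed.

Lemma continuous_powR_pos s x : 0 < x -> {for x, continuous (fun y => y `^ s)}.
Proof. by move=> x0; have := is_derive1_powR s x0; exact: is_derive1_continuous. Qed.

Lemma is_derive_powR_div s x : s != 0 -> 0 < x ->
  is_derive x 1 (fun y => y `^ s / s) (x `^ (s - 1)).
Proof.
move=> s0 x0; rewrite (_ : (fun y => _) = (fun y => s^-1 * y `^ s)); last first.
  by apply/funext => y; rewrite mulrC.
apply: (is_derive_eq (is_derive1_Ml s^-1 (is_derive1_powR s x0))).
by rewrite mulKf.
Qed.

Lemma integral_powR_0c s c : 0 < s -> 0 < c ->
  (\int[mu]_(x in `]0%R, c]) (x `^ (s - 1))%:E = (c `^ s / s)%:E)%E.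
Proof.
move=> s0 c0.
(* The integrand is unbounded at 0 when s < 1, so the interval is exhausted from its right end; n +
   2 makes the left end strictly smaller than c already at n = 0. *)
pose F_ (n : nat) : set R := `[c / n.+2%:R, c]%classic.
have an n : 0 < c / n.+2%:R by rewrite divr_gt0.
have ac n : c / n.+2%:R < c by rewrite ltr_pdivrMr// ltr_pMr// ltr1n.
have FE : \bigcup_n F_ n = `]0%R, c]%classic.
  rewrite eqEsubset; split=> x /=.
    by move=> [n _]; rewrite /F_/= !in_itv/= => /andP[/(lt_le_trans (an n)) -> ->].
  rewrite in_itv/= => /andP[x0 xc]; exists (Num.trunc (c / x)) => //.
  rewrite /F_/= in_itv/= xc andbT ler_pdivrMr// mulrC -ler_pdivrMr//.
  by have /ltW /le_trans := truncnS_gt (c / x); apply; rewrite ler_nat.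
have I n : (\int[mu]_(x in F_ n) (x `^ (s - 1))%:E =
    (c `^ s / s)%:E - ((c / n.+2%:R) `^ s / s)%:E)%E.
  apply: (continuous_FTC2 (F := fun y => y `^ s / s)) => //.
  - apply: continuous_in_subspaceT => x; rewrite inE/= in_itv/= => /andP[ax _].
    by apply: continuous_powR_pos; exact: lt_le_trans ax.
  - have s0' : s != 0 by rewrite gt_eqF.
    split.
    + move=> x; rewrite in_itv/= => /andP[ax _].
      by have [] := is_derive_powR_div s0' (lt_trans (an n) ax).
    + apply: cvg_at_right_filter.
      exact: (is_derive1_continuous (is_derive_powR_div s0' (an n))).
    + apply: cvg_at_left_filter.
      exact: (is_derive1_continuous (is_derive_powR_div s0' c0)).
  - move=> x; rewrite in_itv/= => /andP[ax _].
    have s0' : s != 0 by rewrite gt_eqF.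
    by rewrite derive1E; have [_] := is_derive_powR_div s0' (lt_trans (an n) ax).
have L1 : (\int[mu]_(x in F_ n) (x `^ (s - 1))%:E @[n --> \oo] -->
    \int[mu]_(x in `]0%R, c]) (x `^ (s - 1))%:E)%E.
  rewrite -FE; apply: ge0_nondecreasing_set_cvg_integral => //.
  - apply/nondecreasing_seqP => n; rewrite subsetEset => x; rewrite /F_/= !in_itv/=.
    move=> /andP[+ ->]; rewrite andbT; apply: le_trans.
    by rewrite ler_pM2l// lef_pV2 ?posrE// ler_nat.
  - by move=> n; exact: measurable_itv.
  - move=> n; apply/measurable_EFinP.
    by apply: measurable_funTS; exact: measurable_powR.
  - by move=> n x _; rewrite lee_fin powR_ge0.
have L2 : ((c `^ s / s)%:E - ((c / n.+2%:R) `^ s / s)%:E @[n --> \oo] -->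
    (c `^ s / s)%:E)%E.
  rewrite -[X in _ --> X]sube0; apply: cvgeB => //; first exact: cvg_cst.
  apply: cvg_EFin; first exact: nearW.
  rewrite -[X in _ --> X](mul0r s^-1); apply: cvgMr_tmp.
  have H0 : (c / n.+2%:R @[n --> \oo] --> (0 : R)).
    rewrite -[X in _ --> X](mulr0 c); apply: cvgMl_tmp.
    rewrite (@cvg_shiftS _ (fun n : nat => n.+1%:R^-1 : R)); exact: cvg_harmonic.
  have := @powR_cvg0 R s s0 => /cvg_at_rightP; apply; split => //.
rewrite -(funext I) in L2.
by have := cvg_unique _ L1 L2; exact.
Qed.

Lemma integral_powR_cy s c : 0 < s -> 0 < c ->
  (\int[mu]_(x in `[c, +oo[) (x `^ (- s - 1))%:E = (c `^ (- s) / s)%:E)%E.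
Proof.
move=> s0 c0; have ns0 : - s != 0 by rewrite oppr_eq0 gt_eqF.
rewrite (ge0_continuous_FTC2y (F := fun y => y `^ (- s) / - s) (l := 0)).
- by rewrite sub0e -EFinN invrN mulrN opprK.
- by move=> x _; exact: powR_ge0.
- apply: continuous_in_subspaceT => x; rewrite inE/= in_itv/= andbT => ax.
  by apply: continuous_powR_pos; exact: lt_le_trans ax.
- rewrite -[X in _ --> X](mul0r (- s)^-1); apply: cvgMr_tmp.
  apply/cvgrPdist_le => e e0; near=> y.
  have y0 : 0 < y by near: y; exact: nbhs_pinfty_gt.
  have yK : e^-1 `^ s^-1 <= y by near: y; exact: nbhs_pinfty_ge.
  rewrite sub0r normrN ger0_norm ?powR_ge0// powRN.
  rewrite -[leRHS]invrK lef_pV2 ?posrE ?powR_gt0 ?invr_gt0//.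
  have -> : e^-1 = (e^-1 `^ s^-1) `^ s by rewrite -powRrM mulVf ?gt_eqF// powRr1// invr_ge0 ltW.
  by apply: ler_powRl; rewrite ?powR_ge0// (ltW s0).
- by move=> x ax; have [] := is_derive_powR_div ns0 (lt_trans c0 ax).
- apply: cvg_at_right_filter.
  exact: (is_derive1_continuous (is_derive_powR_div ns0 c0)).
- move=> x; rewrite in_itv/= andbT => ax.
  by rewrite derive1E; have [_] := is_derive_powR_div ns0 (lt_trans c0 ax).
Unshelve. all: end_near. Qed.

(** The common criterion for the Gaussian weights and the Gamma integrand: x^(s-1) with s > 0 is
    integrable at 0 and x^(-2) at infinity. *)
Lemma integrable_pos_dom f C s : measurable_fun Dp f -> 0 < s ->
  (forall x, 0 < x -> x <= 1 -> `|f x| <= C * x `^ (s - 1)) ->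
  (forall x, 1 <= x -> `|f x| <= C * x `^ (- 2)) ->
  mu.-integrable Dp (EFin \o f).
Proof.
move=> mf s0 f0 f1; apply/integrableP; split; first exact/measurable_EFinP.
have C0 : 0 <= C.
  have := f1 1 (lexx 1); rewrite powR1 mulr1; exact: le_trans.
have E : (\int[mu]_(x in Dp) `|(EFin \o f) x| <=
   \int[mu]_(x in `]0%R, 1%R]) (C%:E * (x `^ (s - 1))%:E) +
   \int[mu]_(x in `[1%R, +oo[) (C%:E * (x `^ (- 1 - 1))%:E))%E.
  have -> : Dp = `]0%R, 1%R] `|` `]1%R, +oo[.
    rewrite eqEsubset; split=> x /=; rewrite !in_itv/= !andbT.
      by move=> x0; case: (leP x 1) => ?; [left; rewrite x0|right].
    by case=> [/andP[]//|]; exact: lt_trans.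
  rewrite ge0_integral_setU//=; last 2 first.
  - apply/measurable_EFinP/measurableT_comp => //.
    apply: measurable_funS mf => // x [] /=; rewrite !in_itv/= !andbT; first by case/andP.
    exact: lt_trans.
  - rewrite disj_set2E; apply/eqP; rewrite -subset0 => x []/=; rewrite !in_itv/= andbT.
    by move=> /andP[_ x1]; rewrite ltNge x1.
  apply: leeD.
  - apply: ge0_le_integral => //.
    + apply/measurable_EFinP/measurableT_comp => //.
      by apply: measurable_funS mf => // x /=; rewrite !in_itv/= andbT => /andP[].
    + apply/measurable_funeM/measurable_EFinP.
      by apply: measurable_funTS; exact: measurable_powR.
    + by move=> x; rewrite /= in_itv/= => /andP[x0 x1]; rewrite -EFinM lee_fin f0.
  - rewrite integral_itv_obnd_cbnd; last first.
      apply/measurable_EFinP/measurableT_comp => //.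
      by apply: measurable_funS mf => // x /=; rewrite !in_itv/= !andbT; exact: lt_trans.
    apply: ge0_le_integral => //.
    + apply/measurable_EFinP/measurableT_comp => //.
      by apply: measurable_funS mf => // x /=; rewrite !in_itv/= !andbT; exact: lt_le_trans.
    + apply/measurable_funeM/measurable_EFinP.
      by apply: measurable_funTS; exact: measurable_powR.
    + move=> x; rewrite /= in_itv/= andbT => x1; rewrite -EFinM lee_fin.
      by rewrite (_ : -1 - 1 = -2); [exact: f1|ring].
apply: le_lt_trans E _.
rewrite !ge0_integralZl//=; do ?[by move=> x _; rewrite lee_fin powR_ge0];
  do ?[by apply/measurable_EFinP/measurable_funTS; exact: measurable_powR].
by rewrite integral_powR_0c// integral_powR_cy// -!EFinM -EFinD ltry.
Qed.

Lemma powR_le_expR m x : 0 < m -> 0 <= x -> x `^ m <= m `^ m * expR x.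
Proof.
move=> m0 x0.
have -> : expR x = expR (x / m) `^ m by rewrite -expRM divfK// gt_eqF.
(* It remains to compare the bases: x <= m e^(x/m), which follows from 1 + y <= e^y at y = x / m. *)
rewrite -powRM ?(ltW m0) ?expR_ge0//; apply: ler_powRl; rewrite ?(ltW m0)//.
rewrite mulrC -ler_pdivrMr//; apply: le_trans (expR_ge1Dx _); lra.
Qed.

Lemma gauss_powR_le eps s : 0 < eps -> 0 <= s ->
  exists C, forall x, 0 < x -> x `^ s * expR (- (eps * x ^+ 2)) <= C * x `^ (- 2).
Proof.
move=> e0 s0; pose m := (s + 2) / 2.
have m0 : 0 < m by rewrite /m; lra.
exists ((m / eps) `^ m) => x x0.
have x20 : 0 <= eps * x ^+ 2 by rewrite mulr_ge0 ?sqr_ge0 ?ltW.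
rewrite expRN -ler_pdivlMr; last by rewrite invr_gt0 expR_gt0.
rewrite invrK powRm2 ?(ltW x0)//.
rewrite mulrAC ler_pdivlMr ?exprn_gt0//.
have -> : x `^ s * x ^+ 2 = (x ^+ 2) `^ m.
  rewrite -(powR_mulrn 2 (ltW x0)) -powRD; last by apply/implyP => _; rewrite gt_eqF.
  by rewrite -powRrM /m; congr (_ `^ _); field.
set y := eps * x ^+ 2.
have -> : x ^+ 2 = y / eps by rewrite /y mulrAC mulfV ?mul1r// gt_eqF.
rewrite (@powRM _ y)// ?invr_ge0 ?(ltW e0)// (@powRM _ m) ?invr_ge0 ?(ltW e0) ?(ltW m0)//.
by rewrite [leRHS]mulrAC ler_wpM2r ?powR_ge0 ?powR_le_expR.
Qed.

Lemma measurable_gpow eps s :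
  measurable_fun Dp (fun x => x `^ s * expR (- (eps * x ^+ 2))).
Proof.
apply: measurable_funTS; apply: measurable_funM; first exact: measurable_powR.
apply: measurableT_comp => //; apply: measurableT_comp => //.
by apply: measurable_funM => //; exact: measurable_funX.
Qed.

Lemma integrable_gpow eps s : 0 < eps -> 0 <= s ->
  mu.-integrable Dp (EFin \o (fun x => x `^ s * expR (- (eps * x ^+ 2)))).
Proof.
move=> e0 s0; have [C HC] := gauss_powR_le e0 s0.
apply: (@integrable_pos_dom _ (Num.max 1 C) (s + 1)).
- exact: measurable_gpow.
- lra.
- move=> x x0 x1; rewrite addrK ger0_norm ?mulr_ge0 ?powR_ge0 ?expR_ge0//.
  rewrite mulrC ler_wpM2r ?powR_ge0// le_max; apply/orP; left.
  by rewrite -[leRHS]expR0 ler_expR oppr_le0 mulr_ge0 ?sqr_ge0 ?ltW.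
- move=> x x1; rewrite ger0_norm ?mulr_ge0 ?powR_ge0 ?expR_ge0//.
  apply: (le_trans (HC x (lt_le_trans ltr01 x1))).
  by rewrite ler_wpM2r ?powR_ge0// le_max lexx orbT.
Qed.

Lemma gpow_cvgy eps s C f : 0 < eps -> 0 <= s ->
  (forall x, 0 < x -> `|f x| <= C * (x `^ s * expR (- (eps * x ^+ 2)))) ->
  f x @[x --> +oo] --> (0 : R).
Proof.
move=> e0 s0 fb; have [D HD] := gauss_powR_le e0 s0.
have C0 : 0 <= C.
  have := fb 1 ltr01; rewrite powR1 mul1r => /(le_trans (normr_ge0 _)).
  by rewrite pmulr_lge0 ?expR_gt0.
have D0 : 0 <= D.
  have := HD 1 ltr01; rewrite powR1 mulr1; apply: le_trans.
  by rewrite mulr_ge0 ?powR_ge0 ?expR_ge0.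
apply/cvgrPdist_le => e ep; near=> x; rewrite sub0r normrN.
have x1 : 1 <= x by near: x; exact: nbhs_pinfty_ge.
have x0 : 0 < x by exact: lt_le_trans x1.
apply: (le_trans (fb _ x0)).
apply: (@le_trans _ _ (C * (D / x))).
  rewrite ler_wpM2l//; apply: (le_trans (HD _ x0)).
  rewrite ler_wpM2l// powRm2 ?(ltW x0)// lef_pV2 ?posrE ?exprn_gt0//.
  by rewrite expr2 ler_pMr.
by rewrite mulrA ler_pdivrMr// -ler_pdivrMl//; near: x.
Unshelve. all: end_near. Qed.

Lemma le_integrable_pos f g : measurable_fun Dp f ->
  (forall x, 0 < x -> `|f x| <= g x) -> mu.-integrable Dp (EFin \o g) ->
  mu.-integrable Dp (EFin \o f).
Proof.
move=> mf fg; apply: le_integrable => //; first exact/measurable_EFinP.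
move=> x; rewrite /= in_itv/= andbT => x0; rewrite lee_fin.
by apply: (le_trans (fg _ x0)); exact: ler_norm.
Qed.

Lemma integrable_pos_Ml c f : mu.-integrable Dp (EFin \o f) ->
  mu.-integrable Dp (EFin \o (fun x => c * f x)).
Proof.
by move=> h; exact: (@integrableZl _ _ _ mu Dp measurable_Dp c _ h).
Qed.

Lemma integrable_posD f g : mu.-integrable Dp (EFin \o f) ->
  mu.-integrable Dp (EFin \o g) -> mu.-integrable Dp (EFin \o (fun x => f x + g x)).
Proof. by move=> hf hg; exact: (@integrableD _ _ _ mu Dp measurable_Dp _ _ hf hg). Qed.

Lemma Rintegral_posZl c f : mu.-integrable Dp (EFin \o f) ->
  \int[mu]_(x in Dp) (c * f x) = c * \int[mu]_(x in Dp) f x.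
Proof. by move=> hf; exact: (@RintegralZl _ _ _ mu Dp f c measurable_Dp hf). Qed.

Lemma Rintegral_posD f g : mu.-integrable Dp (EFin \o f) ->
  mu.-integrable Dp (EFin \o g) ->
  \int[mu]_(x in Dp) (f x + g x) = \int[mu]_(x in Dp) f x + \int[mu]_(x in Dp) g x.
Proof. by move=> hf hg; exact: (@RintegralD _ _ _ mu Dp f g measurable_Dp hf hg). Qed.

Lemma Rintegral_posB f g : mu.-integrable Dp (EFin \o f) ->
  mu.-integrable Dp (EFin \o g) ->
  \int[mu]_(x in Dp) (f x - g x) = \int[mu]_(x in Dp) f x - \int[mu]_(x in Dp) g x.
Proof. by move=> hf hg; exact: (@RintegralB _ _ _ mu Dp f g measurable_Dp hf hg). Qed.

Lemma is_derive_Rintegral (f df : R -> R -> R) (G : R -> R) (l u v : R) :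
  u < l -> l < v ->
  (forall x, u < x -> x < v -> mu.-integrable Dp (EFin \o f x)) ->
  (forall x y, u < x -> x < v -> 0 < y -> is_derive x 1 (f ^~ y) (df x y)) ->
  mu.-integrable Dp (EFin \o G) ->
  (forall x y, u < x -> x < v -> 0 < y -> `|df x y| <= G y) ->
  is_derive l 1 (fun x => \int[mu]_(y in Dp) f x y) (\int[mu]_(y in Dp) df l y).
Proof.
move=> ul lv intf dfE intG dfG.
have Il : `]u, v[%classic l by rewrite /= in_itv/= ul lv.
have dE x y : `]u, v[%classic x -> Dp y -> partial1of2 f x y = df x y.
  rewrite /= !in_itv/= andbT => /andP[ux xv] y0.
  by rewrite partial1of2E; have [_] := dfE x y ux xv y0.
have H1 x : `]u, v[%classic x -> mu.-integrable Dp (EFin \o f x).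
  by rewrite /= in_itv/= => /andP[]; exact: intf.
have H2 x y : `]u, v[%classic x -> Dp y -> derivable (f ^~ y) x 1.
  rewrite /= !in_itv/= andbT => /andP[ux xv] y0.
  by have [] := dfE x y ux xv y0.
have H3 : mu.-integrable Dp (EFin \o (fun y => `|G y|)).
  exact: (integrable_norm intG).
have H4 x y : `]u, v[%classic x -> Dp y -> `|partial1of2 f x y| <= `|G y|.
  move=> Ix Dy; rewrite dE//; apply: le_trans (ler_norm _).
  by move: Ix Dy; rewrite /= !in_itv/= andbT => /andP[ux xv] y0; exact: dfG.
apply: DeriveDef.
  apply: (@derivable_under_integral R _ _ mu f Dp measurable_Dp l u v Il H1 H2 (fun y => `|G y|) _ H3 H4) => y.
  exact: normr_ge0.
rewrite -derive1E (@differentiation_under_integral R _ _ mu f Dp measurable_Dp l u v Il H1 H2 (fun y => `|G y|) (fun y => normr_ge0 (G y)) H3 H4).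
by apply: eq_Rintegral => y; rewrite inE => Dy; rewrite dE.
Qed.

Lemma continuous_Rintegral (f : R -> R -> R) (G : R -> R) (l u v : R) :
  u < l -> l < v ->
  (forall x, u < x -> x < v -> mu.-integrable Dp (EFin \o f x)) ->
  (forall x y, u < x -> x < v -> 0 < y -> {for x, continuous (f ^~ y)}) ->
  mu.-integrable Dp (EFin \o G) ->
  (forall x y, u < x -> x < v -> 0 < y -> `|f x y| <= G y) ->
  {for l, continuous (fun x => \int[mu]_(y in Dp) f x y)}.
Proof.
move=> ul lv intf cf intG fG.
have Il : l \in (`]u, v[%classic : set R) by rewrite inE/= in_itv/= ul lv.
apply: (@continuity_under_integral R _ _ mu f Dp measurable_Dp u v _ _ G intG _ _ Il).
- by move=> x; rewrite /= in_itv/= => /andP[]; exact: intf.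
- apply/aeW => y; rewrite /= in_itv/= andbT => y0 x; rewrite inE/= in_itv/= => /andP[ux xv].
  exact: cf.
- move=> x; rewrite /= in_itv/= => /andP[ux xv]; apply/aeW => y.
  by rewrite /= in_itv/= andbT; exact: fG.
Qed.

End PowerIntegrals.

(** * Oscillating Gaussian moments *)

Section Gauss.
Context {R : realType}.
Implicit Types (f g F e h dh k : R -> R) (x y c s eps m b C l : R).
Local Notation mu := (@lebesgue_measure R).
Local Notation Dp := (`]0%R, +oo[%classic : set R).

Definition gaussc eps b x : R := expR (- (eps * x ^+ 2)) * cos (b * x ^+ 2).
Definition gausss eps b x : R := expR (- (eps * x ^+ 2)) * sin (b * x ^+ 2).

Lemma is_derive_sqrM c x : is_derive x 1 (fun y => c * y ^+ 2) (2 * c * x).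
Proof.
apply: (is_derive_eq (is_derive1_Ml c (is_derive1_exp 1 x))).
by rewrite expr1; ring.
Qed.

Lemma is_derive_expRN2 eps x :
  is_derive x 1 (fun y => expR (- (eps * y ^+ 2)))
    (- (2 * eps * x) * expR (- (eps * x ^+ 2))).
Proof.
have h : is_derive x 1 (fun y => - (eps * y ^+ 2)) (- (2 * eps * x)).
  rewrite (_ : (fun y => _) = (fun y => (- eps) * y ^+ 2)); last by apply/funext=> y; rewrite mulNr.
  by apply: (is_derive_eq (is_derive_sqrM (- eps) x)); ring.
apply: (is_derive_eq (is_derive1_fcomp (is_derive_expR _) h)).
by rewrite mulrC.
Qed.

Lemma is_derive_gaussc eps b x : is_derive x 1 (gaussc eps b)
  (- (2 * x) * (eps * gaussc eps b x + b * gausss eps b x)).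
Proof.
apply: (is_derive_eq (is_derive1M (is_derive_expRN2 eps x)
  (is_derive1_fcomp (is_derive_cos _) (is_derive_sqrM b x)))).
rewrite /gaussc /gausss; ring.
Qed.

Lemma is_derive_gausss eps b x : is_derive x 1 (gausss eps b)
  (2 * x * (b * gaussc eps b x - eps * gausss eps b x)).
Proof.
apply: (is_derive_eq (is_derive1M (is_derive_expRN2 eps x)
  (is_derive1_fcomp (is_derive_sin _) (is_derive_sqrM b x)))).
rewrite /gaussc /gausss; ring.
Qed.

(* The oscillating Gaussians enter only through continuity and this bound. *)
Definition gauss_like eps e :=
  (forall x, {for x, continuous e}) /\ forall x, `|e x| <= expR (- (eps * x ^+ 2)).

Lemma gauss_like_c eps b : gauss_like eps (gaussc eps b).
Proof.
split=> x; first exact: (is_derive1_continuous (is_derive_gaussc eps b x)).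
rewrite /gaussc normrM ger0_norm ?expR_ge0// -[leRHS]mulr1 ler_wpM2l ?expR_ge0//.
by rewrite ler_norml cos_geN1 cos_le1.
Qed.

Lemma gauss_like_s eps b : gauss_like eps (gausss eps b).
Proof.
split=> x; first exact: (is_derive1_continuous (is_derive_gausss eps b x)).
rewrite /gausss normrM ger0_norm ?expR_ge0// -[leRHS]mulr1 ler_wpM2l ?expR_ge0//.
by rewrite ler_norml sin_geN1 sin_le1.
Qed.

Lemma continuous_measurable1 f : (forall x, {for x, continuous f}) -> measurable_fun setT f.
Proof. by move=> cf; apply: continuous_measurable_fun => x; exact: cf. Qed.

Lemma integrable_gmul eps e k C s : 0 < eps -> 0 <= s -> gauss_like eps e ->
  measurable_fun Dp k -> (forall x, 0 < x -> `|k x| <= C * x `^ s) ->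
  mu.-integrable Dp (EFin \o (fun x => e x * k x)).
Proof.
move=> e0 s0 [ce be] mk kb.
apply: (@le_integrable_pos _ _ (fun x => C * (x `^ s * expR (- (eps * x ^+ 2))))).
- apply: measurable_funM => //; apply: measurable_funTS.
  exact: continuous_measurable1.
- move=> x x0; rewrite normrM mulrC mulrA ler_pM//; exact: kb.
- exact/integrable_pos_Ml/integrable_gpow.
Qed.

Lemma measurable_fun_dpos f df :
  (forall x, 0 < x -> is_derive x 1 f (df x)) -> measurable_fun Dp f.
Proof. by move=> h; apply: measurable_fun_pos => x /h; exact: is_derive1_continuous. Qed.

Lemma continuousM1 f g x : {for x, continuous f} -> {for x, continuous g} ->
  {for x, continuous (fun y => f y * g y)}.
Proof. by move=> cf cg; exact: cvgM. Qed.

Lemma continuousD1 f g x : {for x, continuous f} -> {for x, continuous g} ->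
  {for x, continuous (fun y => f y + g y)}.
Proof. by move=> cf cg; exact: cvgD. Qed.

(* Real and imaginary part of [2 p ∫ x e^(-p x^2) h = ∫ e^(-p x^2) h'],
   where [p = eps + i b]. *)
Lemma gauss_ibp eps b h dh C s s' : 0 < eps -> 0 <= s -> 0 <= s' ->
  (forall x, 0 < x -> is_derive x 1 h (dh x)) ->
  (forall x, 0 < x -> {for x, continuous dh}) ->
  (forall x, 0 < x -> `|h x| <= C * x `^ s) ->
  (forall x, 0 < x -> `|dh x| <= C * x `^ s') ->
  h x @[x --> 0^'+] --> (0 : R) ->
  2 * (eps * \int[mu]_(x in Dp) (gaussc eps b x * (x * h x))
       + b * \int[mu]_(x in Dp) (gausss eps b x * (x * h x)))
    = \int[mu]_(x in Dp) (gaussc eps b x * dh x) /\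
  2 * (eps * \int[mu]_(x in Dp) (gausss eps b x * (x * h x))
       - b * \int[mu]_(x in Dp) (gaussc eps b x * (x * h x)))
    = \int[mu]_(x in Dp) (gausss eps b x * dh x).
Proof.
move=> e0 s0 s0' dhE cdh hb dhb h0.
have mh : measurable_fun Dp h by exact: measurable_fun_dpos dhE.
have mdh : measurable_fun Dp dh by exact: measurable_fun_pos.
have mxh : measurable_fun Dp (fun x => x * h x) by exact: measurable_funM.
have s1 : 0 <= s + 1 by lra.
have xhb x : 0 < x -> `|x * h x| <= C * x `^ (s + 1).
  move=> x0; rewrite normrM gtr0_norm// powRDp//.
  by rewrite powRr1 ?(ltW x0)// mulrA mulrC ler_wpM2r ?(ltW x0)// hb.
have ic := integrable_gmul e0 s1 (gauss_like_c eps b) mxh xhb.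
have is_ := integrable_gmul e0 s1 (gauss_like_s eps b) mxh xhb.
have idc := integrable_gmul e0 s0' (gauss_like_c eps b) mdh dhb.
have ids := integrable_gmul e0 s0' (gauss_like_s eps b) mdh dhb.
have chx x : 0 < x -> {for x, continuous h}.
  by move=> x0; exact: is_derive1_continuous (dhE _ x0).
(* The derivative of either oscillating Gaussian is x times a linear combination of the two, so one
   integration by parts with generic coefficients yields both identities. *)
have main e de c1 c2 :
  gauss_like eps e ->
  (forall x, is_derive x 1 e (de x)) ->
  (forall x, de x = x * (c1 * gaussc eps b x + c2 * gausss eps b x)) ->
  mu.-integrable Dp (EFin \o (fun x => e x * dh x)) ->
  c1 * \int[mu]_(x in Dp) (gaussc eps b x * (x * h x))
   + c2 * \int[mu]_(x in Dp) (gausss eps b x * (x * h x))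
    + \int[mu]_(x in Dp) (e x * dh x) = 0.
  move=> ge dE deE ie.
  have [ce be] := ge.
  have i1 := integrable_pos_Ml c1 ic.
  have i2 := integrable_pos_Ml c2 is_.
  have i12 : mu.-integrable Dp (EFin \o (fun x =>
     c1 * (gaussc eps b x * (x * h x)) + c2 * (gausss eps b x * (x * h x)))).
    exact: integrable_posD.
  rewrite -!RintegralZl// -?RintegralD//; try exact: measurable_Dp.
  rewrite -[RHS](@Rintegral_derive0 _ (fun x => e x * h x)
    (fun x => de x * h x + e x * dh x)).
  - by apply: eq_Rintegral => x _; rewrite deE; ring.
  - by move=> x x0; exact: is_derive1M (dE x) (dhE x x0).
  - move=> x x0; apply: continuousD1; apply: continuousM1 => //.
    + rewrite (_ : de = (fun x => x * (c1 * gaussc eps b x + c2 * gausss eps b x))); last exact/funext.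
      have [cc _] := gauss_like_c eps b; have [cs _] := gauss_like_s eps b.
      apply: continuousM1; first exact: cvg_id.
      apply: continuousD1; apply: continuousM1 => //; exact: cvg_cst.
    + exact: chx.
    + exact: cdh.
  - rewrite (_ : (fun x => _) = (fun x => c1 * (gaussc eps b x * (x * h x)) + c2 * (gausss eps b x * (x * h x)) + e x * dh x)); last first.
      by apply/funext => x; rewrite deE; ring.
    exact: integrable_posD.
  - rewrite -[X in _ --> X](mulr0 (e 0)); apply: cvgM => //.
    exact/cvg_at_right_filter/ce.
  - apply: (gpow_cvgy e0 s0 (C := C)) => x x0.
    by rewrite normrM mulrC mulrA ler_pM// hb.
split.
- have := main (gaussc eps b) _ (- (2 * eps)) (- (2 * b)) (gauss_like_c eps b)
    (fun x => is_derive_gaussc eps b x) _ idc.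
  move=> H; have {}H := H ltac:(move=> x; ring); lra.
- have := main (gausss eps b) _ (2 * b) (- (2 * eps)) (gauss_like_s eps b)
    (fun x => is_derive_gausss eps b x) _ ids.
  move=> H; have {}H := H ltac:(move=> x; ring); lra.
Qed.

Lemma eq_integ_ext (f g : R -> R) : f =1 g -> mu.-integrable Dp (EFin \o f) ->
  mu.-integrable Dp (EFin \o g).
Proof. by move=> /funext ->. Qed.

Definition gaussmom (a : R) e : R := \int[mu]_(x in Dp) (e x * x `^ a).

(** The case h = x^(a+1) of [gauss_ibp]. With G the complex moment of order a and Z that of order a
    + 2, it reads 2 p Z = (a + 1) G. *)
Lemma gaussmom_ibp (a : R) eps b : 0 <= a -> 0 < eps ->
  2 * (eps * \int[mu]_(x in Dp) (gaussc eps b x * (x * x `^ (a + 1)))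
       + b * \int[mu]_(x in Dp) (gausss eps b x * (x * x `^ (a + 1))))
    = (a + 1) * gaussmom a (gaussc eps b) /\
  2 * (eps * \int[mu]_(x in Dp) (gausss eps b x * (x * x `^ (a + 1)))
       - b * \int[mu]_(x in Dp) (gaussc eps b x * (x * x `^ (a + 1))))
    = (a + 1) * gaussmom a (gausss eps b).
Proof.
move=> a0 e0.
have a1 : 0 <= a + 1 by lra.
have m_a : measurable_fun Dp (fun x : R => x `^ a).
  by apply: measurable_funTS; exact: measurable_powR.
have [|||||H1 H2] := @gauss_ibp eps b (fun x => x `^ (a + 1)) (fun x => (a + 1) * x `^ a)
  (a + 1) (a + 1) a e0 a1 a0.
- by move=> x x0; apply: (is_derive_eq (is_derive1_powR (a + 1) x0)); rewrite addrK.
- move=> x x0; apply: continuousM1; first exact: cvg_cst.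
  exact: continuous_powR_pos.
- by move=> x x0; rewrite ger0_norm ?powR_ge0// ler_peMl ?powR_ge0//; lra.
- by move=> x x0; rewrite ger0_norm// mulr_ge0 ?powR_ge0.
- by apply: powR_cvg0; lra.
rewrite H1 H2 /gaussmom.
have b1 x : 0 < x -> `|x `^ a| <= 1 * x `^ a.
  by move=> x0; rewrite mul1r ger0_norm ?powR_ge0.
split; rewrite -RintegralZl//; try exact: measurable_Dp.
- by apply: eq_Rintegral => x _; ring.
- exact: (integrable_gmul e0 a0 (gauss_like_c eps b) m_a b1).
- by apply: eq_Rintegral => x _; ring.
- exact: (integrable_gmul e0 a0 (gauss_like_s eps b) m_a b1).
Qed.

Lemma is_derive_affine c m x : is_derive x 1 (fun y => c + y * m) m.
Proof.
apply: (is_derive_eq (is_derive1D (is_derive_cst c x 1)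
   (is_derive1M (is_derive_id x 1) (is_derive_cst m x 1)))).
by rewrite mul1r mulr0 addr0 add0r.
Qed.

(* [e^(-p x^2)] along the segment [p = (1 + tau e1) + i tau b1]. *)
Lemma is_derive_gaussmom (a e1 b1 tau : R) : 0 <= a -> 0 < 1 + tau * e1 ->
  let eps := 1 + tau * e1 in let b := 0 + tau * b1 in
  let Z e := \int[mu]_(x in Dp) (e x * (x * x `^ (a + 1))) in
  is_derive tau 1 (fun t => gaussmom a (gaussc (1 + t * e1) (0 + t * b1)))
    (- e1 * Z (gaussc eps b) - b1 * Z (gausss eps b)) /\
  is_derive tau 1 (fun t => gaussmom a (gausss (1 + t * e1) (0 + t * b1)))
    (- e1 * Z (gausss eps b) + b1 * Z (gaussc eps b)).
Proof.
move=> a0 e0 eps b Z; rewrite -/eps in e0.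
(* Half-width of a neighbourhood of [tau] on which the real part stays above eps / 2, so that one
   Gaussian dominates all derivatives there; the added 1 covers e1 = 0. *)
pose d := eps / (2 * (`|e1| + 1)).
have d0 : 0 < d by rewrite divr_gt0// mulr_gt0// ltr_wpDl.
have near_eps (t : R) : tau - d < t -> t < tau + d -> eps / 2 <= 1 + t * e1.
  move=> t1 t2; have ht : `|t - tau| <= d by rewrite ler_norml; lra.
  have : `|(t - tau) * e1| <= eps / 2.
    rewrite normrM; apply: (@le_trans _ _ (d * (`|e1| + 1))).
      by rewrite ler_pM// ler_wpDr.
    rewrite le_eqVlt /d; apply/orP; left; apply/eqP; field.
    by rewrite gt_eqF// ltr_wpDl.
  by rewrite ler_norml /eps => /andP[+ _]; lra.
have a2 : 0 <= a + 2 by lra.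
have eps20 : 0 < eps / 2 by rewrite divr_gt0.
have m_a : measurable_fun Dp (fun x : R => x `^ a).
  by apply: measurable_funTS; exact: measurable_powR.
have b_a x : 0 < x -> `|x `^ a| <= 1 * x `^ a.
  by move=> x0; rewrite mul1r ger0_norm ?powR_ge0.
have xx x : 0 < x -> x * x `^ (a + 1) = x ^+ 2 * x `^ a.
  move=> x0; rewrite powRDp//.
  by rewrite powRr1 ?(ltW x0)//; ring.
have xx2 x : 0 < x -> x * x `^ (a + 1) = x `^ (a + 2).
  move=> x0; rewrite xx// (powRDp a)//.
  by rewrite (powR_mulrn 2 (ltW x0)) mulrC.
have m_Z : measurable_fun Dp (fun x : R => x * x `^ (a + 1)).
  apply: measurable_funM => //; apply: measurable_funTS; exact: measurable_powR.
have b_Z x : 0 < x -> `|x * x `^ (a + 1)| <= 1 * x `^ (a + 2).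
  by move=> x0; rewrite xx2// mul1r ger0_norm ?powR_ge0.
have dbc (t x : R) : is_derive t 1 (fun t => gaussc (1 + t * e1) (0 + t * b1) x)
  (x ^+ 2 * (- e1 * gaussc (1 + t * e1) (0 + t * b1) x - b1 * gausss (1 + t * e1) (0 + t * b1) x)) /\
  is_derive t 1 (fun t => gausss (1 + t * e1) (0 + t * b1) x)
  (x ^+ 2 * (- e1 * gausss (1 + t * e1) (0 + t * b1) x + b1 * gaussc (1 + t * e1) (0 + t * b1) x)).
  have h : is_derive t 1 (fun t => - ((1 + t * e1) * x ^+ 2)) (- (e1 * x ^+ 2)).
    rewrite (_ : (fun y => _) = (fun y => - x ^+ 2 + y * (- (e1 * x ^+ 2)))).
      exact: is_derive_affine.
    by apply/funext => y; ring.
  have dE := is_derive1_fcomp (is_derive_expR _) h.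
  have dB : is_derive t 1 (fun t => (0 + t * b1) * x ^+ 2) (b1 * x ^+ 2).
    rewrite (_ : (fun y => _) = (fun y => 0 + y * (b1 * x ^+ 2))).
      exact: is_derive_affine.
    by apply/funext => y; ring.
  split.
  - apply: (is_derive_eq (is_derive1M dE (is_derive1_fcomp (is_derive_cos _) dB))).
    rewrite /gaussc /gausss; ring.
  - apply: (is_derive_eq (is_derive1M dE (is_derive1_fcomp (is_derive_sin _) dB))).
    rewrite /gaussc /gausss; ring.
have Gint : mu.-integrable Dp (EFin \o (fun x => (`|e1| + `|b1|) *
     (x `^ (a + 2) * expR (- (eps / 2 * x ^+ 2))))).
  by apply: integrable_pos_Ml; exact: integrable_gpow.
have gl e (t : R) : tau - d < t -> t < tau + d -> gauss_like (1 + t * e1) e ->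
    forall x, `|e x| <= expR (- (eps / 2 * x ^+ 2)).
  move=> t1 t2 [_ H] x; apply: (le_trans (H x)); rewrite ler_expR lerN2.
  by rewrite ler_wpM2r ?sqr_ge0// near_eps.
have dom (t y u v : R) : tau - d < t -> t < tau + d -> 0 < y ->
   `|u| <= expR (- (eps / 2 * y ^+ 2)) -> `|v| <= expR (- (eps / 2 * y ^+ 2)) ->
   `|y ^+ 2 * (- e1 * u + b1 * v) * y `^ a| <=
    (`|e1| + `|b1|) * (y `^ (a + 2) * expR (- (eps / 2 * y ^+ 2))).
  move=> t1 t2 y0 ub vb.
  rewrite mulrAC -xx// xx2// normrM ger0_norm ?powR_ge0// mulrCA ler_wpM2l ?powR_ge0//.
  apply: (le_trans (ler_normD _ _)); rewrite mulrDl lerD// normrM ?normrN ler_wpM2l//.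
have ltd : tau - d < tau by lra.
have gtd : tau < tau + d by lra.
have i_e e (t : R) : tau - d < t -> t < tau + d -> gauss_like (1 + t * e1) e ->
    mu.-integrable Dp (EFin \o (fun x => e x * x `^ a)).
  move=> t1 t2 ge; apply: (integrable_gmul _ a0 ge m_a b_a).
  exact: lt_le_trans (near_eps _ t1 t2).
have iZ e : gauss_like eps e -> mu.-integrable Dp (EFin \o (fun x => e x * (x * x `^ (a + 1)))).
  by move=> ge; exact: (integrable_gmul e0 a2 ge m_Z b_Z).
have iZc := iZ _ (gauss_like_c eps b); have iZs := iZ _ (gauss_like_s eps b).
have iZ1 := integrable_pos_Ml (- e1) iZc; have iZ2 := integrable_pos_Ml (- e1) iZs.
have iZ3 := integrable_pos_Ml b1 iZc; have iZ4 := integrable_pos_Ml b1 iZs.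
split.
- apply: (is_derive_eq (@is_derive_Rintegral R
    (fun t x => gaussc (1 + t * e1) (0 + t * b1) x * x `^ a)
    (fun t x => x ^+ 2 * (- e1 * gaussc (1 + t * e1) (0 + t * b1) x + b1 * - gausss (1 + t * e1) (0 + t * b1) x) * x `^ a)
    _ tau (tau - d) (tau + d) ltd gtd _ _ Gint _)).
  + by move=> t t1 t2; exact: (i_e _ t t1 t2 (gauss_like_c _ _)).
  + move=> t x t1 t2 x0; have [dd _] := dbc t x.
    apply: (is_derive_eq (is_derive1M dd (is_derive_cst (x `^ a) t 1))).
    by rewrite mulr0 addr0 mulrN.
  + move=> t x t1 t2 x0; apply: (dom t) => //.
      exact: (gl _ _ t1 t2 (gauss_like_c _ _)).
    by rewrite normrN; exact: (gl _ _ t1 t2 (gauss_like_s _ _)).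
  + rewrite /Z; cbv beta; rewrite -(Rintegral_posZl (- e1) iZc) -(Rintegral_posZl b1 iZs) -(Rintegral_posB iZ1 iZ4).
    apply: eq_Rintegral => x; rewrite inE/= in_itv/= andbT => x0; rewrite xx// -/eps -/b; ring.
- apply: (is_derive_eq (@is_derive_Rintegral R
    (fun t x => gausss (1 + t * e1) (0 + t * b1) x * x `^ a)
    (fun t x => x ^+ 2 * (- e1 * gausss (1 + t * e1) (0 + t * b1) x + b1 * gaussc (1 + t * e1) (0 + t * b1) x) * x `^ a)
    _ tau (tau - d) (tau + d) ltd gtd _ _ Gint _)).
  + by move=> t t1 t2; exact: (i_e _ t t1 t2 (gauss_like_s _ _)).
  + move=> t x t1 t2 x0; have [_ dd] := dbc t x.
    apply: (is_derive_eq (is_derive1M dd (is_derive_cst (x `^ a) t 1))).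
    by rewrite mulr0 addr0.
  + move=> t x t1 t2 x0; apply: (dom t) => //.
      exact: (gl _ _ t1 t2 (gauss_like_s _ _)).
    exact: (gl _ _ t1 t2 (gauss_like_c _ _)).
  + rewrite /Z; cbv beta; rewrite -(Rintegral_posZl (- e1) iZs) -(Rintegral_posZl b1 iZc) -(Rintegral_posD iZ2 iZ3).
    apply: eq_Rintegral => x; rewrite inE/= in_itv/= andbT => x0; rewrite xx// -/eps -/b; ring.
Qed.

End Gauss.

(** * The dispersive estimate and Weber's integral *)

Section BesselGauss.
Context {R : realType}.
Implicit Types (e h k p q f df : R -> R) (a x y c s t w eps m b C l al be : R).
Local Notation mu := (@lebesgue_measure R).
Local Notation Dp := (`]0%R, +oo[%classic : set R).

Lemma gausss0 eps : gausss eps 0 = (fun _ : R => 0).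
Proof. by apply/funext => x; rewrite /gausss mul0r sin0 mulr0. Qed.

Lemma gaussc0 eps : gaussc eps 0 = (fun x : R => expR (- (eps * x ^+ 2))).
Proof. by apply/funext => x; rewrite /gaussc mul0r cos0 mulr1. Qed.

Lemma gaussmom_cst0 a : gaussmom a (fun _ : R => 0) = 0.
Proof.
rewrite /gaussmom; under eq_Rintegral do rewrite mul0r.
by rewrite Rintegral_cst ?mul0r//; exact: measurable_Dp.
Qed.

(* [|∫ x^a e^(-p x^2) dx| |p|^((a+1)/2)] is constant along the segment from [1] to [p]. *)
Lemma gaussmom_norm a eps b : 0 <= a -> 0 < eps ->
  (gaussmom a (gaussc eps b) ^+ 2 + gaussmom a (gausss eps b) ^+ 2) *
    (eps ^+ 2 + b ^+ 2) `^ ((a + 1) / 2) = gaussmom a (gaussc 1 0) ^+ 2.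
Proof.
move=> a0 eps0; pose e1 := eps - 1.
pose M t := gaussmom a (gaussc (1 + t * e1) (0 + t * b)) * gaussmom a (gaussc (1 + t * e1) (0 + t * b))
   + gaussmom a (gausss (1 + t * e1) (0 + t * b)) * gaussmom a (gausss (1 + t * e1) (0 + t * b)).
pose q t := (1 + t * e1) * (1 + t * e1) + (0 + t * b) * (0 + t * b).
pose s := (a + 1) / 2.
(* [q] is |p|^2, hence the exponent (a+1)/2. Along the segment G' = - p' Z and 2 p Z = (a+1) G, so
   p^((a+1)/2) G is constant; [phi] is its squared modulus. *)
pose phi t := M t * q t `^ s.
have phiE (t : R) : 0 <= t <= 1 -> is_derive t 1 phi 0.
  move=> /andP[t0 t1].
  have epst : 0 < 1 + t * e1.
    rewrite /e1; have [->|tn0] := eqVneq t 0; first by rewrite mul0r addr0.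
    have tp : 0 < t by rewrite lt_neqAle eq_sym tn0.
    by have := mulr_gt0 tp eps0; nra.
  have q0 : 0 < q t by rewrite /q ltr_wpDr// ?mulr_gt0// -expr2 sqr_ge0.
  have [H1 H2] := gaussmom_ibp (0 + t * b) a0 epst.
  have [] := @is_derive_gaussmom R a e1 b t a0 epst.
  set Zc := Rintegral _ _ _ in H1 H2 *; set Zs := Rintegral _ _ _ in H1 H2 *.
  move=> dGc dGs.
  have dM := is_derive1D (is_derive1M dGc dGc) (is_derive1M dGs dGs).
  have dq := is_derive1D
    (is_derive1M (is_derive_affine 1 e1 t) (is_derive_affine 1 e1 t))
    (is_derive1M (is_derive_affine 0 b t) (is_derive_affine 0 b t)).
  have dqs := is_derive1_fcomp (is_derive1_powR s q0) dq.
  apply: (is_derive_eq (is_derive1M dM dqs)).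
  have -> : q t `^ s = q t * q t `^ (s - 1).
    by rewrite -[X in X * _]powRr1 ?(ltW q0)// -powRDp//; congr (_ `^ _); ring.
  rewrite -/(q t) /s.
  move: H1 H2; set Gc := gaussmom a (gaussc _ _); set Gs := gaussmom a (gausss _ _).
  move=> H1 H2.
  set ep := 1 + t * e1 in H1 H2 *; set bb := 0 + t * b in H1 H2 *.
  (* The relation 2 p Z = (a+1) G multiplied by the conjugate of p, separated into real and
     imaginary part. *)
  have HZc : q t * Zc = (a + 1) * (ep * Gc - bb * Gs) / 2.
    transitivity ((ep * ((a + 1) * Gc) - bb * ((a + 1) * Gs)) / 2); last by field.
    by rewrite -H1 -H2 /q -/ep -/bb; field.
  have HZs : q t * Zs = (a + 1) * (bb * Gc + ep * Gs) / 2.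
    transitivity ((bb * ((a + 1) * Gc) + ep * ((a + 1) * Gs)) / 2); last by field.
    by rewrite -H1 -H2 /q -/ep -/bb; field.
  transitivity (q t `^ ((a + 1) / 2 - 1) * (2 * Gc * (- e1 * (q t * Zc) - b * (q t * Zs))
     + 2 * Gs * (- e1 * (q t * Zs) + b * (q t * Zc)) +
     (Gc * Gc + Gs * Gs) * ((a + 1) / 2) * (2 * e1 * ep + 2 * b * bb))); first by ring.
  by rewrite HZc HZs; field.
have [||c _] := @MVT R phi (fun _ => 0) 0 1 ltr01.
- by move=> x; rewrite in_itv/= => /andP[x0 x1]; apply: phiE; rewrite !ltW.
- apply: derivable_within_continuous => x; rewrite in_itv/= => x01.
  by have [] := phiE x x01.
rewrite mul0r => /eqP; rewrite subr_eq0 /phi /M /q /e1 !mul1r !mul0r !addr0 !add0r.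
rewrite (addrC 1 (eps - 1)) subrK mulr1 mulr0 addr0 powR1 mulr1 -!expr2 => /eqP ->.
by rewrite gausss0 gaussmom_cst0 expr0n/= addr0.
Qed.

(* Abstracts [U w = w^(-nu) J_nu w] with [nu = (a - 1) / 2], [P = U'], [Q = U'']. *)
Record bessel_like a c0 (U P Q : R -> R) : Prop := BesselLike {
  bl_gt0 : 0 < c0;
  bl_U0 : U 0 = c0;
  bl_P0 : P 0 = 0;
  bl_dU : forall w : R, is_derive w 1 U (P w);
  bl_dP : forall w : R, is_derive w 1 P (Q w);
  bl_ode : forall w : R, w * Q w = - (w * U w) - a * P w;
  bl_U : forall w : R, `|U w| <= c0;
  bl_P : forall w : R, `|P w| <= c0 }.

(** The scale [l] multiplies both frequencies: l = 1 is the integral of interest, and at l = 0 it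
    degenerates to a Gaussian moment. [hprodx] carries the factor x produced by differentiation in
    [l]. *)
Definition hprod a (p q : R -> R) al be e l : R :=
  \int[mu]_(x in Dp) (e x * (x `^ a * (p (l * al * x) * q (l * be * x)))).
Definition hprodx a (p q : R -> R) al be e l : R :=
  \int[mu]_(x in Dp) (e x * (x * (x `^ a * (p (l * al * x) * q (l * be * x))))).

Lemma hprodC a p q al be e l : hprod a p q al be e l = hprod a q p be al e l.
Proof. by apply: eq_Rintegral => x _; rewrite (mulrC (p _)). Qed.

Lemma hprodxC a p q al be e l : hprodx a p q al be e l = hprodx a q p be al e l.
Proof. by apply: eq_Rintegral => x _; rewrite (mulrC (p _)). Qed.

Definition cbdd c (p : R -> R) := (forall x, {for x, continuous p}) /\ forall x, `|p x| <= c.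

Lemma continuous_scale c p : (forall x, {for x, continuous p}) ->
  forall x, {for x, continuous (fun y => p (c * y))}.
Proof.
move=> cp x; apply: (@continuous_comp _ _ _ (fun y => c * y) p); last exact: cp.
exact: (is_derive1_continuous (is_derive1_Zl c x)).
Qed.

Lemma hprod_integrable a c p q al be e eps l : 0 <= a -> 0 < eps -> gauss_like eps e ->
  cbdd c p -> cbdd c q ->
  mu.-integrable Dp (EFin \o (fun x => e x * (x `^ a * (p (l * al * x) * q (l * be * x))))).
Proof.
move=> a0 eps0 ge [cp bp] [cq bq].
apply: (@integrable_gmul _ eps _ _ (c * c) a) => //.
- apply: measurable_funM; first by apply: measurable_funTS; exact: measurable_powR.
  apply: measurable_funTS; apply: continuous_measurable1 => x.
  by apply: continuousM1; exact: continuous_scale.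
- move=> x x0; rewrite !normrM (ger0_norm (powR_ge0 _ _)) mulrC ler_wpM2r ?powR_ge0//.
  exact: ler_pM.
Qed.

Lemma hprodx_integrable a c p q al be e eps l : 0 <= a -> 0 < eps -> gauss_like eps e ->
  cbdd c p -> cbdd c q ->
  mu.-integrable Dp (EFin \o (fun x => e x * (x * (x `^ a * (p (l * al * x) * q (l * be * x)))))).
Proof.
move=> a0 eps0 ge [cp bp] [cq bq].
apply: (@integrable_gmul _ eps _ _ (c * c) (a + 1)) => //; first by lra.
- apply: measurable_funM => //.
  apply: measurable_funM; first by apply: measurable_funTS; exact: measurable_powR.
  apply: measurable_funTS; apply: continuous_measurable1 => x.
  by apply: continuousM1; exact: continuous_scale.
- move=> x x0; rewrite !normrM (ger0_norm (powR_ge0 _ _)) powRDp// powRr1 ?(ltW x0)//.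
  have -> : c * c * (x `^ a * x) = x * (x `^ a * (c * c)) by ring.
  rewrite (gtr0_norm x0) ler_wpM2l ?(ltW x0)// ler_wpM2l ?powR_ge0//.
  exact: ler_pM.
Qed.

Section System.
Variables (a c0 : R) (U P Q : R -> R).
Hypotheses (a0 : 0 <= a) (hU : bessel_like a c0 U P Q).

Let bU : cbdd c0 U.
Proof.
split=> x; last exact: (bl_U hU).
exact: (is_derive1_continuous (bl_dU hU x)).
Qed.

Let bP : cbdd c0 P.
Proof.
split=> x; last exact: (bl_P hU).
exact: (is_derive1_continuous (bl_dP hU x)).
Qed.

Lemma is_derive_scale (f df : R -> R) c x l : (forall w : R, is_derive w 1 f (df w)) ->
  is_derive l 1 (fun t => f (t * c * x)) (df (l * c * x) * (c * x)).
Proof.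
move=> fE.
have h : is_derive l 1 (fun t => t * c * x) (c * x).
  rewrite (_ : (fun t => _) = (fun t => 0 + t * (c * x))); first exact: is_derive_affine.
  by apply/funext => t; ring.
exact: (is_derive1_fcomp (fE _) h).
Qed.

Lemma is_derive_hprodU al be e eps l : 0 < eps -> gauss_like eps e ->
  is_derive l 1 (hprod a U U al be e)
    (al * hprodx a P U al be e l + be * hprodx a U P al be e l).
Proof.
move=> eps0 ge.
have iX := integrable_pos_Ml al (hprodx_integrable al be l a0 eps0 ge bP bU).
have iY := integrable_pos_Ml be (hprodx_integrable al be l a0 eps0 ge bU bP).
have ul : l - 1 < l by rewrite ltrBlDr ltrDl.
have lu : l < l + 1 by rewrite ltrDl.
have Gi : mu.-integrable Dp (EFin \o (fun x => (`|al| + `|be|) * (c0 * c0) * (x `^ (a + 1) * expR (- (eps * x ^+ 2))))).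
  by apply: integrable_pos_Ml; apply: integrable_gpow => //; rewrite addr_ge0.
have c00 : 0 <= c0 by exact: ltW (bl_gt0 hU).
apply: (is_derive_eq (@is_derive_Rintegral R
    (fun t x => e x * (x `^ a * (U (t * al * x) * U (t * be * x))))
    (fun t x => e x * (x `^ a * (P (t * al * x) * (al * x) * U (t * be * x)
        + U (t * al * x) * (P (t * be * x) * (be * x)))))
    _ l (l - 1) (l + 1) ul lu _ _ Gi _)).
- by move=> t _ _; exact: (hprod_integrable al be t a0 eps0 ge bU bU).
- move=> t x _ _ x0; do 2! apply: is_derive1_Ml.
  by apply: is_derive1M; apply: is_derive_scale; exact: (bl_dU hU).
- move=> t x _ _ x0; have [_ eb] := ge.
  rewrite !normrM (ger0_norm (powR_ge0 _ _)) powRDp// powRr1 ?(ltW x0)//.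
  have -> : (`|al| + `|be|) * (c0 * c0) * (x `^ a * x * expR (- (eps * x ^+ 2))) =
    expR (- (eps * x ^+ 2)) * (x `^ a * ((`|al| + `|be|) * (c0 * c0) * x)) by ring.
  apply: ler_pM => //; first by rewrite mulr_ge0 ?powR_ge0.
  rewrite ler_wpM2l ?powR_ge0//.
  apply: (le_trans (ler_normD _ _)); rewrite !normrM (gtr0_norm x0).
  have [[_ uU] [_ uP]] := (bU, bP).
  have -> : (`|al| + `|be|) * (c0 * c0) * x = c0 * (`|al| * x) * c0 + c0 * (c0 * (`|be| * x)) by ring.
  apply: lerD; apply: ler_pM => //; rewrite ?mulr_ge0 ?(ltW x0)//.
    by rewrite ler_wpM2r ?mulr_ge0 ?(ltW x0).
  by rewrite ler_wpM2r ?mulr_ge0 ?(ltW x0).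
- rewrite /hprodx -!Rintegral_posZl ?(hprodx_integrable al be l a0 eps0 ge bP bU) ?(hprodx_integrable al be l a0 eps0 ge bU bP)//.
  rewrite -Rintegral_posD//.
  by apply: eq_Rintegral => x _; ring.
Qed.

(** Bessel's equation removes the second derivative, which closes the system on products of [U] and
    [P] and produces the damping term in 2 a / l. *)
Lemma is_derive_hprodP al be e eps l : 0 < eps -> gauss_like eps e -> 0 < l ->
  is_derive l 1 (hprod a P P al be e)
    (- (al * hprodx a U P al be e l) - be * hprodx a P U al be e l
      - 2 * a / l * hprod a P P al be e l).
Proof.
move=> eps0 ge l0.
have iX := integrable_pos_Ml be (hprodx_integrable al be l a0 eps0 ge bP bU).
have iY := integrable_pos_Ml al (hprodx_integrable al be l a0 eps0 ge bU bP).
have iB := integrable_pos_Ml (2 * a / l) (hprod_integrable al be l a0 eps0 ge bP bP).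
have ul : l / 2 < l by rewrite ltr_pdivrMr// ltr_pMr// ltr1n.
have lu : l < 2 * l by rewrite ltr_pMl// ltr1n.
have c00 : 0 <= c0 by exact: ltW (bl_gt0 hU).
have c02 : 0 <= c0 * c0 by rewrite mulr_ge0.
have Gi : mu.-integrable Dp (EFin \o (fun x =>
    (`|al| + `|be|) * (c0 * c0) * (x `^ (a + 1) * expR (- (eps * x ^+ 2))) +
    (4 * a / l) * (c0 * c0) * (x `^ a * expR (- (eps * x ^+ 2))))).
  apply: integrable_posD; apply: integrable_pos_Ml; apply: integrable_gpow => //.
  by rewrite addr_ge0.
(* The derivative of P(t c x) in t, rewritten by Bessel's equation at w = t c x. The singular
   coefficient is a / t, bounded around [l] uniformly in x. *)
pose dq (t c x : R) : R := - (c * x) * U (t * c * x) - a / t * P (t * c * x).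
have dqE (t c x : R) : 0 < t -> Q (t * c * x) * (c * x) = dq t c x.
  move=> t0; have := bl_ode hU (t * c * x); rewrite /dq => H.
  have tn0 : t != 0 by rewrite gt_eqF.
  apply: (mulfI tn0); rewrite mulrBr.
  have -> : t * (a / t * P (t * c * x)) = a * P (t * c * x) by field.
  by move: H; set q := Q _; set p := P _; set u := U _ => H; lra.
apply: (is_derive_eq (@is_derive_Rintegral R
    (fun t x => e x * (x `^ a * (P (t * al * x) * P (t * be * x))))
    (fun t x => e x * (x `^ a * (dq t al x * P (t * be * x)
        + P (t * al * x) * dq t be x)))
    _ l (l / 2) (2 * l) ul lu _ _ Gi _)).
- by move=> t _ _; exact: (hprod_integrable al be t a0 eps0 ge bP bP).
- move=> t x tl _ x0; do 2! apply: is_derive1_Ml.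
  have t0 : 0 < t by apply: lt_trans tl; rewrite divr_gt0.
  by rewrite -!dqE//; apply: is_derive1M; apply: is_derive_scale; exact: (bl_dP hU).
- move=> t x tl _ x0; have [_ eb] := ge.
  have t0 : 0 < t by apply: lt_trans tl; rewrite divr_gt0.
  rewrite !normrM (ger0_norm (powR_ge0 _ _)) powRDp// powRr1 ?(ltW x0)//.
  have [[_ uU] [_ uP]] := (bU, bP).
  have at2 : a / t <= 2 * a / l.
    rewrite ler_pdivrMr// mulrAC ler_pdivlMr// [leRHS]mulrAC mulrC ler_wpM2r//.
    by move: tl; rewrite ltr_pdivrMr// mulrC => /ltW.
  have dqb (c : R) : `|dq t c x| <= (`|c| * x + 2 * a / l) * c0.
    rewrite /dq; apply: (le_trans (ler_normB _ _)); rewrite mulrDl !normrM normrN normrM (gtr0_norm x0).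
    apply: lerD; first by rewrite ler_wpM2l ?mulr_ge0 ?(ltW x0).
    rewrite -normrM (ger0_norm (_ : 0 <= a / t)) ?divr_ge0 ?(ltW t0)//.
    by apply: ler_pM => //; rewrite divr_ge0 ?(ltW t0).
  have -> : (`|al| + `|be|) * (c0 * c0) * (x `^ a * x * expR (- (eps * x ^+ 2))) +
    (4 * a / l) * (c0 * c0) * (x `^ a * expR (- (eps * x ^+ 2)))
    = expR (- (eps * x ^+ 2)) * (x `^ a * ((`|al| * x + 2 * a / l) * c0 * c0 + c0 * ((`|be| * x + 2 * a / l) * c0))) by field; rewrite gt_eqF.
  apply: ler_pM => //; first by rewrite mulr_ge0 ?powR_ge0.
  rewrite ler_wpM2l ?powR_ge0//.
  apply: (le_trans (ler_normD _ _)); rewrite !normrM.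
  by apply: lerD; apply: ler_pM.
- rewrite /hprodx /hprod -!Rintegral_posZl ?(hprodx_integrable al be l a0 eps0 ge bP bU)
    ?(hprodx_integrable al be l a0 eps0 ge bU bP) ?(hprod_integrable al be l a0 eps0 ge bP bP)//.
  rewrite -[X in _ = X - _ - _]mulN1r -Rintegral_posZl// -Rintegral_posB//; last first.
    exact: integrable_pos_Ml.
  rewrite -Rintegral_posB//; last first.
    have := integrable_posD (integrable_pos_Ml (-1) iY) (integrable_pos_Ml (-1) iX).
    apply: eq_integ_ext => x; ring.
  apply: eq_Rintegral => x _; rewrite /dq; field.
  by rewrite gt_eqF.
Qed.

Lemma continuous_hprodP al be e eps l : 0 < eps -> gauss_like eps e ->
  {for l, continuous (hprod a P P al be e)}.
Proof.
move=> eps0 ge.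
have ul : l - 1 < l by rewrite ltrBlDr ltrDl.
have lu : l < l + 1 by rewrite ltrDl.
have c00 : 0 <= c0 by exact: ltW (bl_gt0 hU).
have Gi : mu.-integrable Dp (EFin \o (fun x => c0 * c0 * (x `^ a * expR (- (eps * x ^+ 2))))).
  by apply: integrable_pos_Ml; apply: integrable_gpow.
apply: (@continuous_Rintegral R
  (fun t x => e x * (x `^ a * (P (t * al * x) * P (t * be * x)))) _ l _ _ ul lu _ _ Gi).
- by move=> t _ _; exact: (hprod_integrable al be t a0 eps0 ge bP bP).
- move=> t x _ _ _.
  have h c := is_derive_scale c x t (bl_dP hU).
  exact: (is_derive1_continuous (is_derive1_Ml (e x) (is_derive1_Ml (x `^ a) (is_derive1M (h al) (h be))))).
- move=> t x _ _ x0; have [_ eb] := ge; have [_ uP] := bP.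
  have -> : c0 * c0 * (x `^ a * expR (- (eps * x ^+ 2))) = expR (- (eps * x ^+ 2)) * (x `^ a * (c0 * c0)) by ring.
  rewrite !normrM (ger0_norm (powR_ge0 _ _)); apply: ler_pM => //.
    by rewrite !mulr_ge0 ?powR_ge0.
  rewrite ler_wpM2l ?powR_ge0//; exact: ler_pM.
Qed.

(** Bessel's equation says (w^a U')' = - w^a U. Hence x^a P(l al x) U(l be x) has derivative l be
    x^a P P - l al x^a U U, and [gauss_ibp] expresses the cross term [X] through [A] and [B]. *)
Lemma hprod_ibp al be eps b l : 0 < eps ->
  let A e := hprod a U U al be e l in let B e := hprod a P P al be e l in
  let X e := hprodx a P U al be e l in
  2 * (eps * X (gaussc eps b) + b * X (gausss eps b)) =
    l * be * B (gaussc eps b) - l * al * A (gaussc eps b) /\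
  2 * (eps * X (gausss eps b) - b * X (gaussc eps b)) =
    l * be * B (gausss eps b) - l * al * A (gausss eps b).
Proof.
move=> eps0 A B X.
have c00 : 0 <= c0 by exact: ltW (bl_gt0 hU).
have [[cU uU] [cP uP]] := (bU, bP).
pose h x := x `^ a * (P (l * al * x) * U (l * be * x)).
pose dh x := l * be * (x `^ a * (P (l * al * x) * P (l * be * x)))
   - l * al * (x `^ a * (U (l * al * x) * U (l * be * x))).
have cl (p : R -> R) (c x : R) : (forall x, {for x, continuous p}) -> {for x, continuous (fun y : R => p (c * y))}.
  by move=> cp; exact: continuous_scale.
have C0 : 0 <= c0 * c0 by rewrite mulr_ge0.
pose C := (1 + `|l * al| + `|l * be|) * (c0 * c0).
have C1 : c0 * c0 <= C by rewrite ler_peMl// -addrA lerDl addr_ge0.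
have [|||||H1 H2] := @gauss_ibp R eps b h dh C a a eps0 a0 a0.
- move=> x x0.
  have dsc (f df : R -> R) c : (forall w : R, is_derive w 1 f (df w)) ->
      is_derive x 1 (fun y => f (c * y)) (df (c * x) * c).
    by move=> fE; exact: (is_derive1_fcomp (fE _) (is_derive1_Zl c x)).
  apply: (is_derive_eq (is_derive1M (is_derive1_powR a x0)
    (is_derive1M (dsc _ _ (l * al) (bl_dP hU)) (dsc _ _ (l * be) (bl_dU hU))))).
  have := bl_ode hU (l * al * x); rewrite /dh.
  have -> : x `^ a = x * x `^ (a - 1) by rewrite mulrC -[X in _ * X]powRr1 ?(ltW x0)// -powRDp// subrK.
  set q := Q _; set p := P (l * al * x); set u := U (l * al * x).
  set p' := P (l * be * x); set u' := U (l * be * x); set z := x `^ _.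
  move=> H.
  transitivity (z * u' * (a * p + l * al * x * q) + x * z * p * p' * (l * be)); first by ring.
  by rewrite H; ring.
- move=> x x0; rewrite /dh.
  have cpa := @continuous_powR_pos _ a x x0.
  rewrite (_ : (fun y => _) = (fun y => l * be * (y `^ a * (P (l * al * y) * P (l * be * y)))
   + (- (l * al)) * (y `^ a * (U (l * al * y) * U (l * be * y))))); last by apply/funext=> y; ring.
  apply: continuousD1; apply: continuousM1; do ?[exact: cvg_cst];
    apply: continuousM1 => //; apply: continuousM1; exact: cl.
- move=> x x0; rewrite /h !normrM (ger0_norm (powR_ge0 _ _)) mulrC ler_wpM2r ?powR_ge0//.
  apply: le_trans C1; exact: ler_pM.
- move=> x x0; rewrite /dh; apply: (le_trans (ler_normB _ _)).
  rewrite !normrM (ger0_norm (powR_ge0 _ _)) -!normrM.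
  have h1 : `|l * be| * (x `^ a * `|P (l * al * x) * P (l * be * x)|) <= `|l * be| * (x `^ a * (c0 * c0)).
    by rewrite ler_wpM2l// ler_wpM2l ?powR_ge0// normrM ler_pM.
  have h2 : `|l * al| * (x `^ a * `|U (l * al * x) * U (l * be * x)|) <= `|l * al| * (x `^ a * (c0 * c0)).
    by rewrite ler_wpM2l// ler_wpM2l ?powR_ge0// normrM ler_pM.
  apply: (le_trans (lerD h1 h2)); rewrite /C.
  have : 0 <= c0 * c0 * x `^ a by rewrite mulr_ge0 ?powR_ge0.
  nra.
(* The boundary term at 0 vanishes because P 0 = 0; for a = 0 the factor x^a does not tend to 0. *)
- apply: (@squeeze_cvgr _ _ _ _ (fun x => - (c0 * `|P (l * al * x)|)) (fun x => c0 * `|P (l * al * x)|)).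
  + near=> x; rewrite -ler_norml /h !normrM (ger0_norm (powR_ge0 _ _)).
    have x1 : x <= 1 by near: x; exact: nbhs_right_le.
    have x0 : 0 < x by near: x; exact: nbhs_right_gt.
    have xa : x `^ a <= 1.
      by rewrite -(powRr0 x) ger_powR// x0.
    rewrite -[leRHS]mul1r; apply: ler_pM; rewrite ?powR_ge0 ?mulr_ge0//.
    by rewrite mulrC ler_wpM2r.
  + have L : c0 * `|P (l * al * x)| @[x --> 0^'+] --> c0 * `|P (l * al * 0)|.
      apply: cvg_at_right_filter; apply: cvgMl_tmp; apply: cvg_norm; exact: cl.
    by rewrite -[X in _ --> X]oppr0; apply: cvgN; move: L; rewrite mulr0 (bl_P0 hU) normr0 mulr0.
  + have L : c0 * `|P (l * al * x)| @[x --> 0^'+] --> c0 * `|P (l * al * 0)|.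
      apply: cvg_at_right_filter; apply: cvgMl_tmp; apply: cvg_norm; exact: cl.
    by move: L; rewrite mulr0 (bl_P0 hU) normr0 mulr0.
have key e : gauss_like eps e -> \int[mu]_(x in Dp) (e x * dh x) = l * be * B e - l * al * A e.
  move=> ge.
  have iA := hprod_integrable al be l a0 eps0 ge bU bU.
  have iB := hprod_integrable al be l a0 eps0 ge bP bP.
  rewrite /A /B /hprod -(Rintegral_posZl _ iA) -(Rintegral_posZl _ iB).
  rewrite -(Rintegral_posB (integrable_pos_Ml _ iB) (integrable_pos_Ml _ iA)).
  by apply: eq_Rintegral => x _; rewrite /dh; ring.
by rewrite -!key; [|exact: gauss_like_s|exact: gauss_like_c].
Unshelve. all: end_near. Qed.

Lemma hprodU0 al be e eps : 0 < eps -> gauss_like eps e ->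
  hprod a U U al be e 0 = c0 ^+ 2 * gaussmom a e.
Proof.
move=> eps0 ge; rewrite /hprod /gaussmom -Rintegral_posZl.
  by apply: eq_Rintegral => x _; rewrite !mul0r (bl_U0 hU); ring.
have := @integrable_gmul R eps e (fun x => x `^ a) 1 a eps0 a0 ge; apply.
  by apply: measurable_funTS; exact: measurable_powR.
by move=> x _; rewrite mul1r ger0_norm ?powR_ge0.
Qed.

Lemma hprodP0 al be e : hprod a P P al be e 0 = 0.
Proof.
rewrite /hprod; under eq_Rintegral do rewrite !mul0r (bl_P0 hU) !mulr0.
by rewrite Rintegral_cst ?mul0r//; exact: measurable_Dp.
Qed.

(* With [A = ∫ e^(-p x^2) U(l al x) U(l be x) x^a] and [B] its analogue for
   [U'], the energy [|A|^2 + |B|^2] decreases in [l]. *)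
Lemma hprod_energy al be eps b : 0 < eps ->
  hprod a U U al be (gaussc eps b) 1 ^+ 2 + hprod a U U al be (gausss eps b) 1 ^+ 2
  <= c0 ^+ 4 * (gaussmom a (gaussc eps b) ^+ 2 + gaussmom a (gausss eps b) ^+ 2).
Proof.
move=> eps0.
have gc := gauss_like_c eps b; have gs := gauss_like_s eps b.
pose Ac := hprod a U U al be (gaussc eps b); pose As := hprod a U U al be (gausss eps b).
pose Bc := hprod a P P al be (gaussc eps b); pose Bs := hprod a P P al be (gausss eps b).
pose Xc := hprodx a P U al be (gaussc eps b); pose Xs := hprodx a P U al be (gausss eps b).
pose Yc := hprodx a U P al be (gaussc eps b); pose Ys := hprodx a U P al be (gausss eps b).
pose N l := Ac l * Ac l + As l * As l + (Bc l * Bc l + Bs l * Bs l).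
pose dN l := 2 * (Ac l * (al * Xc l + be * Yc l) + As l * (al * Xs l + be * Ys l)
  + (Bc l * (- (al * Yc l) - be * Xc l - 2 * a / l * Bc l)
    + Bs l * (- (al * Ys l) - be * Xs l - 2 * a / l * Bs l))).
have dNE l : 0 < l -> is_derive l 1 N (dN l).
  move=> l0.
  have dAc := is_derive_hprodU al be l eps0 gc; have dAs := is_derive_hprodU al be l eps0 gs.
  have dBc := is_derive_hprodP al be eps0 gc l0; have dBs := is_derive_hprodP al be eps0 gs l0.
  apply: (is_derive_eq (is_derive1D (is_derive1D (is_derive1M dAc dAc) (is_derive1M dAs dAs))
     (is_derive1D (is_derive1M dBc dBc) (is_derive1M dBs dBs)))).
  rewrite /dN /Ac /As /Bc /Bs /Xc /Xs /Yc /Ys; ring.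
have dN0 l : 0 < l -> dN l <= 0.
  move=> l0; have q0 : 0 < eps ^+ 2 + b ^+ 2 by rewrite ltr_wpDr ?sqr_ge0 ?exprn_gt0.
  have [h1 h2] := hprod_ibp al be b l eps0.
  (* The second cross term is the first one with [al] and [be] exchanged. *)
  have [] := hprod_ibp be al b l eps0.
  rewrite !(hprodxC a P U be al) !(hprodC a U U be al) !(hprodC a P P be al).
  move: h1 h2; rewrite -/(Ac l) -/(As l) -/(Bc l) -/(Bs l) -/(Xc l) -/(Xs l) -/(Yc l) -/(Ys l).
  move=> h1 h2 h3 h4.
  (* The sign is read off after multiplication by |p|^2: the integrations by parts determine 2 p X
     and 2 p Y, and the conjugate of p turns these into the four formulas below. *)
  rewrite -(pmulr_rle0 _ q0) /dN.
  move: h1 h2 h3 h4; set xc := Xc l; set xs := Xs l; set yc := Yc l; set ys := Ys l.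
  set ac := Ac l; set as' := As l; set bc := Bc l; set bs := Bs l => h1 h2 h3 h4.
  have Hxc : 2 * (eps ^+ 2 + b ^+ 2) * xc = eps * (l * be * bc - l * al * ac) - b * (l * be * bs - l * al * as').
    by rewrite -h1 -h2; ring.
  have Hxs : 2 * (eps ^+ 2 + b ^+ 2) * xs = b * (l * be * bc - l * al * ac) + eps * (l * be * bs - l * al * as').
    by rewrite -h1 -h2; ring.
  have Hyc : 2 * (eps ^+ 2 + b ^+ 2) * yc = eps * (l * al * bc - l * be * ac) - b * (l * al * bs - l * be * as').
    by rewrite -h3 -h4; ring.
  have Hys : 2 * (eps ^+ 2 + b ^+ 2) * ys = b * (l * al * bc - l * be * ac) + eps * (l * al * bs - l * be * as').
    by rewrite -h3 -h4; ring.
  have -> : (eps ^+ 2 + b ^+ 2) * (2 * (ac * (al * xc + be * yc) + as' * (al * xs + be * ys) +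
      (bc * (- (al * yc) - be * xc - 2 * a / l * bc) + bs * (- (al * ys) - be * xs - 2 * a / l * bs)))) =
    ac * (al * (2 * (eps ^+ 2 + b ^+ 2) * xc) + be * (2 * (eps ^+ 2 + b ^+ 2) * yc))
    + as' * (al * (2 * (eps ^+ 2 + b ^+ 2) * xs) + be * (2 * (eps ^+ 2 + b ^+ 2) * ys))
    - bc * (al * (2 * (eps ^+ 2 + b ^+ 2) * yc) + be * (2 * (eps ^+ 2 + b ^+ 2) * xc))
    - bs * (al * (2 * (eps ^+ 2 + b ^+ 2) * ys) + be * (2 * (eps ^+ 2 + b ^+ 2) * xs))
    - (eps ^+ 2 + b ^+ 2) * (4 * a / l) * (bc ^+ 2 + bs ^+ 2) by ring.
  rewrite Hxc Hxs Hyc Hys.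
  (* All terms containing b cancel. What remains is minus l eps times a sum of squares, minus the
     damping term; it is nonpositive as eps > 0, l > 0 and a >= 0. *)
  have -> : forall z : R, ac * (al * (eps * (l * be * bc - l * al * ac) - b * (l * be * bs - l * al * as')) +
     be * (eps * (l * al * bc - l * be * ac) - b * (l * al * bs - l * be * as'))) +
   as' * (al * (b * (l * be * bc - l * al * ac) + eps * (l * be * bs - l * al * as')) +
      be * (b * (l * al * bc - l * be * ac) + eps * (l * al * bs - l * be * as'))) -
   bc * (al * (eps * (l * al * bc - l * be * ac) - b * (l * al * bs - l * be * as')) +
     be * (eps * (l * be * bc - l * al * ac) - b * (l * be * bs - l * al * as'))) -
   bs * (al * (b * (l * al * bc - l * be * ac) + eps * (l * al * bs - l * be * as')) +
     be * (b * (l * be * bc - l * al * ac) + eps * (l * be * bs - l * al * as'))) - z =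
   - (l * eps * ((al * ac - be * bc) ^+ 2 + (be * ac - al * bc) ^+ 2 +
      (al * as' - be * bs) ^+ 2 + (be * as' - al * bs) ^+ 2) + z) by move=> z; ring.
  rewrite oppr_le0 addr_ge0// mulr_ge0 ?addr_ge0 ?sqr_ge0//.
    by rewrite mulr_ge0 ?(ltW l0) ?(ltW eps0).
  by rewrite mulr_ge0 ?(ltW q0)// divr_ge0 ?(ltW l0)// mulr_ge0.
have cN : N x @[x --> 0^'+] --> N 0.
  apply: cvg_at_right_filter.
  have cA e : gauss_like eps e -> {for 0, continuous (hprod a U U al be e)}.
    by move=> ge; exact: (is_derive1_continuous (is_derive_hprodU al be 0 eps0 ge)).
  have cB e : gauss_like eps e -> {for 0, continuous (hprod a P P al be e)}.
    by move=> ge; exact: (@continuous_hprodP al be e eps 0 eps0 ge).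
  have cM f : {for 0, continuous f} -> {for 0, continuous (fun y => f y * f y)}.
    by move=> cf; exact: continuousM1.
  exact: (continuousD1 (continuousD1 (cM _ (cA _ gc)) (cM _ (cA _ gs)))
    (continuousD1 (cM _ (cB _ gc)) (cM _ (cB _ gs)))).
have := nincr_from0 dNE dN0 cN ler01.
have N0 : N 0 = c0 ^+ 4 * (gaussmom a (gaussc eps b) ^+ 2 + gaussmom a (gausss eps b) ^+ 2).
  rewrite /N /Ac /As /Bc /Bs (hprodU0 al be eps0 gc) (hprodU0 al be eps0 gs) !hprodP0.
  ring.
rewrite N0; apply: le_trans.
by rewrite /N !expr2 lerDl addr_ge0// -expr2 sqr_ge0.
Qed.

Lemma hprod_dispersive al be eps b : 0 < eps ->
  (hprod a U U al be (gaussc eps b) 1 ^+ 2 + hprod a U U al be (gausss eps b) 1 ^+ 2) *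
   (eps ^+ 2 + b ^+ 2) `^ ((a + 1) / 2) <= (c0 ^+ 2 * gaussmom a (gaussc 1 0)) ^+ 2.
Proof.
move=> eps0; rewrite exprMn -(gaussmom_norm b a0 eps0) mulrA -exprM.
by rewrite ler_wpM2r ?powR_ge0// hprod_energy.
Qed.

(** With be = 0 the second factor is the constant U 0 = c0 and the system closes on A alone: A' =
    -(al^2 / (2 eps)) l A. This is the Hankel transform of a Gaussian. *)
Lemma hankel_gauss al eps : 0 < eps ->
  hprod a U U al 0 (gaussc eps 0) 1 =
  c0 ^+ 2 * gaussmom a (gaussc eps 0) * expR (- (al ^+ 2 / (4 * eps))).
Proof.
move=> eps0; have gc := gauss_like_c eps 0.
have en0 : eps != 0 by rewrite gt_eqF.
pose A := hprod a U U al 0 (gaussc eps 0).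
pose phi l := A l * expR (al ^+ 2 / (4 * eps) * l ^+ 2).
have phiE l : is_derive l 1 phi 0.
  have dA := is_derive_hprodU al 0 l eps0 gc.
  have dE := is_derive1_fcomp (is_derive_expR _) (is_derive_sqrM (al ^+ 2 / (4 * eps)) l).
  apply: (is_derive_eq (is_derive1M dA dE)).
  have [h1 _] := hprod_ibp al 0 0 l eps0.
  rewrite -/(A l) mul0r addr0; move: h1; rewrite -/(A l) !mulr0 !mul0r addr0 sub0r.
  set X := hprodx _ _ _ _ _ _ _ => h1.
  have -> : X = - (l * al * A l) / (2 * eps) by rewrite -h1; field.
  by field.
have := @is_derive_0_is_cst R phi 1 0 phiE.
rewrite /phi expr1n mulr1 expr0n/= mulr0 expR0 mulr1 /A (hprodU0 al 0 eps0 gc) => <-.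
by rewrite -mulrA -expRD subrr expR0 mulr1.
Qed.

Lemma gaussmom_ge0 eps : 0 <= gaussmom a (gaussc eps 0).
Proof. by apply: Rintegral_ge0 => x _; rewrite gaussc0 mulr_ge0 ?expR_ge0 ?powR_ge0. Qed.

(** For real p the combination (A^2 - B^2) exp((al^2 + be^2) l^2 / (2 eps)) is nondecreasing in l,
    and it is positive at l = 0. So A has no zero on l >= 0, and the intermediate value theorem
    gives it the sign of A 0. *)
Lemma hprod_ge0 al be eps : 0 < eps -> 0 <= hprod a U U al be (gaussc eps 0) 1.
Proof.
move=> eps0; have gc := gauss_like_c eps 0.
have en0 : eps != 0 by rewrite gt_eqF.
pose A := hprod a U U al be (gaussc eps 0); pose B := hprod a P P al be (gaussc eps 0).
(* The alternative of a zero moment is settled by the energy bound, which then forces A 1 = 0. *)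
have := gaussmom_ge0 eps; rewrite le_eqVlt => /predU1P[G0|G0].
  have := hprod_energy al be 0 eps0; rewrite gausss0 gaussmom_cst0 -G0 expr0n/= addr0 mulr0.
  rewrite -/(A 1) => H.
  suff /eqP : A 1 ^+ 2 == 0 by move=> /eqP; rewrite sqrf_eq0 => /eqP ->.
  rewrite eq_le sqr_ge0 andbT; by apply: le_trans H; rewrite lerDl sqr_ge0.
have A0 : 0 < A 0 by rewrite /A (hprodU0 al be eps0 gc) mulr_gt0 ?exprn_gt0 ?(bl_gt0 hU).
pose m := al ^+ 2 + be ^+ 2.
pose phi l := (-1) * ((A l * A l + (-1) * (B l * B l)) * expR (m / (2 * eps) * l ^+ 2)).
pose dphi l := - (4 * a / l * B l ^+ 2 * expR (m / (2 * eps) * l ^+ 2)).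
have phiE l : 0 < l -> is_derive l 1 phi (dphi l).
  move=> l0; have ln0 : l != 0 by rewrite gt_eqF.
  have dA := is_derive_hprodU al be l eps0 gc.
  have dB := is_derive_hprodP al be eps0 gc l0.
  have dE := is_derive1_fcomp (is_derive_expR _) (is_derive_sqrM (m / (2 * eps)) l).
  apply: (is_derive_eq (is_derive1_Ml (-1) (is_derive1M (is_derive1D (is_derive1M dA dA)
     (is_derive1_Ml (-1) (is_derive1M dB dB))) dE))).
  have [h1 _] := hprod_ibp al be 0 l eps0.
  have [] := hprod_ibp be al 0 l eps0.
  rewrite !(hprodxC a P U be al) !(hprodC a U U be al) !(hprodC a P P be al).
  move: h1; rewrite /dphi -/(A l) -/(B l) /m.
  set X := hprodx _ _ _ _ _ (gaussc _ _) _; set Y := hprodx _ _ _ _ _ (gaussc _ _) _.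
  rewrite !mul0r !addr0 => h1 h2 _.
  have -> : X = (l * be * B l - l * al * A l) / (2 * eps) by rewrite -h1; field.
  have -> : Y = (l * al * B l - l * be * A l) / (2 * eps) by rewrite -h2; field.
  by set E := expR _; field; rewrite ?ln0 ?en0.
have dphi0 l : 0 < l -> dphi l <= 0.
  move=> l0; rewrite oppr_le0 mulr_ge0 ?expR_ge0// mulr_ge0 ?sqr_ge0// divr_ge0 ?(ltW l0)//.
  by rewrite mulr_ge0.
have cA l : {for l, continuous A}.
  exact: (is_derive1_continuous (is_derive_hprodU al be l eps0 gc)).
have cphi : phi x @[x --> 0^'+] --> phi 0.
  apply: cvg_at_right_filter.
  have cB : {for 0, continuous B} by exact: (@continuous_hprodP al be _ eps 0 eps0 gc).
  have cE := is_derive1_continuous (is_derive1_fcomp (is_derive_expR _) (is_derive_sqrM (m / (2 * eps)) 0)).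
  have cst1 : {for 0, continuous (fun _ : R => (-1 : R))} by exact: cvg_cst.
  have c1 := continuousD1 (continuousM1 (cA 0) (cA 0)) (continuousM1 cst1 (continuousM1 cB cB)).
  exact: (continuousM1 cst1 (continuousM1 c1 cE)).
have An0 l : 0 <= l -> A l != 0.
  move=> l0; apply/eqP => Al0.
  have := nincr_from0 phiE dphi0 cphi l0.
  have B0 : B 0 = 0 by exact: hprodP0.
  rewrite /phi Al0 B0.
  have : 0 <= B l * B l * expR (m / (2 * eps) * l ^+ 2) by rewrite mulr_ge0 ?expR_ge0// -expr2 sqr_ge0.
  have : 0 < A 0 * A 0 by rewrite mulr_gt0.
  have -> : m / (2 * eps) * 0 ^+ 2 = 0 by rewrite expr0n mulr0.
  rewrite expR0; nra.
rewrite leNgt; apply/negP => A1.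
have cAw : {within `[0, 1], continuous A} by apply: continuous_subspaceT => x; exact: cA.
have [|c] := IVT ler01 cAw (v := 0).
  by rewrite ge_min le_max (ltW A1) (ltW A0) orbT.
by rewrite in_itv/= => /andP[c00 _] /eqP; apply/negP; exact: An0.
Qed.

End System.
End BesselGauss.

(** * Bessel functions *)

Section GammaFunction.
Context {R : realType}.
Implicit Types (s x : R).
Local Notation mu := (@lebesgue_measure R).
Local Notation Dp := (`]0%R, +oo[%classic : set R).

Lemma powR_expRN_le s x : 0 < s -> 0 < x ->
  x `^ (s - 1) * expR (- x) <= (s + 1) `^ (s + 1) * x `^ (- 2).
Proof.
move=> s0 x0; have s1 : 0 < s + 1 by lra.
rewrite powRm2 ?(ltW x0)// ler_pdivlMr ?exprn_gt0// mulrAC -(powR_mulrn 2 (ltW x0)).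
rewrite -powRDp// (_ : s - 1 + 2 = s + 1); last by ring.
rewrite expRN ler_pdivrMr ?expR_gt0//; exact: powR_le_expR (ltW x0).
Qed.

Lemma measurable_gint s : measurable_fun Dp (fun x : R => x `^ (s - 1) * expR (- x)).
Proof.
apply: measurable_funTS; apply: measurable_funM; first exact: measurable_powR.
by apply: measurableT_comp => //.
Qed.

Lemma integrable_gint s : 0 < s ->
  mu.-integrable Dp (EFin \o (fun x : R => x `^ (s - 1) * expR (- x))).
Proof.
move=> s0.
apply: (@integrable_pos_dom R _ (Num.max 1 ((s + 1) `^ (s + 1))) s) => //.
- exact: measurable_gint.
- move=> x x0 x1; rewrite ger0_norm ?mulr_ge0 ?powR_ge0 ?expR_ge0//.
  rewrite mulrC ler_wpM2r ?powR_ge0// le_max; apply/orP; left.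
  by rewrite -[leRHS]expR0 ler_expR oppr_le0 ltW.
- move=> x x1; rewrite ger0_norm ?mulr_ge0 ?powR_ge0 ?expR_ge0//.
  apply: (le_trans (powR_expRN_le s0 (lt_le_trans ltr01 x1))).
  by rewrite ler_wpM2r ?powR_ge0// le_max lexx orbT.
Qed.

Lemma GammaS s : 0 < s -> Gamma (s + 1) = s * Gamma s.
Proof.
move=> s0; have s1 : 0 < s + 1 by lra.
have i1 := integrable_pos_Ml s (integrable_gint s0).
have i2 := integrable_gint s1.
have dE (x : R) : is_derive x 1 (fun y : R => expR (- y)) (- expR (- x)).
  have h : is_derive x 1 (fun y : R => - y) (- 1) by exact: is_deriveNid.
  by apply: (is_derive_eq (is_derive1_fcomp (is_derive_expR _) h)); rewrite mulrN1.
have : \int[mu]_(x in Dp) (s * (x `^ (s - 1) * expR (- x)) - x `^ (s + 1 - 1) * expR (- x)) = 0.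
  apply: (@Rintegral_derive0 _ (fun x => x `^ s * expR (- x))).
  - move=> x x0; apply: (is_derive_eq (is_derive1M (is_derive1_powR s x0) (dE x))).
    by rewrite addrK; ring.
  - move=> x x0; have cE := is_derive1_continuous (dE x).
    have c1 := @continuous_powR_pos _ (s - 1) x x0.
    have c2 := @continuous_powR_pos _ (s + 1 - 1) x x0.
    rewrite (_ : (fun y => _) = (fun y => s * (y `^ (s - 1) * expR (- y)) + (-1) * (y `^ (s + 1 - 1) * expR (- y)))).
      apply: continuousD1; apply: continuousM1; do ?[exact: cvg_cst]; exact: continuousM1.
    by apply/funext => y; ring.
  - have := integrable_posD i1 (integrable_pos_Ml (-1) i2).
    by apply: eq_integ_ext => x; ring.
  - rewrite -[X in _ --> X](mul0r (expR (- 0))); apply: cvgM; first exact: powR_cvg0.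
    by apply: cvg_at_right_filter; exact: (is_derive1_continuous (dE 0)).
  - apply/cvgrPdist_le => e e0; near=> x; rewrite sub0r normrN.
    have x0 : 0 < x by near: x; exact: nbhs_pinfty_gt.
    have xK : (s + 1 + 1) `^ (s + 1 + 1) / e <= x by near: x; apply: nbhs_pinfty_ge; exact: num_real.
    have x1 : 1 <= x by near: x; exact: nbhs_pinfty_ge.
    rewrite ger0_norm ?mulr_ge0 ?powR_ge0 ?expR_ge0//.
    have := powR_expRN_le s1 x0; rewrite addrK => /le_trans; apply.
    rewrite powRm2 ?(ltW x0)//.
    rewrite ler_pdivrMr ?exprn_gt0//; move: xK; rewrite ler_pdivrMr// => /le_trans; apply.
    by rewrite mulrC ler_wpM2l ?(ltW e0)// expr2 ler_pMr.
rewrite Rintegral_posB// Rintegral_posZl; last exact: integrable_gint.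
by move=> /eqP; rewrite subr_eq0 => /eqP H; exact: esym H.
Unshelve. all: end_near. Qed.

Lemma Gamma_gt0 s : 0 < s -> 0 < Gamma s.
Proof.
move=> s0; rewrite -lte_fin.
have fin : (\int[mu]_(x in Dp) (x `^ (s - 1) * expR (- x))%:E)%E \is a fin_num.
  exact: (@integrable_fin_num _ _ _ mu Dp measurable_Dp _ (integrable_gint s0)).
rewrite /Gamma /Rintegral fineK//.
(* Lower bound by the part over ]0, 1], where e^(-x) >= e^(-1). *)
apply: (@lt_le_trans _ _ ((expR (-1))%:E * (1 `^ s / s)%:E)%E).
  by rewrite -EFinM lte_fin mulr_gt0 ?expR_gt0 ?divr_gt0 ?powR_gt0.
rewrite -integral_powR_0c// -ge0_integralZl//=; last 2 first.
- by apply/measurable_EFinP/measurable_funTS; exact: measurable_powR.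
- by move=> x _; rewrite lee_fin powR_ge0.
apply: (@le_trans _ _ (\int[mu]_(x in `]0%R, 1%R]) (x `^ (s - 1) * expR (- x))%:E)%E).
  apply: ge0_le_integral => //.
  - by move=> x _; rewrite lee_fin mulr_ge0 ?powR_ge0 ?expR_ge0.
  - by apply/measurable_funeM/measurable_EFinP/measurable_funTS; exact: measurable_powR.
  - apply/measurable_EFinP; apply: measurable_funS (measurable_gint s) => //.
    by move=> x /=; rewrite !in_itv/= andbT => /andP[].
  - move=> x; rewrite /= in_itv/= => /andP[x0 x1].
    by rewrite -EFinM lee_fin mulrC ler_wpM2l ?powR_ge0// ler_expR lerN2.
apply: ge0_subset_integral => //.
- by apply/measurable_EFinP; exact: measurable_gint.
- by move=> x _; rewrite lee_fin mulr_ge0 ?powR_ge0 ?expR_ge0.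
- by move=> x /=; rewrite !in_itv/= andbT => /andP[].
Qed.

End GammaFunction.

(** * The entire function w^(-nu) J_nu(w) as a power series in w^2 *)

Section BesselSeries.
Context {R : realType}.
Implicit Types (c d : nat -> R) (a v C K x w : R).

(** A class of coefficients whose series are entire and which is stable under termwise
    differentiation with the same constant. *)
Definition fact_bdd C c := forall k, `|c k| <= C / k`!%:R.

Lemma fact_bdd_diffs C c : fact_bdd C c -> fact_bdd C (pseries_diffs c).
Proof.
move=> h k; rewrite /pseries_diffs normrM ger0_norm//.
have := h k.+1; rewrite factS natrM invfM mulrCA => H.
rewrite -ler_pdivlMl//; move: H; congr (_ <= _); ring.
Qed.

Lemma fact_bdd_cvg C c K : fact_bdd C c -> cvgn (pseries c K).
Proof.
move=> h; apply: normed_cvg.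
apply: (@series_le_cvg _ _ (fun k => C * exp_coeff `|K| k)).
- by move=> n; exact: normr_ge0.
- move=> n; rewrite mulr_ge0//; last by rewrite /exp_coeff/= divr_ge0 ?exprn_ge0.
  by have := h 0%N; rewrite fact0 divr1; apply: le_trans.
- move=> n /=; rewrite normrM normrX /exp_coeff/=.
  have -> : C * (`|K| ^+ n / n`!%:R) = C / n`!%:R * `|K| ^+ n by ring.
  by rewrite ler_wpM2r ?exprn_ge0//; exact: h.
- by apply: is_cvg_seriesZ; exact: is_cvg_series_exp_coeff.
Qed.

Lemma is_derive_pseries C c x : fact_bdd C c ->
  is_derive x 1 (fun y => limn (pseries c y)) (limn (pseries (pseries_diffs c) x)).
Proof.
move=> h; have h1 := fact_bdd_diffs h; have h2 := fact_bdd_diffs h1.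
apply: (@pseries_snd_diffs R c (`|x| + 1)); do ?[exact: fact_bdd_cvg].
by rewrite [ltRHS]ger0_norm ?addr_ge0// ltrDl.
Qed.

(** Coefficients in v = w^2 of w^(-nu) J_nu(w) for nu = (a-1)/2, so that nu + 1 = (a+1)/2: the power
    (1/2)^(2k+nu) gives 4^(-k) and the last factor. In particular [bcoef a 0] is 1 / (2^nu
    Gamma(nu+1)), the value at 0. *)
Definition bcoef (a : R) (k : nat) : R :=
  (-1) ^+ k / (k`!%:R * Gamma (k%:R + (a + 1) / 2)) * (4^-1) ^+ k * 2 `^ (- ((a - 1) / 2)).

(** Bessel's equation read on coefficients; it comes from the functional equations of Gamma and of
    the factorial. *)
Lemma bcoefS a k : 0 <= a ->
  4 * k.+1%:R * (k%:R + (a + 1) / 2) * bcoef a k.+1 = - bcoef a k.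
Proof.
move=> a0; rewrite /bcoef.
have s0 : 0 < k%:R + (a + 1) / 2 by rewrite ltr_wpDl// divr_gt0//; lra.
have -> : k.+1%:R + (a + 1) / 2 = k%:R + (a + 1) / 2 + 1 by rewrite -natr1; ring.
rewrite GammaS// factS natrM.
have G0 := Gamma_gt0 s0.
move: s0 G0; set s := _ + _ / 2; set G := Gamma s; set F := k`!%:R : R; set z := 2 `^ _.
move=> s0 G0; have F0 : 0 < F by rewrite ltr0n fact_gt0.
rewrite !exprS; field.
by rewrite !gt_eqF// ltr0n.
Qed.

Lemma bcoef_bdd a : 0 <= a -> fact_bdd (bcoef a 0) (bcoef a).
Proof.
move=> a0; have s0 : 0 < (a + 1) / 2 by rewrite divr_gt0//; lra.
have b0 : 0 < bcoef a 0.
  rewrite /bcoef !expr0 mulr1 mul1r fact0 mul1r add0r mulr_gt0 ?powR_gt0//.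
  by rewrite invr_gt0 Gamma_gt0.
elim=> [|k IH]; first by rewrite fact0 divr1 gtr0_norm.
have k0 : 0 < 4 * k.+1%:R * (k%:R + (a + 1) / 2).
  by rewrite mulr_gt0 ?mulr_gt0 ?ltr0n// ltr_wpDl.
have -> : `|bcoef a k.+1| = `|bcoef a k| / (4 * k.+1%:R * (k%:R + (a + 1) / 2)).
  have := congr1 Num.norm (bcoefS k a0); rewrite normrM normrN (gtr0_norm k0) => <-.
  by rewrite mulrAC mulfV ?mul1r// gt_eqF.
apply: (@le_trans _ _ (bcoef a 0 / k`!%:R / k.+1%:R)); last first.
  by rewrite factS natrM invfM mulrA mulrAC.
apply: ler_pM => //; first by rewrite invr_ge0 ltW.
(* The ratio of consecutive coefficients is at most 1 / (k+1), since 4 (k + (a+1)/2) >= 2. *)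
rewrite lef_pV2 ?posrE ?ltr0n// mulrAC ler_peMl ?ler0n//.
have : 0 <= k%:R :> R by exact: ler0n.
lra.
Qed.

(** [besU] is even and is treated as a function of v = w^2: [besV1] and [besV2] are its first two
    derivatives in v, and [besP], [besQ] follow by the chain rule. This keeps w = 0 and w < 0
    regular. *)
Definition besU a (w : R) : R := limn (pseries (bcoef a) (w ^+ 2)).
Definition besV1 a (v : R) : R := limn (pseries (pseries_diffs (bcoef a)) v).
Definition besV2 a (v : R) : R := limn (pseries (pseries_diffs (pseries_diffs (bcoef a))) v).
Definition besP a (w : R) : R := 2 * w * besV1 a (w ^+ 2).
Definition besQ a (w : R) : R := 2 * besV1 a (w ^+ 2) + 4 * w ^+ 2 * besV2 a (w ^+ 2).

Lemma bessel_pseries_ode a v : 0 <= a ->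
  4 * v * besV2 a v + 2 * (1 + a) * besV1 a v + limn (pseries (bcoef a) v) = 0.
Proof.
move=> a0; have h := bcoef_bdd a0.
have h1 := fact_bdd_diffs h; have h2 := fact_bdd_diffs h1.
have c0 := fact_bdd_cvg (K := v) h.
have c1 := fact_bdd_cvg (K := v) h1; have c2 := fact_bdd_cvg (K := v) h2.
(* The factor v raises the degree of the second-derivative series by one, so with n terms there and
   n + 1 terms elsewhere the combination of partial sums is exactly 0 by [bcoefS]. *)
have L : 4 * v * pseries (pseries_diffs (pseries_diffs (bcoef a))) v n +
    2 * (1 + a) * pseries (pseries_diffs (bcoef a)) v n.+1 +
    pseries (bcoef a) v n.+1 @[n --> \oo] -->
    4 * v * besV2 a v + 2 * (1 + a) * besV1 a v + limn (pseries (bcoef a) v).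
  apply: cvgD; [apply: cvgD|].
  - by apply: cvgMl_tmp.
  - by apply: cvgMl_tmp; rewrite (@cvg_shiftS _ (pseries (pseries_diffs (bcoef a)) v)).
  - by rewrite (@cvg_shiftS _ (pseries (bcoef a) v)).
have Z n : 4 * v * pseries (pseries_diffs (pseries_diffs (bcoef a))) v n +
    2 * (1 + a) * pseries (pseries_diffs (bcoef a)) v n.+1 +
    pseries (bcoef a) v n.+1 = 0.
  rewrite /pseries /series/=.
  have -> : 4 * v * (\sum_(0 <= k < n) pseries_diffs (pseries_diffs (bcoef a)) k * v ^+ k) =
     4 * \sum_(0 <= k < n.+1) (k%:R * pseries_diffs (bcoef a) k * v ^+ k).
    rewrite big_nat_recl//= mul0r mul0r add0r -mulrA mulr_sumr; congr (_ * _).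
    by apply: eq_bigr => k _; rewrite /pseries_diffs exprS; ring.
  rewrite !mulr_sumr -!big_split/= big1// => k _; rewrite /pseries_diffs.
  transitivity ((4 * k.+1%:R * (k%:R + (a + 1) / 2) * bcoef a k.+1 + bcoef a k) * v ^+ k).
    by field.
  by rewrite bcoefS// addNr mul0r.
apply: (cvg_unique _ L); first exact: Rhausdorff.
rewrite (_ : (fun n => _) = (fun _ => 0)); last exact/funext.
exact: cvg_cst.
Qed.

Lemma is_derive_besU a w : 0 <= a -> is_derive w 1 (besU a) (besP a w).
Proof.
move=> a0; have h := bcoef_bdd a0.
have H : is_derive w 1 (besU a) _ :=
  @is_derive1_fcomp R _ (fun y => y ^+ 2) w _ _ (is_derive_pseries (w ^+ 2) h) (is_derive1_exp 1 w).
apply: (is_derive_eq H).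
by rewrite /besP /besV1 expr1; ring.
Qed.

Lemma is_derive_besP a w : 0 <= a -> is_derive w 1 (besP a) (besQ a w).
Proof.
move=> a0; have h := fact_bdd_diffs (bcoef_bdd a0).
have H : is_derive w 1 (besP a) _ := is_derive1M (is_derive1_Zl 2 w)
  (@is_derive1_fcomp R _ (fun y => y ^+ 2) w _ _ (is_derive_pseries (w ^+ 2) h) (is_derive1_exp 1 w)).
apply: (is_derive_eq H).
by rewrite /besQ /besV1 /besV2 expr1; ring.
Qed.

(** Both sup bounds come from the energy U^2 + P^2: its derivative -(2 a / w) P^2 is nonpositive for
    w > 0, so it stays below its value c0^2 at 0. Negative w follow by parity. *)
Lemma bessel_like_bes a : 0 <= a ->
  bessel_like a (bcoef a 0) (besU a) (besP a) (besQ a).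
Proof.
move=> a0.
have s0 : 0 < (a + 1) / 2 by rewrite divr_gt0//; lra.
have b0 : 0 < bcoef a 0.
  rewrite /bcoef !expr0 mulr1 mul1r fact0 mul1r add0r mulr_gt0 ?powR_gt0//.
  by rewrite invr_gt0 Gamma_gt0.
have U0 : besU a 0 = bcoef a 0.
  rewrite /besU expr0n/=; apply/cvg_lim; first exact: Rhausdorff.
  rewrite -(@cvg_shiftS _ (pseries (bcoef a) 0)).
  rewrite (_ : (fun n => _) = (fun _ => bcoef a 0)); first exact: cvg_cst.
  apply/funext => n; rewrite /pseries /series/= big_nat_recl//= expr0 mulr1 big1 ?addr0// => k _.
  by rewrite expr0n mulr0.
have P0 : besP a 0 = 0 by rewrite /besP mulr0 mul0r.
have ode w : w * besQ a w = - (w * besU a w) - a * besP a w.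
  have := bessel_pseries_ode (w ^+ 2) a0; rewrite /besQ /besP -/(besU a w) => H.
  have {}H : besU a w = - (4 * w ^+ 2 * besV2 a (w ^+ 2)) - 2 * (1 + a) * besV1 a (w ^+ 2) by lra.
  by rewrite H; ring.
have dU w := is_derive_besU w a0; have dP w := is_derive_besP w a0.
have E w : 0 <= w -> besU a w ^+ 2 + besP a w ^+ 2 <= bcoef a 0 ^+ 2.
  move=> w0.
  pose N x := besU a x * besU a x + besP a x * besP a x.
  pose dN x := - (2 * a / x * besP a x ^+ 2).
  have NE x : 0 < x -> is_derive x 1 N (dN x).
    move=> x0; have xn0 : x != 0 by rewrite gt_eqF.
    apply: (is_derive_eq (is_derive1D (is_derive1M (dU x) (dU x)) (is_derive1M (dP x) (dP x)))).
    rewrite /dN; apply: (mulfI xn0).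
    transitivity (2 * besP a x * (x * besU a x + x * besQ a x)); first by ring.
    by rewrite ode; field.
  have N0 x : 0 < x -> dN x <= 0.
    by move=> x0; rewrite oppr_le0 mulr_ge0 ?sqr_ge0// divr_ge0 ?(ltW x0)// mulr_ge0.
  have cN : N x @[x --> 0^'+] --> N 0.
    apply: cvg_at_right_filter.
    exact: (is_derive1_continuous (is_derive1D (is_derive1M (dU 0) (dU 0)) (is_derive1M (dP 0) (dP 0)))).
  by have := nincr_from0 NE N0 cN w0; rewrite /N U0 P0 mulr0 addr0 -!expr2.
have Ea w : besU a w ^+ 2 + besP a w ^+ 2 <= bcoef a 0 ^+ 2.
  have [w0|w0] := leP 0 w; first exact: E.
  have := E (- w); rewrite oppr_ge0 => /(_ (ltW w0)).
  by rewrite /besU /besP !sqrrN mulrN mulNr sqrrN.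
split => // w; rewrite -ler_sqr ?nnegrE ?(ltW b0)// real_normK ?num_real//;
  apply: le_trans (Ea w).
- by rewrite lerDl sqr_ge0.
- by rewrite lerDr sqr_ge0.
Qed.

Lemma besselJ_besU a w : 0 <= a -> 0 < w ->
  w `^ ((1 - a) / 2) * besselJ ((a - 1) / 2) w = besU a w.
Proof.
move=> a0 w0; have w20 : 0 < w / 2 by rewrite divr_gt0.
have -> : besselJ ((a - 1) / 2) w = w `^ ((a - 1) / 2) * besU a w.
  rewrite /besselJ /besU.
  have -> : (fun k : nat => (-1) ^+ k / (k`!%:R * Gamma (k%:R + (a - 1) / 2 + 1)) * (w / 2) `^ (2 * k%:R + (a - 1) / 2))
     = w `^ ((a - 1) / 2) *: (fun k : nat => bcoef a k * (w ^+ 2) ^+ k).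
    apply/funext => k; rewrite /GRing.scale/= /bcoef.
    have -> : k%:R + (a - 1) / 2 + 1 = k%:R + (a + 1) / 2 by field.
    rewrite powRDp// powRrM (powR_mulrn k (powR_ge0 _ _)) (powR_mulrn 2 (ltW w20)).
    rewrite (@powRM _ w) ?(ltW w0)//.
    have -> : 2^-1 `^ ((a - 1) / 2) = 2 `^ (- ((a - 1) / 2)) :> R.
      by rewrite -powR_inv1// -powRrM mulN1r.
    have -> : ((w / 2) ^+ 2) ^+ k = (4^-1) ^+ k * (w ^+ 2) ^+ k.
      by rewrite -exprMn; congr (_ ^+ _); field.
    by rewrite /GRing.scale/=; ring.
  rewrite lim_seriesZ//; exact: (fact_bdd_cvg (bcoef_bdd a0)).
rewrite mulrA -powRDp// (_ : _ + _ = 0) ?powRr0 ?mul1r//.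
by field.
Qed.

End BesselSeries.

(** * Measurability and iterated integrals *)

Section Measurability.
Context {R : realType} {d : measure_display} {T : measurableType d}.
Implicit Types (f g h : T -> R).

Definition ind (b : bool) : R := if b then 1 else 0.

Lemma mesM f g : measurable_fun setT f -> measurable_fun setT g ->
  measurable_fun setT (fun x => f x * g x).
Proof. exact: measurable_funM. Qed.
Lemma mesD f g : measurable_fun setT f -> measurable_fun setT g ->
  measurable_fun setT (fun x => f x + g x).
Proof. exact: measurable_funD. Qed.
Lemma mesN f : measurable_fun setT f -> measurable_fun setT (fun x => - f x).
Proof. by move=> mf; exact: measurableT_comp. Qed.
Lemma mes_norm f : measurable_fun setT f -> measurable_fun setT (fun x => `|f x|).
Proof. by move=> mf; exact: measurableT_comp. Qed.
Lemma mesX n f : measurable_fun setT f -> measurable_fun setT (fun x => f x ^+ n).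
Proof. exact: measurable_funX. Qed.
Lemma mes_pow s f : measurable_fun setT f -> measurable_fun setT (fun x => f x `^ s).
Proof. by move=> mf; exact: (measurableT_comp (measurable_powR s)). Qed.
Lemma mes_comp (k : R -> R) f : measurable_fun setT k -> measurable_fun setT f ->
  measurable_fun setT (fun x => k (f x)).
Proof. by move=> mk mf; exact: (measurableT_comp mk mf). Qed.
Lemma mes_comp2 (k : R -> R -> R) f g :
  measurable_fun setT (fun p : R * R => k p.1 p.2) ->
  measurable_fun setT f -> measurable_fun setT g ->
  measurable_fun setT (fun x => k (f x) (g x)).
Proof.
by move=> mk mf mg; exact: (measurableT_comp mk (measurable_fun_pair mf mg)).
Qed.
Lemma mes_ind (b : T -> bool) : measurable_fun setT b ->
  measurable_fun setT (fun x => ind (b x)).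
Proof. by move=> mb; apply: measurable_fun_ifT. Qed.
Lemma mes_lt f g : measurable_fun setT f -> measurable_fun setT g ->
  measurable_fun setT (fun x => f x < g x).
Proof. exact: measurable_fun_ltr. Qed.
Lemma mes_le f g : measurable_fun setT f -> measurable_fun setT g ->
  measurable_fun setT (fun x => f x <= g x).
Proof. exact: measurable_fun_ler. Qed.
Lemma mes_inv f : measurable_fun setT f -> measurable_fun setT (fun x => (f x)^-1).
Proof.
move=> mf.
rewrite (_ : (fun x => _) = (fun x => ind (0 < f x) * f x `^ (-1) + - (ind (f x < 0) * (- f x) `^ (-1)))).
  apply: mesD; [|apply: mesN]; apply: mesM; do ?[by apply: mes_ind; exact: mes_lt].
    exact: mes_pow.
  by apply: mes_pow; exact: mesN.
apply/funext => x; rewrite /ind; case: (ltgtP 0 (f x)) => h.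
- by rewrite mul0r subr0 mul1r powR_inv1 ?ltW.
- by rewrite mul0r sub0r mul1r powR_inv1 ?oppr_ge0 ?ltW// invrN opprK.
- by rewrite -h invr0 !mul0r subrr.
Qed.

Lemma mes_sg f : measurable_fun setT f -> measurable_fun setT (fun x => Num.sg (f x)).
Proof.
move=> mf; rewrite (_ : (fun x => _) = (fun x => ind (0 < f x) + - ind (f x < 0))).
  apply: mesD; [|apply: mesN]; apply: mes_ind; exact: mes_lt.
by apply/funext => x; rewrite /ind; case: (sgrP (f x)) => h; rewrite ?subr0 ?sub0r.
Qed.

(** Tonelli treats the positive and the negative part, and [fine] is measurable; parameters at which
    the integral diverges are included, with the default value. *)
Lemma mes_Rint (G : T -> R -> R) :
  measurable_fun setT (fun p : T * R => G p.1 p.2) ->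
  measurable_fun setT (fun x => \int[@lebesgue_measure R]_y G x y).
Proof.
move=> mG; apply: (measurableT_comp (@fine_measurable R setT measurableT)).
rewrite (_ : (fun x => _) = (fun x =>
   (\int[@lebesgue_measure R]_y (Num.max (G x y) 0)%:E) -
   (\int[@lebesgue_measure R]_y (Num.max (- G x y) 0)%:E))%E); last first.
  apply/funext => x; rewrite integralE; congr (_ - _)%E.
  - by apply: eq_integral => y _; rewrite funeposE EFin_max.
  - by apply: eq_integral => y _; rewrite funenegE EFin_max.
apply: emeasurable_funB.
- apply: (@measurable_fun_fubini_tonelli_F _ _ T _ R (@lebesgue_measure R)
    (fun p => (Num.max (G p.1 p.2) 0)%:E)).
    by apply/measurable_EFinP; apply: measurable_maxr.
  by move=> p; rewrite lee_fin le_max lexx orbT.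
- apply: (@measurable_fun_fubini_tonelli_F _ _ T _ R (@lebesgue_measure R)
    (fun p => (Num.max (- G p.1 p.2) 0)%:E)).
    apply/measurable_EFinP; apply: measurable_maxr => //.
    exact: measurableT_comp.
  by move=> p; rewrite lee_fin le_max lexx orbT.
Qed.

Lemma mes_int_ge0 (G : T -> R -> R) :
  measurable_fun setT (fun p : T * R => G p.1 p.2) -> (forall x y, 0 <= G x y) ->
  measurable_fun setT (fun x => (\int[@lebesgue_measure R]_y (G x y)%:E)%E).
Proof.
move=> mG G0; apply: (@measurable_fun_fubini_tonelli_F _ _ T _ R (@lebesgue_measure R)
    (fun p => (G p.1 p.2)%:E)); first exact/measurable_EFinP.
by move=> p; rewrite lee_fin.
Qed.

End Measurability.

Ltac mes := repeat first
  [ assumption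
  | lazymatch goal with
    | |- measurable_fun _ (fun x => @?f x * @?g x) => apply: mesM
    | |- measurable_fun _ (fun x => @?f x + @?g x) => apply: mesD
    | |- measurable_fun _ (fun x => - @?f x) => apply: mesN
    | |- measurable_fun _ (fun x => `|@?f x|) => apply: mes_norm
    | |- measurable_fun _ (fun x => @?f x ^+ _) => apply: mesX
    | |- measurable_fun _ (fun x => @?f x `^ _) => apply: mes_pow
    | |- measurable_fun _ (fun x => (@?f x)^-1) => apply: mes_inv
    | |- measurable_fun _ (fun x => ind (@?f x)) => apply: mes_ind
    | |- measurable_fun _ (fun x => Num.sg (@?f x)) => apply: mes_sg
    | |- measurable_fun _ (fun x => @?f x < @?g x) => apply: mes_lt
    | |- measurable_fun _ (fun x => @?f x <= @?g x) => apply: mes_le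
    end
  | exact: measurable_cst | exact: measurable_id
  | exact: measurable_fst | exact: measurable_snd
  | exact: (measurableT_comp measurable_fst measurable_fst)
  | exact: (measurableT_comp measurable_snd measurable_fst)
  | exact: (measurableT_comp measurable_fst measurable_snd)
  | exact: (measurableT_comp measurable_snd measurable_snd)
  | apply: mesM | apply: mesD | apply: mesN | apply: mes_norm | apply: mesX
  | apply: mes_pow | apply: mes_ind | apply: mes_lt | apply: mes_le
  | apply: mes_inv | apply: mes_sg ].

(** * Fubini and Tonelli for real-valued iterated integrals on the line *)

Section Integrals.
Context {R : realType}.
Implicit Types (f g h u v w : R -> R) (G H : R -> R -> R).
Local Notation mu := (@lebesgue_measure R).
Local Notation intg f := (mu.-integrable setT (EFin \o f)).
Local Notation meas2 G := (measurable_fun setT (fun p : R * R => G p.1 p.2)).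

Lemma intg_meas f : intg f -> measurable_fun setT f.
Proof. by move=> /integrableP[/measurable_EFinP]. Qed.

Lemma intg_le f g : measurable_fun setT f -> (forall x, `|f x| <= g x) -> intg g -> intg f.
Proof.
move=> mf fg; apply: le_integrable => //; first exact/measurable_EFinP.
by move=> x _; rewrite lee_fin; apply: (le_trans (fg x)); exact: ler_norm.
Qed.

Lemma intgZ (c : R) f : intg f -> intg (fun x => c * f x).
Proof. by move=> h; exact: (@integrableZl _ _ _ mu setT measurableT c _ h). Qed.

Lemma intgD f g : intg f -> intg g -> intg (fun x => f x + g x).
Proof. by move=> hf hg; exact: (@integrableD _ _ _ mu setT measurableT _ _ hf hg). Qed.

Lemma intg_norm f : intg f -> intg (fun x => `|f x|).
Proof. exact: integrable_norm. Qed.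

Lemma RintE f : intg f -> (\int[mu]_x f x)%:E = (\int[mu]_x (f x)%:E)%E.
Proof. by move=> hf; rewrite /Rintegral fineK//; exact: integrable_fin_num. Qed.

Lemma RintZ (c : R) f : intg f -> \int[mu]_x (c * f x) = c * \int[mu]_x f x.
Proof. by move=> hf; exact: (@RintegralZl _ _ _ mu setT f c measurableT hf). Qed.

Lemma RintD f g : intg f -> intg g ->
  \int[mu]_x (f x + g x) = \int[mu]_x f x + \int[mu]_x g x.
Proof. by move=> hf hg; exact: (@RintegralD _ _ _ mu setT f g measurableT hf hg). Qed.

Lemma Rint_le f g : intg f -> intg g -> (forall x, f x <= g x) ->
  \int[mu]_x f x <= \int[mu]_x g x.
Proof. by move=> hf hg fg; apply: le_Rintegral. Qed.

Lemma Rint_norm_le f g : measurable_fun setT f -> intg g -> (forall x, `|f x| <= g x) ->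
  `|\int[mu]_x f x| <= \int[mu]_x g x.
Proof.
move=> mf hg fg; have hf := intg_le mf fg hg.
apply: (le_trans (le_normr_Rintegral _ hf)) => //.
by apply: Rint_le => //; exact: intg_norm.
Qed.

Lemma intg_ge0 f : measurable_fun setT f -> (forall x, 0 <= f x) ->
  (\int[mu]_x (f x)%:E < +oo)%E -> intg f.
Proof.
move=> mf f0 fi; apply/integrableP; split; first exact/measurable_EFinP.
by under eq_integral => x _ do rewrite /= ger0_norm//.
Qed.

Lemma int_ge0Z (c : R) f : measurable_fun setT f -> (forall x, 0 <= f x) -> 0 <= c ->
  (\int[mu]_x (c * f x)%:E = c%:E * \int[mu]_x (f x)%:E)%E.
Proof.
move=> mf f0 c0; under eq_integral do rewrite EFinM.
rewrite ge0_integralZl//; first exact/measurable_EFinP.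
by move=> x _; rewrite lee_fin.
Qed.

Lemma int_ge0D f g : measurable_fun setT f -> measurable_fun setT g ->
  (forall x, 0 <= f x) -> (forall x, 0 <= g x) ->
  (\int[mu]_x (f x + g x)%:E = \int[mu]_x (f x)%:E + \int[mu]_x (g x)%:E)%E.
Proof.
move=> mf mg f0 g0; under eq_integral do rewrite EFinD.
rewrite ge0_integralD//; try exact/measurable_EFinP.
all: by move=> x _; rewrite lee_fin.
Qed.

Lemma int_ge0_le f g : measurable_fun setT f -> measurable_fun setT g ->
  (forall x, 0 <= f x) -> (forall x, f x <= g x) ->
  (\int[mu]_x (f x)%:E <= \int[mu]_x (g x)%:E)%E.
Proof.
move=> mf mg f0 fg; apply: ge0_le_integral => //; try exact/measurable_EFinP.
- by move=> x _; rewrite lee_fin.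
- by move=> x _; rewrite lee_fin.
Qed.

Lemma tonelli G : meas2 G -> (forall x y, 0 <= G x y) ->
  (\int[mu]_x \int[mu]_y (G x y)%:E = \int[mu]_y \int[mu]_x (G x y)%:E)%E.
Proof.
move=> mG G0; apply: (@fubini_tonelli _ _ _ _ R mu mu (fun p => (G p.1 p.2)%:E)).
  exact/measurable_EFinP.
by move=> p; rewrite lee_fin.
Qed.

Lemma meas2C G : meas2 G -> measurable_fun setT (fun p : R * R => G p.2 p.1).
Proof. by move=> mG; apply: (mes_comp2 mG); mes. Qed.

Lemma meas2_1 G x : meas2 G -> measurable_fun setT (G x).
Proof. by move=> mG; apply: (mes_comp2 mG); mes. Qed.

Lemma meas2_2 G y : meas2 G -> measurable_fun setT (G ^~ y).
Proof. by move=> mG; apply: (mes_comp2 mG); mes. Qed.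

(** Absolute integrability makes the inner integral finite for almost every x, so [fine] inside
    alters it only on a null set. *)
Lemma iter_RintE G : meas2 G ->
  (\int[mu]_x \int[mu]_y `|G x y|%:E < +oo)%E ->
  \int[mu]_x \int[mu]_y G x y = fine (\int[mu]_x \int[mu]_y (G x y)%:E)%E.
Proof.
move=> mG Gi; rewrite /Rintegral; congr fine.
have mG' : measurable_fun setT (fun p : R * R => (G p.1 p.2)%:E) by exact/measurable_EFinP.
have /(integrable12ltyP mu mu mG') Ip : (\int[mu]_x \int[mu]_y `|(G x y)%:E| < +oo)%E by [].
apply: ae_eq_integral => //.
- by apply/measurable_EFinP; exact: mes_Rint.
- apply: measurable_fubini_F Ip.
- have := ae_integrable1 Ip; apply: filterS => x Ix _ /=.
  by rewrite fineK//; exact: (integrable_fin_num measurableT Ix).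
Qed.

Lemma Rint_swap G : meas2 G ->
  (\int[mu]_x \int[mu]_y `|G x y|%:E < +oo)%E ->
  \int[mu]_x \int[mu]_y G x y = \int[mu]_y \int[mu]_x G x y.
Proof.
move=> mG Gi; have mGC := meas2C mG.
have Gi' : (\int[mu]_y \int[mu]_x `|G x y|%:E < +oo)%E.
  by rewrite -(tonelli (G := fun x y => `|G x y|))//; mes.
rewrite iter_RintE// (iter_RintE mGC Gi'); congr fine.
have mG' : measurable_fun setT (fun p : R * R => (G p.1 p.2)%:E) by exact/measurable_EFinP.
apply: (@Fubini _ _ _ _ R mu mu (fun p => (G p.1 p.2)%:E)).
exact/(integrable12ltyP mu mu mG').
Qed.

Lemma iter_dom_lty G u v : meas2 G -> intg u -> intg v ->
  (forall x, 0 <= u x) -> (forall x, 0 <= v x) ->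
  (forall x y, `|G x y| <= u x * v y) ->
  (\int[mu]_x \int[mu]_y `|G x y|%:E < +oo)%E.
Proof.
move=> mG hu hv u0 v0 Guv.
apply: (@le_lt_trans _ _ (\int[mu]_x ((u x)%:E * \int[mu]_y (v y)%:E))%E).
  apply: ge0_le_integral => //.
  - by move=> x _; apply: integral_ge0 => y _; rewrite lee_fin.
  - by apply: (mes_int_ge0 (G := fun x y => `|G x y|)) => //; mes.
  - rewrite -(RintE hv); apply/measurable_EFinP; apply: mesM; mes; exact: intg_meas.
  - move=> x _; rewrite -int_ge0Z//; last exact: intg_meas.
    apply: int_ge0_le => //.
    + apply: mes_norm; exact: meas2_1.
    + by apply: mesM; mes; exact: intg_meas.
rewrite -(RintE hv).
under eq_integral do rewrite -EFinM mulrC.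
rewrite int_ge0Z//; [|exact: intg_meas|exact: Rintegral_ge0].
by rewrite -(RintE hu) -EFinM ltry.
Qed.

Lemma Rint_swap_dom G u v : meas2 G -> intg u -> intg v ->
  (forall x, 0 <= u x) -> (forall x, 0 <= v x) ->
  (forall x y, `|G x y| <= u x * v y) ->
  \int[mu]_x \int[mu]_y G x y = \int[mu]_y \int[mu]_x G x y.
Proof. by move=> mG hu hv u0 v0 Guv; apply: Rint_swap => //; exact: iter_dom_lty hu hv _ _ _. Qed.

(** Two exchanges of integration expand an integrated product of two integrals; g^2 is the
    integrable majorant in x, one g for each factor. It serves once for the space kernel of a form
    and once for the two time variables. *)
Lemma Rint_bilinear (H1 H2 : R -> R -> R) g h1 h2 : meas2 H1 -> meas2 H2 ->
  measurable_fun setT g -> intg (fun x => g x ^+ 2) -> intg h1 -> intg h2 ->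
  (forall x, 0 <= g x) -> (forall x, 0 <= h1 x) -> (forall x, 0 <= h2 x) ->
  (forall x t, `|H1 x t| <= g x * h1 t) -> (forall x t, `|H2 x t| <= g x * h2 t) ->
  \int[mu]_x ((\int[mu]_t H1 x t) * (\int[mu]_s H2 x s)) =
  \int[mu]_t \int[mu]_s \int[mu]_x (H1 x t * H2 x s).
Proof.
move=> mH1 mH2 mg ig2 ih1 ih2 g0 h10 h20 b1 b2.
have mI : measurable_fun setT (fun x => \int[mu]_s H2 x s) by exact: mes_Rint.
have bI x : `|\int[mu]_s H2 x s| <= g x * \int[mu]_s h2 s.
  rewrite -RintZ//; apply: Rint_norm_le => //; first exact: meas2_1.
  exact: intgZ.
have i1 x : intg (H1 x).
  apply: (intg_le _ (b1 x)); first exact: meas2_1.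
  exact: intgZ.
have i2 x : intg (H2 x).
  apply: (intg_le _ (b2 x)); first exact: meas2_1.
  exact: intgZ.
transitivity (\int[mu]_x \int[mu]_t ((\int[mu]_s H2 x s) * H1 x t)).
  by apply: eq_Rintegral => x _; rewrite RintZ// mulrC.
pose c := \int[mu]_s h2 s.
have c0 : 0 <= c by apply: Rintegral_ge0.
transitivity (\int[mu]_t \int[mu]_x ((\int[mu]_s H2 x s) * H1 x t)); last first.
  apply: eq_Rintegral => t _.
  transitivity (\int[mu]_x \int[mu]_s (H1 x t * H2 x s)).
    by apply: eq_Rintegral => x _; rewrite RintZ// mulrC.
  apply: (@Rint_swap_dom _ (fun x => g x ^+ 2) (fun s => h1 t * h2 s)) => //.
  - apply: mesM.
      by apply: (mes_comp2 mH1); mes.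
    by [].
  - exact: intgZ.
  - by move=> x; exact: sqr_ge0.
  - by move=> x; rewrite mulr_ge0.
  - move=> x s; rewrite normrM expr2 mulrACA; exact: ler_pM.
apply: (@Rint_swap_dom _ (fun x => g x ^+ 2) (fun t => c * h1 t)) => //.
- apply: mesM => //; apply: (measurableT_comp mI); mes.
- exact: intgZ.
- by move=> x; exact: sqr_ge0.
- by move=> x; rewrite mulr_ge0.
- move=> x t; rewrite normrM.
  have -> : g x ^+ 2 * (c * h1 t) = (g x * c) * (g x * h1 t) by ring.
  by apply: ler_pM => //; exact: bI.
Qed.

End Integrals.

(** * Interpolation of bilinear forms *)

Section Layers.
Context {R : realType}.
Implicit Types (f g h : R -> R) (c s x y : R).
Local Notation mu := (@lebesgue_measure R).
Local Notation intg f := (mu.-integrable setT (EFin \o f)).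
Local Notation meas2 G := (measurable_fun setT (fun p : R * R => G p.1 p.2)).
Local Notation ind := (@ind R).

Lemma ind_ge0 (b : bool) : 0 <= ind b. Proof. by rewrite /ind; case: b. Qed.
Lemma ind_le1 (b : bool) : ind b <= 1. Proof. by rewrite /ind; case: b. Qed.
Lemma norm_ind (b : bool) : `|ind b| = ind b.
Proof. by rewrite ger0_norm// ind_ge0. Qed.

Lemma measurable_fun_powT s (D : set R) : measurable_fun D (fun x : R => (x `^ s)%:E).
Proof. by apply/measurable_EFinP/measurable_funTS; exact: measurable_powR. Qed.

Lemma layer_le s c : 0 < s -> 0 <= c ->
  (\int[mu]_x (ind (0 < x) * ind (x <= c) * x `^ (s - 1))%:E = (c `^ s / s)%:E)%E.
Proof.
move=> s0; rewrite le_eqVlt => /predU1P[<-|c0].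
  rewrite powR0 ?gt_eqF// mul0r integral0_eq// => x _; rewrite /ind.
  by case: ltgtP => //=; rewrite ?mul0r// mulr0 mul0r.
rewrite -integral_powR_0c// [RHS]integral_mkcond; apply: eq_integral => x _.
rewrite patchE; case: ifPn => [/set_mem|/negP Hx].
  by rewrite /= in_itv/= /ind => /andP[-> ->]; rewrite !mul1r.
have : ~~ (0 < x <= c) by apply/negP => h; apply: Hx; apply/mem_set; rewrite /= in_itv.
by rewrite /ind; case: (0 < x) => /=; [move=> /negbTE ->|]; rewrite ?mulr0 !mul0r.
Qed.

Lemma layer_lt s c : 0 < s -> 0 <= c ->
  (\int[mu]_x (ind (0 < x) * ind (x < c) * x `^ (s - 1))%:E = (c `^ s / s)%:E)%E.
Proof.
move=> s0; rewrite le_eqVlt => /predU1P[<-|c0].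
  rewrite powR0 ?gt_eqF// mul0r integral0_eq// => x _; rewrite /ind.
  by case: ltgtP => //=; rewrite ?mul0r// mulr0 mul0r.
rewrite -integral_powR_0c// -integral_itv_bndo_bndc; last exact: measurable_fun_powT.
rewrite [RHS]integral_mkcond; apply: eq_integral => x _.
rewrite patchE; case: ifPn => [/set_mem|/negP Hx].
  by rewrite /= in_itv/= /ind => /andP[-> ->]; rewrite !mul1r.
have : ~~ (0 < x < c) by apply/negP => h; apply: Hx; apply/mem_set; rewrite /= in_itv.
by rewrite /ind; case: (0 < x) => /=; [move=> /negbTE ->|]; rewrite ?mulr0 !mul0r.
Qed.

Lemma Rint_abs_le h : measurable_fun setT h ->
  ((`|\int[mu]_x h x|)%:E <= \int[mu]_x (`|h x|)%:E)%E.
Proof.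
move=> mh; have mh' : measurable_fun setT (EFin \o h) by exact/measurable_EFinP.
apply: le_trans (le_abse_integral mu measurableT mh').
rewrite /Rintegral /comp; case: (\int[mu]_x _)%E => [r| |] //=.
- exact: leey.
- exact: leey.
Qed.

End Layers.

(** The choice kap = (M^2 a b)^(1/p), eta = (a/b)^(1/2) kap^(1-p/2) makes the three terms multiples
    of the same quantity M^(2/p-1) (a b)^(1/p). *)
Lemma optimize_param {R : realType} (p M C2 a b B : R) : 1 < p -> p < 2 ->
  0 < M -> 0 <= C2 -> 0 <= a -> 0 <= b ->
  (forall kap eta : R, 0 < kap -> 0 < eta ->
    B <= (M * kap `^ (1 - p) * a + C2 * eta) * (b / p)
      + C2 * eta^-1 * (kap `^ (2 - p) * a / (2 - p))) ->
  B <= ((1 + C2) / p + C2 / (2 - p)) * M `^ (2 / p - 1) * (a * b) `^ p^-1.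
Proof.
move=> p1 p2 M0 C20 a0 b0 H.
have p0 : 0 < p by lra.
have p20 : 0 < 2 - p by lra.
(* For a = 0 or b = 0 the balancing values degenerate; with kap = 1 and eta tending to 0,
   respectively to infinity, one gets B <= 0. *)
have small (K : R) : 0 <= K -> (forall e : R, 0 < e -> B <= K * e) -> B <= 0.
  move=> K0 h; rewrite leNgt; apply/negP => B0.
  have K1 : 0 < K + 1 by lra.
  have := h (B / (K + 1)) (divr_gt0 B0 K1); apply/negP; rewrite -ltNge.
  by rewrite mulrCA gtr_pMr// ltr_pdivrMr//; lra.
have Cp0 : 0 <= (1 + C2) / p + C2 / (2 - p).
  by rewrite addr_ge0// divr_ge0//; lra.
have rhs0 : 0 <= ((1 + C2) / p + C2 / (2 - p)) * M `^ (2 / p - 1) * (a * b) `^ p^-1.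
  by rewrite !mulr_ge0 ?powR_ge0.
move: a0; rewrite le_eqVlt => /predU1P[aE|a0].
  apply: (le_trans _ rhs0); apply: (small (C2 * (b / p))).
    by rewrite !mulr_ge0// invr_ge0 ltW.
  move=> e e0; apply: (le_trans (H 1 e ltr01 e0)); rewrite -aE !mulr0 mul0r mulr0 addr0 add0r.
  by rewrite le_eqVlt; apply/orP; left; apply/eqP; ring.
move: b0; rewrite le_eqVlt => /predU1P[bE|b0].
  apply: (le_trans _ rhs0); apply: (small (C2 * (a / (2 - p)))).
    by rewrite !mulr_ge0// ?invr_ge0 ltW.
  move=> e e0; have ei : 0 < e^-1 by rewrite invr_gt0.
  apply: (le_trans (H 1 _ ltr01 ei)); rewrite -bE !mul0r mulr0 add0r invrK powR1.
  by rewrite le_eqVlt; apply/orP; left; apply/eqP; ring.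
(* In logarithms the balancing equations are linear; [k] and [e] are the logarithms of kap and
   eta. *)
pose al := ln a; pose be := ln b; pose m := ln M.
have aE : a = expR al by rewrite lnK.
have bE : b = expR be by rewrite lnK.
have ME : M = expR m by rewrite lnK.
pose k := (2 * m + al + be) / p.
pose e := (al - be) / 2 + k * (1 - p / 2).
have := H (expR k) (expR e) (expR_gt0 _) (expR_gt0 _).
have X1 : M * expR k `^ (1 - p) * a * b = expR (m * (2 / p - 1) + (al + be) / p).
  rewrite -expRM aE bE ME -!expRD; congr expR; rewrite /k; field; lra.
have X2 : expR e * b = expR (m * (2 / p - 1) + (al + be) / p).
  rewrite bE -!expRD; congr expR; rewrite /e /k; field; lra.
have X3 : (expR e)^-1 * (expR k `^ (2 - p) * a) = expR (m * (2 / p - 1) + (al + be) / p).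
  rewrite -expRM aE -expRN -!expRD; congr expR; rewrite /e /k; field; lra.
have X4 : M `^ (2 / p - 1) * (a * b) `^ p^-1 = expR (m * (2 / p - 1) + (al + be) / p).
  by rewrite ME aE bE -expRD -!expRM -expRD.
move=> h; rewrite -mulrA X4; apply: (le_trans h); rewrite le_eqVlt; apply/orP; left; apply/eqP.
have -> : (M * expR k `^ (1 - p) * a + C2 * expR e) * (b / p) +
  C2 * (expR e)^-1 * (expR k `^ (2 - p) * a / (2 - p)) =
  (M * expR k `^ (1 - p) * a * b + C2 * (expR e * b)) / p +
  C2 * ((expR e)^-1 * (expR k `^ (2 - p) * a)) / (2 - p) by ring.
by rewrite X1 X2 X3; ring.
Qed.

(** * Interpolation between a sup bound on the kernel and an L^2 bound on the form *)

Section Interpolation.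
Context {R : realType}.
Implicit Types (f g h : R -> R) (c s x y z p m kap eta : R).
Local Notation mu := (@lebesgue_measure R).
Local Notation intg f := (mu.-integrable setT (EFin \o f)).
Local Notation meas2 G := (measurable_fun setT (fun p : R * R => G p.1 p.2)).
Local Notation ind := (@ind R).
Variables (w : R -> R) (W : R -> R -> R) (M : R).
Hypotheses (mw : measurable_fun setT w) (w0 : forall x, 0 <= w x)
  (mW : meas2 W) (M0 : 0 < M) (WM : forall y z, `|W y z| <= M).

(** On this class every form with a bounded kernel converges absolutely, and it is stable under
    multiplication by bounded measurable functions, hence under truncation. *)
Definition nice f := [/\ measurable_fun setT f,
  (exists K, forall x, `|f x| <= K) & intg (fun x => `|f x| * w x)].

Definition form f g : R := \int[mu]_z (g z * w z * \int[mu]_y (f y * w y * W y z)).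

Definition form_in f z : R := \int[mu]_y (f y * w y * W y z).

Lemma nice_mul f h c : nice f -> measurable_fun setT h -> (forall x, `|h x| <= c) ->
  nice (fun x => h x * f x).
Proof.
move=> [mf [K fK] inf] mh hc; split; first exact: mesM.
- by exists (c * K) => x; rewrite normrM ler_pM.
- apply: (intg_le _ _ (intgZ c inf)).
    by apply: mesM => //; apply: mes_norm; exact: mesM.
  move=> x; rewrite normrM normr_id (ger0_norm (w0 x)) normrM mulrA ler_wpM2r//.
  by rewrite ler_wpM2r.
Qed.

Lemma form_in_integrable f z : nice f -> intg (fun y => f y * w y * W y z).
Proof.
move=> nf; have [mf _ inf] := nf; apply: (intg_le _ _ (intgZ M inf)).
  by apply: mesM; [exact: mesM|exact: meas2_2].
move=> y; rewrite normrM normrM (ger0_norm (w0 y)) [leRHS]mulrC ler_wpM2l//.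
by rewrite mulr_ge0.
Qed.

Lemma measurable_form_in f : nice f -> measurable_fun setT (form_in f).
Proof.
move=> [mf _ _]; rewrite /form_in; apply: (@mes_Rint R _ _ (fun z y => f y * w y * W y z)).
apply: mesM; first by apply: mesM; apply: mes_comp => //; mes.
by apply: (mes_comp2 mW); mes.
Qed.

Lemma form_in_le f z : nice f -> `|form_in f z| <= M * \int[mu]_y (`|f y| * w y).
Proof.
move=> nf; have [mf _ inf] := nf; rewrite -RintZ//.
apply: Rint_norm_le; [exact: (intg_meas (form_in_integrable z nf))|exact: intgZ|].
move=> y; rewrite normrM normrM (ger0_norm (w0 y)) [leRHS]mulrC ler_wpM2l//.
by rewrite mulr_ge0.
Qed.

Lemma form_integrable f g : nice f -> nice g -> intg (fun z => g z * w z * form_in f z).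
Proof.
move=> nf ng; have [mg _ ing] := ng.
apply: (intg_le _ _ (intgZ (M * \int[mu]_y (`|f y| * w y)) ing)).
  by apply: mesM; [exact: mesM|exact: measurable_form_in].
move=> z; rewrite normrM normrM (ger0_norm (w0 z)) [leRHS]mulrC ler_wpM2l//.
  by rewrite mulr_ge0.
exact: form_in_le.
Qed.

Lemma form_le f g : nice f -> nice g ->
  `|form f g| <= M * (\int[mu]_y (`|f y| * w y)) * (\int[mu]_y (`|g y| * w y)).
Proof.
move=> nf ng; have [mg _ ing] := ng; rewrite -RintZ//.
apply: Rint_norm_le; [exact: (intg_meas (form_integrable nf ng))|exact: intgZ|].
move=> z; rewrite normrM normrM (ger0_norm (w0 z)) [leRHS]mulrC ler_wpM2l//.
  by rewrite mulr_ge0.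
exact: form_in_le.
Qed.

Lemma form_Dl f1 f2 g : nice f1 -> nice f2 -> nice g ->
  form (fun x => f1 x + f2 x) g = form f1 g + form f2 g.
Proof.
move=> n1 n2 ng; rewrite /form -RintD; [|exact: form_integrable|exact: form_integrable].
apply: eq_Rintegral => z _; rewrite -mulrDr; congr (_ * _).
rewrite -RintD; [|exact: form_in_integrable|exact: form_in_integrable].
by apply: eq_Rintegral => y _; ring.
Qed.

(** This invariance turns the symmetric L^2 bound into one with a free ratio [eta] between its two
    terms. *)
Lemma form_scale f g c : c != 0 -> nice f -> nice g ->
  form (fun x => c * f x) (fun x => c^-1 * g x) = form f g.
Proof.
move=> c0 nf ng; apply: eq_Rintegral => z _.
have -> : \int[mu]_y (c * f y * w y * W y z) = c * \int[mu]_y (f y * w y * W y z).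
  by rewrite -RintZ; [apply: eq_Rintegral => y _; ring|exact: form_in_integrable].
by field.
Qed.

Let sig g (m : R) z := Num.sg (g z) * ind (m < `|g z|).

Lemma sig_abs g m z : 0 < m -> `|sig g m z| = ind (m < `|g z|).
Proof.
move=> m0; rewrite /sig normrM norm_ind /ind normr_sg; case: ltP => // h; rewrite ?mulr0// mulr1.
by rewrite -normr_gt0 (lt_trans m0 h).
Qed.

Let msig g m : measurable_fun setT g -> measurable_fun setT (sig g m).
Proof. move=> mg; rewrite /sig; mes. Qed.

Let nsig g m : 0 < m -> nice g -> nice (sig g m).
Proof.
move=> m0 [mg [K gK] ing]; split; first exact: msig.
- by exists 1 => x; rewrite sig_abs// ind_le1.
- apply: (intg_le _ _ (intgZ m^-1 ing)).
    by apply: mesM => //; apply: mes_norm; exact: msig.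
  move=> x; rewrite normrM normr_id (ger0_norm (w0 x)) mulrA ler_wpM2r// sig_abs// /ind.
  case: ltP => h; last by rewrite mulr_ge0 ?invr_ge0 ?(ltW m0).
  by rewrite mulrC ler_pdivlMr// mul1r ltW.
Qed.

(* [g] is the integral over the levels [m] of [sgn g 1_(|g| > m)]. *)
Lemma form_layer f g : nice f -> nice g ->
  form f g = \int[mu]_m (ind (0 < m) * form f (sig g m)).
Proof.
move=> nf ng; have [mg [K gK] ing] := ng.
pose G z m := ind (0 < m) * (sig g m z * w z * form_in f z).
have mG : meas2 G.
  rewrite /G /sig; apply: mesM; first by mes.
  apply: mesM; last by apply: (mes_comp (k := form_in f)); [exact: measurable_form_in|mes].
  apply: mesM; last by apply: (mes_comp (k := w)); mes.
  apply: mesM; first by apply: mes_sg; apply: (mes_comp (k := g)); mes.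
  apply: mes_ind; apply: mes_lt; mes; apply: (mes_comp (k := g)); mes.
have lay z : (\int[mu]_m (ind (0 < m) * ind (m < `|g z|))%:E = (`|g z|)%:E)%E.
  have := @layer_lt R 1 `|g z| ltr01 (normr_ge0 _); rewrite powRr1// divr1 => <-.
  by apply: eq_integral => m _; rewrite subrr powRr0 mulr1.
have ilay z : intg (fun m => ind (0 < m) * ind (m < `|g z|)).
  apply: intg_ge0; first by mes.
    by move=> m; rewrite mulr_ge0 ?ind_ge0.
  by rewrite lay ltry.
have absG z m : `|G z m| = ind (0 < m) * ind (m < `|g z|) * (w z * `|form_in f z|).
  rewrite /G /ind; case: ltP => m0; last by rewrite !mul0r normr0.
  by rewrite !mul1r !normrM -normrM sig_abs// (ger0_norm (w0 z)) -mulrA.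
transitivity (\int[mu]_z \int[mu]_m G z m).
  apply: eq_Rintegral => z _.
  transitivity (\int[mu]_m ((Num.sg (g z) * w z * form_in f z) * (ind (0 < m) * ind (m < `|g z|)))).
    have -> : \int[mu]_m (Num.sg (g z) * w z * form_in f z * (ind (0 < m) * ind (m < `|g z|))) =
        Num.sg (g z) * w z * form_in f z * `|g z| by rewrite RintZ// /Rintegral lay.
    by rewrite -/(form_in f z) {1}(numEsg (g z)); ring.
  by apply: eq_Rintegral => m _; rewrite /G /sig; ring.
(* Fubini applies: integrating the absolute value over the levels restores |g|, and |form_in f| |g|
   w is integrable because [form_in f] is bounded. *)
rewrite Rint_swap//.
  apply: eq_Rintegral => m _; rewrite /G.
  case: (ltP 0 m) => m0; last first.
    rewrite /ind mul0r; under eq_Rintegral do rewrite mul0r.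
    by rewrite Rintegral_cst// mul0r.
  rewrite RintZ//; exact: form_integrable (nsig m0 ng).
pose c := M * \int[mu]_y (`|f y| * w y).
apply: (@le_lt_trans _ _ (\int[mu]_z (c * (`|g z| * w z))%:E)%E).
  have -> : (\int[mu]_z \int[mu]_m (`|G z m|)%:E = \int[mu]_z (w z * `|form_in f z| * `|g z|)%:E)%E.
    apply: eq_integral => z _; rewrite EFinM -lay -int_ge0Z.
    + by apply: eq_integral => m _; rewrite absG mulrC.
    + mes.
    + by move=> m; rewrite mulr_ge0 ?ind_ge0.
    + by rewrite mulr_ge0.
  apply: int_ge0_le.
  - by apply: mesM; [apply: mesM => //; apply: mes_norm; exact: measurable_form_in|exact: mes_norm].
  - by mes.
  - by move=> z; rewrite !mulr_ge0.
  - move=> z; have -> : w z * `|form_in f z| * `|g z| = `|form_in f z| * (`|g z| * w z) by ring.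
    by rewrite ler_wpM2r ?mulr_ge0//; exact: form_in_le.
by rewrite -(RintE (intgZ c ing)) ltry.
Qed.

Variable C2 : R.
Hypotheses (C20 : 0 <= C2) (L2 : forall f g, nice f -> nice g ->
  `|form f g| <= C2 * (\int[mu]_y (f y ^+ 2 * w y) + \int[mu]_y (g y ^+ 2 * w y))).

Lemma nice_sq f : nice f -> intg (fun y => f y ^+ 2 * w y).
Proof.
move=> [mf [K fK] inf]; apply: (intg_le _ _ (intgZ K inf)); first by mes.
move=> x; rewrite normrM normrX (ger0_norm (w0 x)) mulrA ler_wpM2r// expr2.
by rewrite ler_wpM2r.
Qed.

Lemma nice_pow p f : 1 < p -> nice f -> intg (fun y => `|f y| `^ p * w y).
Proof.
move=> p1 [mf [K fK] inf]; apply: (intg_le _ _ (intgZ (K `^ (p - 1)) inf)); first by mes.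
move=> x; rewrite normrM (ger0_norm (w0 x)) (ger0_norm (powR_ge0 _ _)) mulrA ler_wpM2r//.
rewrite -(mulr_powRB1 (normr_ge0 (f x))); last exact: lt_trans p1.
rewrite mulrC ler_wpM2r//; apply: ler_powRl => //; lra.
Qed.

Lemma form_L2_scaled f g (eta : R) : 0 < eta -> nice f -> nice g ->
  `|form f g| <= C2 * (eta^-1 * \int[mu]_y (f y ^+ 2 * w y) + eta * \int[mu]_y (g y ^+ 2 * w y)).
Proof.
move=> e0 nf ng; pose c := Num.sqrt eta^-1.
have c2 : c ^+ 2 = eta^-1 by rewrite sqr_sqrtr// invr_ge0 ltW.
have c0 : c != 0 by rewrite gt_eqF// sqrtr_gt0 invr_gt0.
have nZ (k : R) h : nice h -> nice (fun x => k * h x).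
  by move=> nh; apply: (@nice_mul h (fun _ => k) `|k|) => //.
rewrite -(form_scale c0 nf ng).
apply: (le_trans (L2 (nZ c f nf) (nZ c^-1 g ng))).
rewrite ler_wpM2l// le_eqVlt; apply/orP; left; apply/eqP; congr (_ + _).
- by rewrite -RintZ ?nice_sq//; apply: eq_Rintegral => x _; rewrite exprMn c2 mulrA.
- rewrite -RintZ ?nice_sq//; apply: eq_Rintegral => x _.
  by rewrite exprMn exprVn c2 invrK mulrA.
Qed.

(** [b] is the distribution function of g for the weight w, and [X] the squared L^2 norm of the part
    of f below the height kap / m. *)
Let b g (m : R) := \int[mu]_z (ind (m < `|g z|) * w z).
Let X f (kap m : R) := \int[mu]_z (ind (`|f z| * m <= kap) * (f z ^+ 2 * w z)).

Let ib g m : 0 < m -> nice g -> intg (fun z => ind (m < `|g z|) * w z).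
Proof.
move=> m0 ng; have [_ _] := nsig m0 ng.
by apply: eq_integrable => // z _ /=; rewrite sig_abs.
Qed.

Let iX f kap m : nice f -> intg (fun z => ind (`|f z| * m <= kap) * (f z ^+ 2 * w z)).
Proof.
move=> nf; have [mf _ _] := nf; apply: (intg_le _ _ (nice_sq nf)).
  by mes.
move=> x; have h : 0 <= f x ^+ 2 * w x by apply: mulr_ge0 => //; exact: sqr_ge0.
by rewrite normrM norm_ind (ger0_norm h) ler_piMl// ind_le1.
Qed.

(* The part of [f] above the height [kap / m] is estimated by the sup bound of
   the kernel, the part below by the [L^2] bound. *)
Lemma form_sig f g p (kap eta m : R) : 1 < p -> 0 < kap -> 0 < eta -> 0 < m ->
  nice f -> nice g ->
  `|form f (sig g m)| <=
    (M * kap `^ (1 - p) * \int[mu]_y (`|f y| `^ p * w y) + C2 * eta) * (m `^ (p - 1) * b g m)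
    + C2 * eta^-1 * (m `^ (1 - p) * X f kap m).
Proof.
move=> p1 k0 e0 m0 nf ng; have [mf _ _] := nf; have ns := nsig m0 ng.
have n1 : nice (fun y => ind (kap < `|f y| * m) * f y).
  apply: (@nice_mul _ _ 1) => //; first by mes.
  by move=> y; rewrite norm_ind ind_le1.
have n2 : nice (fun y => ind (`|f y| * m <= kap) * f y).
  apply: (@nice_mul _ _ 1) => //; first by mes.
  by move=> y; rewrite norm_ind ind_le1.
have -> : form f (sig g m) = form (fun y => ind (kap < `|f y| * m) * f y) (sig g m) +
    form (fun y => ind (`|f y| * m <= kap) * f y) (sig g m).
  rewrite -(form_Dl n1 n2 ns); apply: (congr1 (form ^~ (sig g m))).
  apply/funext => y; rewrite -mulrDl /ind.
  by case: ltP => _; rewrite ?addr0 ?add0r mul1r.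
apply: (le_trans (ler_normD _ _)).
(* With this power of m in the ratio of the two L^2 terms, integration over m turns both into L^p
   norms. *)
have e1 : 0 < eta * m `^ (p - 1) by rewrite mulr_gt0// powR_gt0.
have H1 := form_le n1 ns; have H2 := form_L2_scaled e1 n2 ns.
have E1 : \int[mu]_y (`|sig g m y| * w y) = b g m.
  by apply: eq_Rintegral => y _; rewrite sig_abs.
have E2 : \int[mu]_y (sig g m y ^+ 2 * w y) = b g m.
  apply: eq_Rintegral => y _; rewrite -(real_normK (num_real _)) sig_abs// /ind.
  by case: ifP => _; rewrite ?expr1n ?expr0n.
have E3 : \int[mu]_y ((ind (`|f y| * m <= kap) * f y) ^+ 2 * w y) = X f kap m.
  apply: eq_Rintegral => y _; rewrite exprMn mulrA /ind.
  by case: ifP => _; rewrite ?expr1n ?expr0n.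
(* Where |f| > kap / m one has |f| <= |f|^p (m / kap)^(p-1). *)
have E4 : \int[mu]_y (`|ind (kap < `|f y| * m) * f y| * w y) <=
    kap `^ (1 - p) * m `^ (p - 1) * \int[mu]_y (`|f y| `^ p * w y).
  have [_ _ i1] := n1.
  rewrite -RintZ ?nice_pow//; apply: Rint_le => //; first by apply: intgZ; exact: nice_pow.
  move=> y; rewrite mulrA ler_wpM2r// normrM norm_ind {1}/ind; case: ltP => h.
    rewrite mul1r -(mulr_powRB1 (normr_ge0 (f y))); last exact: lt_trans p1.
    have -> : kap `^ (1 - p) = (kap `^ (p - 1))^-1 by rewrite -powRN; congr (_ `^ _); ring.
    rewrite mulrCA ler_peMr// mulrAC -mulrA mulrC ler_pdivlMr ?powR_gt0// mul1r.
    rewrite -powRM//; last exact: ltW.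
    by apply: ler_powRl; [rewrite subr_ge0 ltW|exact: ltW|exact: ltW].
  by rewrite mul0r !mulr_ge0 ?powR_ge0.
have b0 : 0 <= b g m by apply: Rintegral_ge0 => z _; rewrite mulr_ge0 ?ind_ge0.
rewrite E1 in H1; rewrite E2 E3 in H2.
have H3 := le_trans H1 (ler_wpM2r b0 (ler_wpM2l (ltW M0) E4)).
apply: (le_trans (lerD H3 H2)); rewrite invfM -powRN opprB.
rewrite le_eqVlt; apply/orP; left; apply/eqP; ring.
Qed.

(** [form_sig] integrated over the levels. By Tonelli m^(p-1) b integrates to the integral of |g|^p
    w / p; for m^(1-p) X the level runs up to kap / |f|, which converges as p < 2 and gives
    kap^(2-p) / (2-p) times the integral of |f|^p w. *)
Lemma form_param f g p (kap eta : R) : 1 < p -> p < 2 -> 0 < kap -> 0 < eta ->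
  nice f -> nice g ->
  `|form f g| <= (M * kap `^ (1 - p) * \int[mu]_y (`|f y| `^ p * w y) + C2 * eta) *
      (\int[mu]_y (`|g y| `^ p * w y) / p)
    + C2 * eta^-1 * (kap `^ (2 - p) * \int[mu]_y (`|f y| `^ p * w y) / (2 - p)).
Proof.
move=> p1 p2 k0 e0 nf ng.
set Nf := \int[mu]_y (`|f y| `^ p * w y); set Ng := \int[mu]_y (`|g y| `^ p * w y).
have [mf _ _] := nf; have [mg _ _] := ng.
have p0 : 0 < p by exact: lt_trans p1.
have p20 : 0 < 2 - p by rewrite subr_gt0.
set A1 := M * _ * _ + _; set A2 := C2 * _.
have Nf0 : 0 <= Nf by apply: Rintegral_ge0 => y _; rewrite mulr_ge0 ?powR_ge0.
have A10 : 0 <= A1 by rewrite addr_ge0 ?mulr_ge0 ?powR_ge0 ?(ltW M0) ?(ltW e0).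
have A20 : 0 <= A2 by rewrite mulr_ge0 ?invr_ge0 ?(ltW e0).
rewrite (form_layer nf ng) -lee_fin.
have mh : measurable_fun setT (fun m : R => ind (0 < m) * form f (sig g m)).
  apply: mesM; first by mes.
  rewrite /form; apply: (@mes_Rint R _ _ (fun m z => sig g m z * w z * form_in f z)).
  apply: mesM; last by apply: (mes_comp (k := form_in f)); [exact: measurable_form_in|mes].
  apply: mesM; last by apply: (mes_comp (k := w)); mes.
  apply: mesM; first by apply: mes_sg; apply: (mes_comp (k := g)); mes.
  apply: mes_ind; apply: mes_lt; mes; apply: (mes_comp (k := g)); mes.
apply: (le_trans (Rint_abs_le mh)).
pose Fb (m z : R) : R := ind (0 < m) * m `^ (p - 1) * (ind (m < `|g z|) * w z).
pose FX (m z : R) : R := ind (0 < m) * m `^ (1 - p) * (ind (`|f z| * m <= kap) * (f z ^+ 2 * w z)).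
have mFb : meas2 Fb.
  rewrite /Fb; apply: mesM; first by mes.
  apply: mesM; last by apply: (mes_comp (k := w)); mes.
  by apply: mes_ind; apply: mes_lt; mes; apply: (mes_comp (k := g)); mes.
have mff : measurable_fun setT (fun q : R * R => f q.2) by apply: (mes_comp (k := f)); mes.
have mFX : meas2 FX.
  rewrite /FX; apply: mesM; first by mes.
  apply: mesM; last by apply: mesM; [mes|apply: (mes_comp (k := w)); mes].
  by apply: mes_ind; apply: mes_le; mes.
have Fb0 m z : 0 <= Fb m z by rewrite /Fb !mulr_ge0 ?ind_ge0 ?powR_ge0.
have fw0 z : 0 <= f z ^+ 2 * w z by apply: mulr_ge0 => //; exact: sqr_ge0.
have ifw0 (m : R) z : 0 <= ind (`|f z| * m <= kap) * (f z ^+ 2 * w z).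
  by apply: mulr_ge0 => //; exact: ind_ge0.
have im0 (m e : R) : 0 <= ind (0 < m) * m `^ e by rewrite mulr_ge0 ?ind_ge0 ?powR_ge0.
have FX0 m z : 0 <= FX m z by exact: mulr_ge0.
pose hb (m : R) : R := ind (0 < m) * m `^ (p - 1) * b g m.
pose hX (m : R) : R := ind (0 < m) * m `^ (1 - p) * X f kap m.
have hbE m : (hb m)%:E = (\int[mu]_z (Fb m z)%:E)%E.
  rewrite /hb /Fb; case: (ltP 0 m) => m0; last first.
    by rewrite /ind !mul0r integral0_eq// => z _; rewrite !mul0r.
  rewrite /b EFinM (RintE (ib m0 ng)) -int_ge0Z ?mulr_ge0 ?ind_ge0 ?powR_ge0//.
    by mes.
  by move=> z; rewrite mulr_ge0 ?ind_ge0.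
have hXE m : (hX m)%:E = (\int[mu]_z (FX m z)%:E)%E.
  rewrite /hX /FX /X EFinM (RintE (iX kap m nf)) -int_ge0Z ?mulr_ge0 ?ind_ge0 ?powR_ge0//.
  by mes.
have hb0 m : 0 <= hb m by rewrite -lee_fin hbE; apply: integral_ge0 => z _; rewrite lee_fin.
have hX0 m : 0 <= hX m by rewrite -lee_fin hXE; apply: integral_ge0 => z _; rewrite lee_fin.
have mhb : measurable_fun setT hb.
  apply/measurable_EFinP; rewrite (_ : _ \o _ = (fun m => (\int[mu]_z (Fb m z)%:E)%E)); last first.
    by apply/funext => m /=; rewrite hbE.
  exact: mes_int_ge0.
have mhX : measurable_fun setT hX.
  apply/measurable_EFinP; rewrite (_ : _ \o _ = (fun m => (\int[mu]_z (FX m z)%:E)%E)); last first.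
    by apply/funext => m /=; rewrite hXE.
  exact: mes_int_ge0.
apply: (@le_trans _ _ (\int[mu]_m (A1 * hb m + A2 * hX m)%:E)%E).
  apply: int_ge0_le => //; first by mes.
    by mes.
  move=> m; rewrite normrM norm_ind /hb /hX {1}/ind; case: (ltP 0 m) => m0; last first.
    by rewrite /ind !mul0r !mulr0 addr0.
  by rewrite /ind !mul1r; exact: form_sig.
rewrite int_ge0D; [|by mes|by mes|by move=> m; rewrite mulr_ge0|by move=> m; rewrite mulr_ge0].
clearbody A1 A2.
rewrite (int_ge0Z mhb hb0 A10) (int_ge0Z mhX hX0 A20) EFinD (EFinM A1) (EFinM A2).
apply: leeD; apply: lee_wpmul2l; rewrite ?lee_fin//.
- under eq_integral do rewrite hbE.
  rewrite tonelli// le_eqVlt; apply/orP; left; apply/eqP.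
  have gp0 z : 0 <= `|g z| `^ p * w z by rewrite mulr_ge0 ?powR_ge0.
  have mgp : measurable_fun setT (fun z => `|g z| `^ p * w z) by mes.
  have ip0 : 0 <= p^-1 by rewrite invr_ge0 ltW.
  rewrite mulrC EFinM (RintE (nice_pow p1 ng)) -(int_ge0Z mgp gp0 ip0).
  apply: eq_integral => z _.
  have -> : p^-1 * (`|g z| `^ p * w z) = w z * (`|g z| `^ p / p) by ring.
  have l0 m : 0 <= ind (0 < m) * ind (m < `|g z|) * m `^ (p - 1).
    by rewrite mulrAC; apply: mulr_ge0; [exact: im0|exact: ind_ge0].
  rewrite EFinM -(layer_lt p0 (normr_ge0 _)) -int_ge0Z//; last by mes.
  by apply: eq_integral => m _; rewrite /Fb; congr EFin; ring.
- under eq_integral do rewrite hXE.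
  rewrite tonelli// le_eqVlt; apply/orP; left; apply/eqP.
  have fp0 z : 0 <= `|f z| `^ p * w z by rewrite mulr_ge0 ?powR_ge0.
  have mfp : measurable_fun setT (fun z => `|f z| `^ p * w z) by mes.
  have ip0 : 0 <= kap `^ (2 - p) / (2 - p) by rewrite divr_ge0 ?powR_ge0 ?(ltW p20).
  have -> : kap `^ (2 - p) * Nf / (2 - p) = kap `^ (2 - p) / (2 - p) * Nf by ring.
  rewrite EFinM (RintE (nice_pow p1 nf)) -(int_ge0Z mfp fp0 ip0).
  apply: eq_integral => z _; rewrite /FX.
  (* Where f vanishes the threshold kap / |f| is meaningless, but the integrand carries f^2 = 0. *)
  have [fz0|fz0] := eqVneq (f z) 0.
    rewrite fz0 normr0 powR0 ?gt_eqF// mul0r mulr0 integral0_eq// => m _.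
    by rewrite expr0n/= (mul0r (w z)) !mulr0.
  have nf0 : 0 < `|f z| by rewrite normr_gt0.
  have k1 : 0 <= kap / `|f z| by rewrite divr_ge0 ?(ltW k0).
  have -> : kap `^ (2 - p) / (2 - p) * (`|f z| `^ p * w z) =
      (f z ^+ 2 * w z) * ((kap / `|f z|) `^ (2 - p) / (2 - p)).
    rewrite powRM ?invr_ge0 ?(ltW k0)// -(real_normK (num_real (f z))).
    have -> : `|f z| `^ p = `|f z| ^+ 2 * `|f z|^-1 `^ (2 - p).
      rewrite -(powR_mulrn 2 (ltW nf0)) -[X in X `^ (2 - p)]powR_inv1 ?(ltW nf0)// -powRrM -powRDp//.
      by congr (_ `^ _); ring.
    by ring.
  have l0 m : 0 <= ind (0 < m) * ind (m <= kap / `|f z|) * m `^ (2 - p - 1).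
    by rewrite mulrAC; apply: mulr_ge0; [exact: im0|exact: ind_ge0].
  rewrite EFinM -(layer_le p20 k1) -int_ge0Z//; last by mes.
  apply: eq_integral => m _; congr EFin.
  rewrite (_ : 2 - p - 1 = 1 - p); last by ring.
  have -> : (m <= kap / `|f z|) = (`|f z| * m <= kap) by rewrite ler_pdivlMr// mulrC.
  by ring.
Qed.

Lemma form_interp f g p : 1 < p -> p < 2 -> nice f -> nice g ->
  `|form f g| <= ((1 + C2) / p + C2 / (2 - p)) * M `^ (2 / p - 1) *
    ((\int[mu]_y (`|f y| `^ p * w y)) * \int[mu]_y (`|g y| `^ p * w y)) `^ p^-1.
Proof.
move=> p1 p2 nf ng; apply: optimize_param => //.
- by apply: Rintegral_ge0 => y _; rewrite mulr_ge0 ?powR_ge0.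
- by apply: Rintegral_ge0 => y _; rewrite mulr_ge0 ?powR_ge0.
- by move=> kap eta k0 e0; exact: form_param.
Qed.

End Interpolation.

(** * The Hardy-Littlewood-Sobolev inequality on the line *)

Section HLS.
Context {R : realType}.
Implicit Types (f g h phi : R -> R) (c d s t u x y z p q rho lam beta N : R).
Local Notation mu := (@lebesgue_measure R).
Local Notation intg f := (mu.-integrable setT (EFin \o f)).
Local Notation meas2 G := (measurable_fun setT (fun p : R * R => G p.1 p.2)).
Local Notation Dp := (`]0%R, +oo[%classic : set R).
Local Notation ind := (@ind R).

(** Lebesgue measure is determined by its values on half-open intervals, so it equals its
    pushforward by such a map; translations and the reflection are the instances used. *)
Lemma int_invariant (psi : R -> R) (mpsi : measurable_fun setT psi) g :
  (forall a b : R, a < b -> mu (psi @^-1` `]a, b]) = (b - a)%:E) ->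
  measurable_fun setT g -> (forall x, 0 <= g x) ->
  (\int[mu]_x (g (psi x))%:E = \int[mu]_x (g x)%:E)%E.
Proof.
move=> H mg g0.
pose m : {measure set (measurableTypeR R) -> \bar R} :=
  @measure_function_pushforward__canonical__measure_function_Measure _ _
    (measurableTypeR R) (measurableTypeR R) R (@lebesgue_measure R) psi mpsi.
have mE A : measurable A -> lebesgue_measure A = m A.
  apply: lebesgue_measure_unique => X [[a b] _ <-] /=.
  rewrite /m /= /pushforward lebesgue_measure_itv/= lte_fin.
  case: ltP => ab; first by rewrite H// EFinB.
  by rewrite set_itv_ge ?preimage_set0 ?measure0// bnd_simp -leNgt.
have mg' : measurable_fun setT (EFin \o g) by exact/measurable_EFinP.
have := @ge0_integral_pushforward _ _ (measurableTypeR R) (measurableTypeR R) R psi mpsi mu setT (EFin \o g) measurableT mg'.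
rewrite preimage_setT => <-; last by move=> x _; rewrite lee_fin.
apply: esym; apply: (@eq_measure_integral _ _ _ setT m mu) => A mA _; exact: mE.
Qed.

Lemma int_shift g d : measurable_fun setT g -> (forall x, 0 <= g x) ->
  (\int[mu]_x (g (d + x))%:E = \int[mu]_x (g x)%:E)%E.
Proof.
move=> mg g0; apply: (@int_invariant (fun x => d + x)) => //; first by mes.
move=> a b ab.
have -> : (fun x => d + x) @^-1` `]a, b] = `]a - d, b - d]%classic.
  apply/seteqP; split => x /=; rewrite !in_itv/= => /andP[h1 h2]; apply/andP; split; lra.
rewrite lebesgue_measure_itv/= lte_fin ltrD2r ab -EFinB; congr EFin; ring.
Qed.

Lemma int_opp g : measurable_fun setT g -> (forall x, 0 <= g x) ->
  (\int[mu]_x (g (- x))%:E = \int[mu]_x (g x)%:E)%E.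
Proof.
move=> mg g0; apply: (@int_invariant (fun x => - x)) => //; first by mes.
move=> a b ab.
have -> : (fun x : R => - x) @^-1` `]a, b] = `[- b, - a[%classic.
  apply/seteqP; split => x /=; rewrite !in_itv/= => /andP[h1 h2]; apply/andP; split; lra.
rewrite lebesgue_measure_itv/= lte_fin ltrN2 ab -EFinB; congr EFin; ring.
Qed.

Lemma int_abs_le g : measurable_fun setT g -> (forall x, 0 <= g x) -> g 0 = 0 ->
  (\int[mu]_x (g `|x|)%:E <= 2%:E * \int[mu]_(x in Dp) (g x)%:E)%E.
Proof.
move=> mg g0 gz.
have mi : measurable_fun setT (fun x => ind (0 < x) * g x) by mes.
have i0 x : 0 <= ind (0 < x) * g x by rewrite mulr_ge0// /ind; case: ifP.
have -> : (\int[mu]_(x in Dp) (g x)%:E = \int[mu]_x (ind (0 < x) * g x)%:E)%E.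
  rewrite integral_mkcond; apply: eq_integral => x _.
  rewrite patchE; case: ifPn => [/set_mem|/negP Hx].
    by rewrite /= in_itv/= andbT /ind => ->; rewrite mul1r.
  rewrite /ind; case: ifPn => h; last by rewrite mul0r.
  by exfalso; apply: Hx; apply/mem_set; rewrite /= in_itv/= h.
have mi' : measurable_fun setT (fun x => ind (0 < - x) * g (- x)).
  by apply: mesM; mes; apply: (mes_comp (k := g)); mes.
have -> : (2%:E * \int[mu]_x (ind (0 < x) * g x)%:E =
   \int[mu]_x (ind (0 < x) * g x + ind (0 < - x) * g (- x))%:E)%E.
  by rewrite int_ge0D//; rewrite (int_opp mi i0) mule_natl mule2n.
apply: int_ge0_le => //.
- by apply: (mes_comp (k := g)); mes.
- by mes.
- move=> x; rewrite /ind oppr_gt0; case: (ltgtP x 0) => h.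
  + by rewrite ltr0_norm// mul0r add0r mul1r.
  + by rewrite gtr0_norm// mul0r addr0 mul1r.
  + by rewrite h normr0 gz !mul0r addr0.
Qed.

Lemma int_dist_le g t : measurable_fun setT g -> (forall x, 0 <= g x) -> g 0 = 0 ->
  (\int[mu]_s (g `|t - s|)%:E <= 2%:E * \int[mu]_(x in Dp) (g x)%:E)%E.
Proof.
move=> mg g0 gz; apply: le_trans (int_abs_le mg g0 gz).
have mh : measurable_fun setT (fun x : R => g `|x|) by apply: (mes_comp (k := g)); mes.
rewrite -(int_opp mh (fun x => g0 _)) -(@int_shift (fun x => g `|- x|) (- t)).
- rewrite le_eqVlt; apply/orP; left; apply/eqP.
  by apply: eq_integral => x _; rewrite opprD opprK.
- by apply: (mes_comp (k := g)); mes.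
- by move=> x; exact: g0.
Qed.

Lemma int_near s rho t : 0 < s -> 0 < rho ->
  (\int[mu]_u (ind (`|t - u| <= rho) * `|t - u| `^ (s - 1) * ind (t != u))%:E
    <= (2 * (rho `^ s / s))%:E)%E.
Proof.
move=> s0 r0; pose g (x : R) := ind (0 < x) * ind (x <= rho) * x `^ (s - 1).
have mg : measurable_fun setT g by rewrite /g; mes.
have g0 x : 0 <= g x by rewrite /g /ind; do 2 case: ifP; rewrite ?mul0r ?mul1r ?powR_ge0.
have gz : g 0 = 0 by rewrite /g /ind ltxx !mul0r.
apply: (@le_trans _ _ (\int[mu]_u (g `|t - u|)%:E)%E).
  rewrite le_eqVlt; apply/orP; left; apply/eqP; apply: eq_integral => u _.
  rewrite /g normr_gt0 subr_eq0; congr EFin; ring.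
apply: (le_trans (int_dist_le t mg g0 gz)); rewrite EFinM lee_wpmul2l//.
rewrite -integral_powR_0c// [leRHS]integral_mkcond [leLHS]integral_mkcond.
rewrite le_eqVlt; apply/orP; left; apply/eqP; apply: eq_integral => x _.
rewrite !patchE /g !mem_setE !in_itv/= andbT /ind; case: (0 < x) => //=.
by case: ifP; rewrite ?mul1r ?mul0r.
Qed.

Lemma int_far rho t : 0 < rho ->
  (\int[mu]_u (ind (rho <= `|t - u|) * `|t - u| `^ (- 2))%:E <= (2 / rho)%:E)%E.
Proof.
move=> r0; pose g (x : R) := ind (rho <= x) * x `^ (- 2).
have mg : measurable_fun setT g by rewrite /g; mes.
have g0 x : 0 <= g x by rewrite /g /ind; case: ifP; rewrite ?mul0r ?mul1r ?powR_ge0.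
have gz : g 0 = 0 by rewrite /g /ind leNgt r0 mul0r.
apply: (le_trans (int_dist_le t mg g0 gz)); rewrite EFinM lee_wpmul2l//.
have := integral_powR_cy (ltr01 : (0 : R) < 1) r0; rewrite divr1 powR_inv1 ?(ltW r0)// => <-.
rewrite [leRHS]integral_mkcond [leLHS]integral_mkcond.
rewrite le_eqVlt; apply/orP; left; apply/eqP; apply: eq_integral => x _.
rewrite !patchE /g !mem_setE !in_itv/= !andbT /ind (_ : - 1 - 1 = - 2 :> R); last by ring.
case: (leP rho x) => h; last by rewrite mul0r if_same.
by rewrite (lt_le_trans r0 h) mul1r.
Qed.

(** Young's inequality with conjugate exponents 2/(2-beta) and 2/beta for lam^(1-beta/2) x and
    lam^(beta/2-1) y, the reciprocal exponents being bounded by 1. The second exponent will turn |t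
    - s|^(-beta) into |t - s|^(-2), integrable at infinity. *)
Lemma young_param beta lam x y : 0 < beta -> beta < 1 -> 0 < lam -> 0 <= x -> 0 <= y ->
  x * y <= lam * x `^ (2 / (2 - beta)) + lam `^ (1 - 2 / beta) * y `^ (2 / beta).
Proof.
move=> b0 b1 l0 x0 y0.
have p0 : 0 < 2 / (2 - beta) by rewrite divr_gt0; lra.
have q0 : 0 < 2 / beta by rewrite divr_gt0.
have l1 e : 0 <= lam `^ e by exact: powR_ge0.
have := @conjugate_powR R (lam `^ (1 - beta / 2) * x) (lam `^ (beta / 2 - 1) * y) _ _
  (mulr_ge0 (l1 _) x0) (mulr_ge0 (l1 _) y0) p0 q0.
rewrite !powRM// -!powRrM mulrACA -powRDp//.
have -> : 1 - beta / 2 + (beta / 2 - 1) = 0 by ring.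
have -> : (1 - beta / 2) * (2 / (2 - beta)) = 1 by field; lra.
have -> : (beta / 2 - 1) * (2 / beta) = 1 - 2 / beta by field; lra.
rewrite powRr0 mul1r powRr1 ?(ltW l0)// => h.
apply: (le_trans (h _)); first by rewrite !invf_div; field.
by apply: lerD; rewrite ler_piMr ?mulr_ge0 ?powR_ge0 ?(ltW l0)// invf_div; lra.
Qed.

(* Only the pairs with [phi s <= phi t = x] matter by symmetry.  The near part
   [|t - s| <= N x^(-p)] uses [phi s <= x], the far part Young's inequality. *)
Lemma hls_inner beta N x t phi : 0 < beta -> beta < 1 -> 0 < N -> 0 < x ->
  measurable_fun setT phi -> (forall s, 0 <= phi s) ->
  (\int[mu]_s (phi s `^ (2 / (2 - beta)))%:E <= N%:E)%E ->
  (\int[mu]_s (ind (phi s <= x) * (phi s * `|t - s| `^ (- beta)))%:E <=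
    ((2 / (1 - beta) + 3) * N `^ (1 - beta) * x `^ (2 / (2 - beta) - 1))%:E)%E.
Proof.
move=> b0 b1 N0 x0 mphi phi0; set p := 2 / (2 - beta) => iN.
(* With these values the near part, the term in phi^p and the far part are multiples of N^(1-beta)
   x^(p-1), with factors 2/(1-beta), 1 and 2; this is the constant of the statement. *)
pose rho := N * x `^ (- p); pose lam := x `^ (p - 1) * N `^ (- beta).
have r0 : 0 < rho by rewrite mulr_gt0// powR_gt0.
have l0 : 0 < lam by rewrite mulr_gt0// powR_gt0.
pose F1 u := ind (`|t - u| <= rho) * `|t - u| `^ (1 - beta - 1) * ind (t != u).
pose F3 u := ind (rho <= `|t - u|) * `|t - u| `^ (- 2).
have mtu : measurable_fun setT (fun u => `|t - u|) by mes.
have mne : measurable_fun setT (fun u => ind (t != u)).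
  have -> : (fun u => ind (t != u)) = (fun u => ind (0 < `|t - u|)).
    by apply/funext => u; rewrite normr_gt0 subr_eq0.
  by mes.
have m1 : measurable_fun setT F1 by rewrite /F1; mes.
have m3 : measurable_fun setT F3 by rewrite /F3; mes.
have ind0 b : 0 <= ind b by rewrite /ind; case: ifP.
have F10 u : 0 <= F1 u by rewrite /F1 !mulr_ge0 ?powR_ge0.
have F30 u : 0 <= F3 u by rewrite /F3 !mulr_ge0 ?powR_ge0.
have mp : measurable_fun setT (fun u => phi u `^ p) by mes.
have m2 : measurable_fun setT (fun u => lam * phi u `^ p) by mes.
have p20 u : 0 <= lam * phi u `^ p by rewrite mulr_ge0 ?powR_ge0 ?(ltW l0).
have m4 : measurable_fun setT (fun u => lam `^ (1 - 2 / beta) * F3 u) by mes.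
have p40 u : 0 <= lam `^ (1 - 2 / beta) * F3 u by rewrite mulr_ge0 ?powR_ge0.
have m0 : measurable_fun setT (fun u => x * F1 u) by mes.
have p00 u : 0 <= x * F1 u by rewrite mulr_ge0 ?(ltW x0).
apply: (@le_trans _ _ (\int[mu]_u (x * F1 u + (lam * phi u `^ p + lam `^ (1 - 2 / beta) * F3 u))%:E)%E).
  apply: int_ge0_le.
  - by mes.
  - by mes.
  - by move=> u; rewrite !mulr_ge0 ?powR_ge0.
  (* On the diagonal the negative power of 0 is 0 by convention, so the left side vanishes. *)
  - move=> u; have [->|tu] := eqVneq t u.
      rewrite subrr normr0 powR0 ?oppr_eq0 ?gt_eqF// !mulr0.
      by rewrite !addr_ge0.
    have d0 : 0 < `|t - u| by rewrite normr_gt0 subr_eq0.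
    have [h|h] := leP `|t - u| rho.
      apply: (@le_trans _ _ (x * F1 u)); last by rewrite lerDl addr_ge0.
      rewrite /F1 h tu (_ : 1 - beta - 1 = - beta); last by ring.
      rewrite /ind mul1r mulr1; case: ifP => hx; first by rewrite mul1r ler_wpM2r ?powR_ge0.
      by rewrite mul0r mulr_ge0 ?powR_ge0 ?(ltW x0).
    apply: (@le_trans _ _ (phi u * `|t - u| `^ (- beta))).
      by rewrite ler_piMl ?mulr_ge0 ?powR_ge0// /ind; case: ifP.
    apply: (le_trans (young_param b0 b1 l0 (phi0 u) (powR_ge0 _ _))).
    rewrite /F3 (ltW h) /ind mul1r -powRrM.
    have -> : - beta * (2 / beta) = - 2 by field; lra.
    by rewrite lerDr.
rewrite int_ge0D//; [|by mes|by move=> u; exact: addr_ge0].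
rewrite int_ge0D// int_ge0Z ?(ltW x0)// int_ge0Z ?(ltW l0)//; last by move=> u; exact: powR_ge0.
rewrite int_ge0Z ?powR_ge0//.
have h1 := @int_near (1 - beta) rho t (_ : 0 < 1 - beta) r0.
have b10 : 0 < 1 - beta by lra.
have h3 := int_far t r0.
apply: (@le_trans _ _ (x%:E * (2 * (rho `^ (1 - beta) / (1 - beta)))%:E +
   (lam%:E * N%:E + (lam `^ (1 - 2 / beta))%:E * (2 / rho)%:E))%E).
  apply: leeD; [|apply: leeD]; apply: lee_wpmul2l; rewrite ?lee_fin ?powR_ge0 ?(ltW x0) ?(ltW l0)//.
  exact: h1.
rewrite -!EFinM -!EFinD lee_fin le_eqVlt; apply/orP; left; apply/eqP.
pose a := ln x; pose n := ln N.
have xE : x = expR a by rewrite lnK.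
have NE : N = expR n by rewrite lnK.
have lE : lam = expR (a * (p - 1) - n * beta).
  by rewrite /lam xE NE -!expRM -expRD mulrN.
have rE : rho = expR (n - a * p) by rewrite /rho xE NE -!expRM -expRD mulrN.
set E := expR (n * (1 - beta) + a * (p - 1)).
have X0 : N `^ (1 - beta) * x `^ (p - 1) = E by rewrite xE NE -!expRM -expRD.
have X1 : x * rho `^ (1 - beta) = E.
  rewrite rE xE -!expRM -expRD; congr expR; rewrite /p; field; lra.
have X2 : lam * N = E.
  rewrite lE NE -expRD; congr expR; ring.
have X3 : lam `^ (1 - 2 / beta) / rho = E.
  rewrite rE lE -expRM -expRN -expRD; congr expR; rewrite /p; field.
  by apply/andP; split; lra.
have -> : (2 / (1 - beta) + 3) * N `^ (1 - beta) * x `^ (p - 1) =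
  (2 / (1 - beta) + 3) * E by rewrite -X0 mulrA.
have alg (a1 a2 a3 : R) : a1 * (2 * (a2 / a3)) = 2 / a3 * (a1 * a2) by ring.
by rewrite alg X1 X2 mulrCA X3; move: (2 / _) (E) => a1 a2; ring.
Qed.

Lemma hls_pos beta N phi : 0 < beta -> beta < 1 -> 0 < N ->
  measurable_fun setT phi -> (forall s, 0 <= phi s) ->
  (\int[mu]_s (phi s `^ (2 / (2 - beta)))%:E <= N%:E)%E ->
  (\int[mu]_t \int[mu]_s (phi t * phi s * `|t - s| `^ (- beta))%:E <=
    (2 * (2 / (1 - beta) + 3) * N `^ (2 - beta))%:E)%E.
Proof.
move=> b0 b1 N0 mphi phi0 iN.
have b10 : 0 < 1 - beta by lra.
have ind0 b : 0 <= ind b by rewrite /ind; case: ifP.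
(* By symmetry the double integral is at most twice its part over phi s <= phi t. There [hls_inner]
   leaves phi t to the power 2/(2-beta), whose integral supplies one more factor N. *)
pose G t s := ind (phi s <= phi t) * (phi t * phi s * `|t - s| `^ (- beta)).
have ms1 : measurable_fun setT (fun p : R * R => phi p.1) by apply: (mes_comp (k := phi)); mes.
have ms2 : measurable_fun setT (fun p : R * R => phi p.2) by apply: (mes_comp (k := phi)); mes.
have mG : meas2 G by rewrite /G; mes.
have G0 t s : 0 <= G t s by rewrite /G !mulr_ge0 ?powR_ge0.
have mGC := meas2C mG.
have mI := mes_int_ge0 mG G0.
have mIC := @mes_int_ge0 R _ _ (fun t s => G s t) mGC (fun t s => G0 s t).
have inner t : (\int[mu]_s (G t s)%:E <=
    ((2 / (1 - beta) + 3) * N `^ (1 - beta) * phi t `^ (2 / (2 - beta)))%:E)%E.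
  have p1 : 0 < 2 / (2 - beta) by rewrite divr_gt0; lra.
  have := phi0 t; rewrite le_eqVlt => /predU1P[e|x0].
    rewrite integral0_eq => [|s _]; last by rewrite /G -e !mul0r mulr0.
    by rewrite lee_fin !mulr_ge0 ?powR_ge0// addr_ge0// divr_ge0// ltW.
  have -> : (2 / (1 - beta) + 3) * N `^ (1 - beta) * phi t `^ (2 / (2 - beta)) =
     phi t * ((2 / (1 - beta) + 3) * N `^ (1 - beta) * phi t `^ (2 / (2 - beta) - 1)).
    by rewrite -(mulr_powRB1 (phi0 t) p1); ring.
  rewrite EFinM; apply: le_trans (lee_wpmul2l _ (hls_inner t b0 b1 N0 x0 mphi phi0 iN)); last first.
    by rewrite lee_fin ltW.
  rewrite -int_ge0Z ?(ltW x0)//; last 2 first.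
  - by mes.
  - by move=> s; rewrite !mulr_ge0 ?powR_ge0.
  rewrite le_eqVlt; apply/orP; left; apply/eqP; apply: eq_integral => s _.
  by rewrite /G; congr EFin; ring.
apply: (@le_trans _ _ (\int[mu]_t (\int[mu]_s (G t s)%:E + \int[mu]_s (G s t)%:E))%E).
  apply: ge0_le_integral => //.
  - by move=> t _; apply: integral_ge0 => s _; rewrite lee_fin !mulr_ge0 ?powR_ge0.
  - apply: (mes_int_ge0 (G := fun t s => phi t * phi s * `|t - s| `^ (- beta))); first by mes.
    by move=> t s; rewrite !mulr_ge0 ?powR_ge0.
  - exact: (emeasurable_funD mI mIC).
  - move=> t _; rewrite -int_ge0D//.
    + apply: int_ge0_le.
      * by mes.
      * by apply: mesD; [exact: (meas2_1 t mG)|exact: (meas2_2 t mG)].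
      * by move=> s; rewrite !mulr_ge0 ?powR_ge0.
      * move=> s; rewrite /G (mulrC (phi s) (phi t)) (distrC s t) -mulrDl.
        rewrite ler_peMl ?mulr_ge0 ?powR_ge0// /ind.
        by case: (ltgtP (phi s) (phi t)) => _; rewrite ?addr0 ?add0r// lerDl.
    + exact: (meas2_1 t mG).
    + exact: (meas2_2 t mG).
have I0 (t : R) : setT t -> (0 <= \int[mu]_s (G t s)%:E)%E.
  by move=> _; apply: integral_ge0 => s _; rewrite lee_fin.
have IC0 (t : R) : setT t -> (0 <= \int[mu]_s (G s t)%:E)%E.
  by move=> _; apply: integral_ge0 => s _; rewrite lee_fin.
clearbody G; rewrite (@ge0_integralD _ _ _ mu setT measurableT _ _ I0 mI IC0 mIC).
rewrite -(tonelli mG G0) -mule2n -mule_natl -!mulrA EFinM.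
apply: lee_wpmul2l; first by rewrite lee_fin.
have mp : measurable_fun setT (fun u => phi u `^ (2 / (2 - beta))) by mes.
have K0 : 0 <= (2 / (1 - beta) + 3) * N `^ (1 - beta).
  by rewrite mulr_ge0 ?powR_ge0// addr_ge0// divr_ge0 ?(ltW b10).
apply: (@le_trans _ _ (\int[mu]_t ((2 / (1 - beta) + 3) * N `^ (1 - beta) * phi t `^ (2 / (2 - beta)))%:E)%E).
  by apply: ge0_le_integral => //; apply/measurable_EFinP; mes.
rewrite int_ge0Z//; last by move=> u; exact: powR_ge0.
apply: (le_trans (lee_wpmul2l _ iN)); first by rewrite lee_fin.
rewrite -EFinM lee_fin -mulrA ler_wpM2l//; first by rewrite addr_ge0// divr_ge0 ?(ltW b10).
rewrite -[X in _ * X](powRr1 (ltW N0)) -powRDp// le_eqVlt; apply/orP; left; apply/eqP.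
by congr (_ `^ _); ring.
Qed.

Lemma hls beta N phi : 0 < beta -> beta < 1 -> 0 <= N ->
  measurable_fun setT phi -> (forall s, 0 <= phi s) ->
  (\int[mu]_s (phi s `^ (2 / (2 - beta)))%:E <= N%:E)%E ->
  (\int[mu]_t \int[mu]_s (phi t * phi s * `|t - s| `^ (- beta))%:E <=
    (2 * (2 / (1 - beta) + 3) * N `^ (2 - beta))%:E)%E.
Proof.
move=> b0 b1; rewrite le_eqVlt => /predU1P[<-|]; last exact: hls_pos.
move=> mphi phi0 iN; rewrite powR0; last by rewrite gt_eqF// subr_gt0; lra.
rewrite mulr0; set I := (X in (X <= _)%E).
apply/lee_addgt0Pr => e e0; rewrite add0e.
set K := 2 * (2 / (1 - beta) + 3).
have b10 : 0 < 1 - beta by lra.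
have K0 : 0 < K by rewrite /K mulr_gt0// addr_gt0// divr_gt0.
(* The case N = 0 is a limit of positive values: this one makes the right-hand side equal to e. *)
have eK : 0 < (e / K) `^ (2 - beta)^-1 by rewrite powR_gt0// divr_gt0.
have := hls_pos b0 b1 eK mphi phi0 (le_trans iN _).
rewrite -powRrM mulVf; last by lra.
rewrite -/K powRr1 ?divr_ge0 ?(ltW e0) ?(ltW K0)// [K * _]mulrC divfK ?gt_eqF//; apply.
by rewrite lee_fin ltW.
Qed.

End HLS.

(** * Kernel bounds *)

Section HalfLine.
Context {R : realType}.
Implicit Types (f g h : R -> R) (x y z t s : R).
Local Notation mu := (@lebesgue_measure R).
Local Notation intg f := (mu.-integrable setT (EFin \o f)).
Local Notation meas2 G := (measurable_fun setT (fun p : R * R => G p.1 p.2)).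
Local Notation Dp := (`]0%R, +oo[%classic : set R).
Local Notation ind := (@ind R).

Lemma patch_Dp f x : (f \_ Dp) x = ind (0 < x) * f x.
Proof. by rewrite patchE mem_setE in_itv/= andbT /ind; case: ifP; rewrite ?mul1r ?mul0r. Qed.

Lemma Rint_Dp f : \int[mu]_(x in Dp) f x = \int[mu]_x (ind (0 < x) * f x).
Proof. by rewrite Rintegral_mkcond; apply: eq_Rintegral => x _; rewrite patch_Dp. Qed.

Lemma int_Dp f : (\int[mu]_(x in Dp) (f x)%:E = \int[mu]_x (ind (0 < x) * f x)%:E)%E.
Proof.
rewrite integral_mkcond; apply: eq_integral => x _.
by rewrite -patch_Dp !patchE; case: ifP.
Qed.

Lemma intg_Dp f : mu.-integrable Dp (EFin \o f) -> intg (fun x => ind (0 < x) * f x).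
Proof.
move=> h; have := (@integrable_mkcond _ _ _ mu Dp (EFin \o f) measurable_Dp).1 h; apply: eq_integrable => // x _.
by rewrite /= -patch_Dp !patchE; case: ifP.
Qed.

(** Pointwise |f z| |f y| <= (f y^2 + f z^2) / 2, and the symmetry of A makes the two halves equal
    after Tonelli. *)
Lemma schur (w f : R -> R) (A : R -> R -> R) (C : R) : measurable_fun setT w ->
  (forall x, 0 <= w x) -> meas2 A -> (forall y z, 0 <= A y z) ->
  (forall y z, A y z = A z y) -> 0 <= C ->
  (forall y, (\int[mu]_z (A y z * w z)%:E <= C%:E)%E) ->
  measurable_fun setT f -> intg (fun y => f y ^+ 2 * w y) ->
  (\int[mu]_z \int[mu]_y (`|f z| * w z * (`|f y| * w y * A y z))%:E <=
    (C * \int[mu]_y (f y ^+ 2 * w y))%:E)%E.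
Proof.
move=> mw w0 mA A0 As C0 AC mf inf.
have m1 : measurable_fun setT (fun p : R * R => f p.1) by apply: (mes_comp (k := f)); mes.
have m2 : measurable_fun setT (fun p : R * R => f p.2) by apply: (mes_comp (k := f)); mes.
have w1 : measurable_fun setT (fun p : R * R => w p.1) by apply: (mes_comp (k := w)); mes.
have w2 : measurable_fun setT (fun p : R * R => w p.2) by apply: (mes_comp (k := w)); mes.
pose G y z := f y ^+ 2 * w y * (A y z * w z).
have mG : meas2 G by rewrite /G; mes.
have fw0 y : 0 <= f y ^+ 2 * w y by apply: mulr_ge0 => //; exact: sqr_ge0.
have Aw0 y z : 0 <= A y z * w z by exact: mulr_ge0.
have G0 y z : 0 <= G y z by exact: mulr_ge0.
have mAC := meas2C mA; have mGC := meas2C mG.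
pose H z y := `|f z| * w z * (`|f y| * w y * A y z).
have mH : meas2 H by rewrite /H; mes.
have H0 z y : 0 <= H z y by rewrite /H !mulr_ge0.
have HG z y : H z y <= 2^-1 * G y z + 2^-1 * G z y.
  have h : `|f z| * `|f y| <= 2^-1 * f y ^+ 2 + 2^-1 * f z ^+ 2.
    rewrite -(real_normK (num_real (f y))) -(real_normK (num_real (f z))).
    have := sqr_ge0 (`|f y| - `|f z|); rewrite sqrrB; lra.
  have -> : H z y = `|f z| * `|f y| * (w z * w y * A y z) by rewrite /H; ring.
  have -> : 2^-1 * G y z + 2^-1 * G z y =
     (2^-1 * f y ^+ 2 + 2^-1 * f z ^+ 2) * (w z * w y * A y z) by rewrite /G (As z y); ring.
  by rewrite ler_wpM2r// !mulr_ge0.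
have Gc (K : R) y z : 0 <= K -> 0 <= K * G y z by move=> K0; exact: mulr_ge0.
have h20 : 0 <= (2^-1 : R) by [].
have innerle : (\int[mu]_y \int[mu]_z (G y z)%:E <= (C * \int[mu]_y (f y ^+ 2 * w y))%:E)%E.
  apply: (@le_trans _ _ (\int[mu]_y (C * (f y ^+ 2 * w y))%:E)%E).
    apply: ge0_le_integral => //.
    - by move=> t _; apply: integral_ge0 => s _; rewrite lee_fin.
    - exact: mes_int_ge0.
    - by apply/measurable_EFinP; mes.
    - move=> y _; rewrite /G int_ge0Z//; last by mes; exact: meas2_1.
      apply: (le_trans (lee_wpmul2l _ (AC y))); first by rewrite lee_fin.
      by rewrite -EFinM lee_fin mulrC.
  rewrite int_ge0Z//; last by mes.
  by rewrite EFinM (RintE inf).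
change ((\int[mu]_z \int[mu]_y (H z y)%:E <= (C * \int[mu]_y (f y ^+ 2 * w y))%:E)%E).
clearbody G H.
apply: (le_trans _ innerle).
apply: (@le_trans _ _ (\int[mu]_z (\int[mu]_y (2^-1 * G y z)%:E + \int[mu]_y (2^-1 * G z y)%:E))%E).
  apply: ge0_le_integral => //.
  - by move=> t _; apply: integral_ge0 => s _; rewrite lee_fin.
  - exact: mes_int_ge0.
  - apply: emeasurable_funD.
      by apply: (@mes_int_ge0 R _ _ (fun z y => 2^-1 * G y z)) => *; [mes|exact: Gc].
    by apply: (@mes_int_ge0 R _ _ (fun z y => 2^-1 * G z y)) => *; [mes|exact: Gc].
  - move=> z _; rewrite -int_ge0D; last 4 first.
    + by mes; exact: meas2_2.
    + by mes; exact: meas2_1.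
    + by move=> y; exact: Gc.
    + by move=> y; exact: Gc.
    apply: int_ge0_le => //.
    + exact: meas2_1.
    + by apply: mesD; apply: mesM => //; [exact: meas2_2|exact: meas2_1].
rewrite (@ge0_integralD _ _ _ mu setT measurableT).
- rewrite -(@tonelli R (fun y z => 2^-1 * G y z)); [|by mes|by move=> *; exact: Gc].
  have E : (\int[mu]_x \int[mu]_y (2^-1 * G x y)%:E = 2^-1%:E * \int[mu]_y \int[mu]_z (G y z)%:E)%E.
    rewrite -ge0_integralZl//.
    - by apply: eq_integral => y _; rewrite int_ge0Z//; exact: meas2_1.
    - exact: mes_int_ge0.
    - by move=> y _; apply: integral_ge0 => s _; rewrite lee_fin.
  rewrite E -ge0_muleDl ?lee_fin// -EFinD (_ : 2^-1 + 2^-1 = 1 :> R) ?mul1e//.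
  by field.
- by move=> t _; apply: integral_ge0 => s _; rewrite lee_fin; exact: Gc.
- by apply: (@mes_int_ge0 R _ _ (fun z y => 2^-1 * G y z)) => *; [mes|exact: Gc].
- by move=> t _; apply: integral_ge0 => s _; rewrite lee_fin; exact: Gc.
- by apply: (@mes_int_ge0 R _ _ (fun z y => 2^-1 * G z y)) => *; [mes|exact: Gc].
Qed.

End HalfLine.

(** * The regularised kernel of the forms and its dispersive bound *)

Section Kernel.
Context {R : realType}.
Implicit Types (f g h : R -> R) (x y z t s eps al be b c : R).
Local Notation mu := (@lebesgue_measure R).
Local Notation intg f := (mu.-integrable setT (EFin \o f)).
Local Notation meas2 G := (measurable_fun setT (fun p : R * R => G p.1 p.2)).
Local Notation Dp := (`]0%R, +oo[%classic : set R).
Local Notation ind := (@ind R).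

(** The half-line is encoded as the whole line with a weight vanishing for x <= 0. [gh] is the
    square root of the regularised weight [gw], one copy for each factor in [Rint_bilinear]. *)
Definition wt a x : R := ind (0 < x) * x `^ a.
Definition gw a eps x : R := expR (- (eps * x ^+ 2)) * wt a x.
Definition gh a eps x : R := expR (- (eps / 2 * x ^+ 2)) * wt (a / 2) x.
Definition kap a t : R := (2 * `|t|) `^ (- ((a + 1) / 2)).
Definition phase a x y t : R := (a + 1) * pi / 4 * Num.sg t - (x ^+ 2 + y ^+ 2) / (4 * t).
(* Real and imaginary part of the kernel of [S_a(-t)]. *)
Definition Kc a (U : R -> R) x y t : R := kap a t * U (x * y / (2 * `|t|)) * cos (phase a x y t).
Definition Ks a (U : R -> R) x y t : R := kap a t * U (x * y / (2 * `|t|)) * sin (phase a x y t).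

Lemma wt_ge0 a x : 0 <= wt a x.
Proof. by rewrite /wt mulr_ge0 ?ind_ge0 ?powR_ge0. Qed.

Lemma gw_ge0 a eps x : 0 <= gw a eps x.
Proof. by rewrite /gw mulr_ge0 ?expR_ge0 ?wt_ge0. Qed.

Lemma gh_ge0 a eps x : 0 <= gh a eps x.
Proof. by rewrite /gh mulr_ge0 ?expR_ge0 ?wt_ge0. Qed.

Lemma kap_ge0 a t : 0 <= kap a t. Proof. exact: powR_ge0. Qed.

Lemma gh_sq a eps x : gh a eps x ^+ 2 = gw a eps x.
Proof.
rewrite /gh /gw /wt !exprMn !expr2 -expRD; congr (expR _ * _); first by field.
rewrite /ind; case: ltP => h; last by rewrite !mul0r.
by rewrite !mul1r -powRDp//; congr (_ `^ _); field.
Qed.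

Section Mes.
Context {d : measure_display} {T : measurableType d}.
Implicit Types (u v k : T -> R).

Lemma mes_wt a u : measurable_fun setT u -> measurable_fun setT (fun p => wt a (u p)).
Proof. by move=> mu_; rewrite /wt; mes. Qed.

Lemma mes_expR u : measurable_fun setT u -> measurable_fun setT (fun p => expR (u p)).
Proof. by move=> ?; apply: (mes_comp (k := expR)) => //; exact: measurable_expR. Qed.

Lemma mes_cos u : measurable_fun setT u -> measurable_fun setT (fun p => cos (u p)).
Proof.
by move=> ?; apply: (mes_comp (k := cos)) => //; apply: continuous_measurable_fun; exact: continuous_cos.
Qed.

Lemma mes_sin u : measurable_fun setT u -> measurable_fun setT (fun p => sin (u p)).
Proof.
by move=> ?; apply: (mes_comp (k := sin)) => //; apply: continuous_measurable_fun; exact: continuous_sin.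
Qed.

Lemma mes_gw a eps u : measurable_fun setT u -> measurable_fun setT (fun p => gw a eps (u p)).
Proof. by move=> ?; apply: mesM; [apply: mes_expR; mes|exact: mes_wt]. Qed.

Lemma mes_gh a eps u : measurable_fun setT u -> measurable_fun setT (fun p => gh a eps (u p)).
Proof. by move=> ?; apply: mesM; [apply: mes_expR; mes|exact: mes_wt]. Qed.

Lemma mes_Kc a U u v k : measurable_fun setT U -> measurable_fun setT u ->
  measurable_fun setT v -> measurable_fun setT k ->
  measurable_fun setT (fun p => Kc a U (u p) (v p) (k p)).
Proof.
move=> mU ? ? ?; rewrite /Kc /kap /phase; apply: mesM; last by apply: mes_cos; mes.
by apply: mesM; first mes; apply: (mes_comp (k := U)) => //; mes.
Qed.

Lemma mes_Ks a U u v k : measurable_fun setT U -> measurable_fun setT u ->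
  measurable_fun setT v -> measurable_fun setT k ->
  measurable_fun setT (fun p => Ks a U (u p) (v p) (k p)).
Proof.
move=> mU ? ? ?; rewrite /Ks /kap /phase; apply: mesM; last by apply: mes_sin; mes.
by apply: mesM; first mes; apply: (mes_comp (k := U)) => //; mes.
Qed.

End Mes.

Section Bounds.
Variables (a c0 : R) (U P Q : R -> R).
Hypotheses (a0 : 0 <= a) (hU : bessel_like a c0 U P Q).

Lemma bl_continuous x : {for x, continuous U}.
Proof. exact: (is_derive1_continuous (bl_dU hU x)). Qed.

Lemma bl_measurable : measurable_fun setT U.
Proof. by apply: continuous_measurable1 => x; exact: bl_continuous. Qed.

Let mU := bl_measurable.
Let c00 : 0 < c0. Proof. exact: (bl_gt0 hU). Qed.

Lemma Kc_le x y t : `|Kc a U x y t| <= kap a t * c0.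
Proof.
rewrite /Kc !normrM (ger0_norm (kap_ge0 a t)) -[leRHS]mulr1 ler_pM ?mulr_ge0 ?kap_ge0//.
  by rewrite ler_wpM2l ?kap_ge0//; exact: (bl_U hU).
by rewrite ler_norml cos_geN1 cos_le1.
Qed.

Lemma Ks_le x y t : `|Ks a U x y t| <= kap a t * c0.
Proof.
rewrite /Ks !normrM (ger0_norm (kap_ge0 a t)) -[leRHS]mulr1 ler_pM ?mulr_ge0 ?kap_ge0//.
  by rewrite ler_wpM2l ?kap_ge0//; exact: (bl_U hU).
by rewrite ler_norml sin_geN1 sin_le1.
Qed.

Lemma hprod_line al be e : hprod a U U al be e 1 =
  \int[mu]_x (e x * wt a x * (U (al * x) * U (be * x))).
Proof.
rewrite /hprod Rint_Dp; apply: eq_Rintegral => x _; rewrite !mul1r /wt; ring.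
Qed.

Lemma intg_hprod al be e eps : 0 < eps -> gauss_like eps e ->
  intg (fun x => e x * wt a x * (U (al * x) * U (be * x))).
Proof.
move=> e0 ge.
have bU : cbdd c0 U by split=> x; [exact: bl_continuous|exact: (bl_U hU)].
have := intg_Dp (hprod_integrable al be 1 a0 e0 ge bU bU).
apply: eq_integrable => // x _ /=; rewrite !mul1r /wt; congr EFin; ring.
Qed.

Lemma intg_gw eps : 0 < eps -> intg (gw a eps).
Proof.
move=> e0; have := intgZ (c0 ^- 2) (intg_hprod 0 0 e0 (gauss_like_c eps 0)).
apply: eq_integrable => // x _ /=; rewrite !mul0r (bl_U0 hU) gaussc0 /gw; congr EFin.
by field; rewrite gt_eqF.
Qed.

(* [Wker] is the kernel of [S(-s)^* S(-t)], regularised by a Gaussian in [x] *)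
Definition Wker eps t s y z : R :=
  \int[mu]_x (gw a eps x * (Kc a U x y t * Kc a U x z s + Ks a U x y t * Ks a U x z s)).

Lemma meas2_W eps t s : meas2 (Wker eps t s).
Proof.
rewrite /Wker; apply: (@mes_Rint R _ _ (fun p x => gw a eps x *
  (Kc a U x p.1 t * Kc a U x p.2 s + Ks a U x p.1 t * Ks a U x p.2 s))).
by apply: mesM; [apply: mes_gw; mes|apply: mesD; apply: mesM; (apply: mes_Kc || apply: mes_Ks); mes].
Qed.

Definition dphase t s y z : R :=
  (a + 1) * pi / 4 * (Num.sg t - Num.sg s) - y ^+ 2 / (4 * t) + z ^+ 2 / (4 * s).

(** The two phases differ by dphase - b x^2, so the x-integral is the Gaussian Bessel integral with
    p = eps + i b, rotated by an angle independent of x. *)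
Lemma W_hprod eps t s y z : 0 < eps ->
  let H e := hprod a U U (y / (2 * `|t|)) (z / (2 * `|s|)) e 1 in
  let b := (4 * t)^-1 - (4 * s)^-1 in
  Wker eps t s y z = kap a t * kap a s *
    (cos (dphase t s y z) * H (gaussc eps b) + sin (dphase t s y z) * H (gausss eps b)).
Proof.
move=> e0 H b; rewrite /H !hprod_line.
have ic := intg_hprod (y / (2 * `|t|)) (z / (2 * `|s|)) e0 (gauss_like_c eps b).
have is_ := intg_hprod (y / (2 * `|t|)) (z / (2 * `|s|)) e0 (gauss_like_s eps b).
rewrite -(RintZ _ ic) -(RintZ _ is_) -RintD; [|exact: intgZ|exact: intgZ].
rewrite -RintZ; last by apply: intgD; exact: intgZ.
apply: eq_Rintegral => x _; rewrite /Kc /Ks.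
set A := U _; set B := U _; set A' := U _; set B' := U _.
have -> : A' = A by rewrite /A' /A; congr (U _); ring.
have -> : B' = B by rewrite /B' /B; congr (U _); ring.
have E : phase a x y t - phase a x z s = dphase t s y z - b * x ^+ 2.
  rewrite /phase /dphase /b !invfM !mulrDl; ring.
have := cosB (phase a x y t) (phase a x z s); rewrite E cosB /gaussc /gausss /gw.
move: (cos (phase a x y t)) (sin (phase a x y t)) (cos (phase a x z s)) (sin (phase a x z s)).
move: (kap a t) (kap a s) (expR _) (wt a x) => k1 k2 e w u1 u2 u3 u4.
move: (cos (b * _)) (sin (b * _)) (cos _) (sin _) => v1 v2 v3 v4 h.
have -> : k1 * A * u1 * (k2 * B * u3) + k1 * A * u2 * (k2 * B * u4) = k1 * k2 * A * B * (u1 * u3 + u2 * u4) by ring.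
by rewrite -h; ring.
Qed.

Lemma rot_le (u v c s K : R) : 0 <= K -> u ^+ 2 + v ^+ 2 = 1 -> c ^+ 2 + s ^+ 2 <= K ^+ 2 ->
  `|u * c + v * s| <= K.
Proof.
move=> K0 uv cs; rewrite -(@ler_pXn2r _ 2)// ?nnegrE// real_normK ?num_real//.
apply: le_trans cs; have := sqr_ge0 (u * s - v * c).
have -> : (u * s - v * c) ^+ 2 = (u ^+ 2 + v ^+ 2) * (c ^+ 2 + s ^+ 2) - (u * c + v * s) ^+ 2 by ring.
by rewrite uv mul1r subr_ge0.
Qed.

Definition G1 : R := gaussmom a (gaussc 1 0).

Lemma G1_ge0 : 0 <= G1. Proof. exact: gaussmom_ge0. Qed.

(** Here |p| >= |b| = |t - s| / (4 |t| |s|), and kap t kap s = (4 |t| |s|)^(-(a+1)/2) cancels the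
    denominator exactly. *)
Lemma W_le eps t s y z : 0 < eps -> t != 0 -> s != 0 -> t != s ->
  `|Wker eps t s y z| <= c0 ^+ 2 * G1 * `|t - s| `^ (- ((a + 1) / 2)).
Proof.
move=> e0 t0 s0 ts; rewrite W_hprod//.
set b := _ - _; set c := hprod _ _ _ _ _ _ _; set d := hprod _ _ _ _ _ _ _.
set m := (a + 1) / 2.
have m0 : 0 < m by rewrite /m; have h := a0; lra.
have b0 : 0 < `|b|.
  rewrite normr_gt0 subr_eq0; apply/negP => /eqP /invr_inj h.
  move/negP: ts; apply; apply/eqP; lra.
have := hprod_dispersive a0 hU (y / (2 * `|t|)) (z / (2 * `|s|)) b e0.
rewrite -/c -/d -/G1 -/m => h.
have h1 : (c ^+ 2 + d ^+ 2) <= (c0 ^+ 2 * G1 * `|b| `^ (- m)) ^+ 2.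
  rewrite exprMn powRN exprVn ler_pdivlMr; last by rewrite exprn_gt0// powR_gt0.
  apply: le_trans h; rewrite ler_wpM2l ?addr_ge0 ?sqr_ge0//.
  rewrite expr2 -powRM// -expr2 real_normK ?num_real//.
  by apply: ler_powRl; rewrite ?(ltW m0) ?sqr_ge0// lerDr sqr_ge0.
rewrite !normrM !(ger0_norm (kap_ge0 _ _)).
have cG0 : 0 <= c0 ^+ 2 * G1 by apply: mulr_ge0; [exact: sqr_ge0|exact: G1_ge0].
have K0 : 0 <= c0 ^+ 2 * G1 * `|b| `^ (- m).
  by rewrite mulr_ge0 ?powR_ge0.
apply: (le_trans (ler_wpM2l _ (rot_le K0 (cos2Dsin2 _) h1))).
  by rewrite mulr_ge0 ?kap_ge0.
rewrite mulrCA ler_wpM2l// /kap -/m.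
rewrite -powRM ?mulr_ge0// -powRM ?mulr_ge0// le_eqVlt; apply/orP; left; apply/eqP.
congr (_ `^ _).
have -> : b = (s - t) / (4 * (t * s)) by rewrite /b; field; rewrite t0 s0.
rewrite normf_div (distrC t s) !normrM (ger0_norm (_ : 0 <= 4 :> R))//.
by field; rewrite !normr_eq0 t0 s0.
Qed.

End Bounds.
End Kernel.

Section Fatou.
Context {R : realType}.
Local Notation mu := (@lebesgue_measure R).

(** The alternative f x = 0 accommodates points where the limit function takes the default value of
    a divergent integral: there f x is trivially below the lower limit. *)
Lemma fatou_le (fn : nat -> R -> R) (f : R -> R) (C : \bar R) :
  (forall n, measurable_fun setT (fn n)) -> (forall n x, 0 <= fn n x) ->
  measurable_fun setT f -> (forall x, 0 <= f x) ->
  (forall x, f x = 0 \/ fn n x @[n --> \oo] --> f x) ->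
  (forall n, (\int[mu]_x (fn n x)%:E <= C)%E) ->
  (\int[mu]_x (f x)%:E <= C)%E.
Proof.
move=> mfn fn0 mf f0 cf bf.
have mfn' n : measurable_fun setT (fun x => (fn n x)%:E) by exact/measurable_EFinP.
have fn0' n x : setT x -> (0 <= (fn n x)%:E)%E by rewrite lee_fin.
have := fatou mu measurableT mfn' fn0'.
have e0 x n : (0 <= einfs (fun m => (fn m x)%:E) n)%E.
  by apply: le_ereal_inf_tmp => _ [m _ <-]; rewrite lee_fin.
have le1 x : ((f x)%:E <= limn_einf (fun m => (fn m x)%:E))%E.
  have [->|h] := cf x.
    by rewrite limn_einf_lim; apply: lime_ge; [exact: is_cvg_einfs|exact: nearW].
  have h' : (fn m x)%:E @[m --> \oo] --> (f x)%:E by apply: cvg_EFin => //; exact: nearW.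
  by rewrite (cvg_limn_einf_sup h').1.
move=> h; apply: (@le_trans _ _ (\int[mu]_x limn_einf (fun m => (fn m x)%:E))%E).
  apply: ge0_le_integral => //.
  - by move=> x _; rewrite lee_fin.
  - exact/measurable_EFinP.
  - apply: (@emeasurable_fun_cvg _ _ _ _ (fun n x => einfs (fun m => (fn m x)%:E) n)).
      by move=> n; exact: (@measurable_fun_einfs _ _ _ setT (fun m x => (fn m x)%:E)).
    by move=> x _; rewrite limn_einf_lim; exact: is_cvg_einfs.
apply: (le_trans h); rewrite limn_einf_lim.
apply: lime_le; first exact: is_cvg_einfs.
apply: nearW => n; apply: le_trans (bf n).
by apply: ereal_inf_lbound; exists n => /=.
Qed.

Lemma cvg_gauss_1 (x : R) : expR (- (n.+1%:R^-1 * x ^+ 2)) @[n --> \oo] --> (1 : R).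
Proof.
rewrite -[X in _ --> X]expR0; apply: continuous_cvg; first exact: continuous_expR.
rewrite -[X in _ --> X]oppr0; apply: cvgN; rewrite -[X in _ --> X](mul0r (x ^+ 2)).
apply: cvgM; last exact: cvg_cst.
exact: cvg_harmonic.
Qed.

End Fatou.

(** * The Schur constant of the nonnegative kernel, uniform in the regularisation *)

Section SchurBound.
Context {R : realType}.
Implicit Types (f g h : R -> R) (x y z t s eps al be b c del : R).
Local Notation mu := (@lebesgue_measure R).
Local Notation intg f := (mu.-integrable setT (EFin \o f)).
Local Notation meas2 G := (measurable_fun setT (fun p : R * R => G p.1 p.2)).
Local Notation Dp := (`]0%R, +oo[%classic : set R).
Local Notation ind := (@ind R).
Variables (a c0 : R) (U P Q : R -> R).
Hypotheses (a0 : 0 <= a) (hU : bessel_like a c0 U P Q).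

Let mU := bl_measurable hU.
Let c00 : 0 < c0. Proof. exact: (bl_gt0 hU). Qed.
Local Notation G1 := (G1 a).

Lemma gaussmom_scale eps : 0 < eps ->
  gaussmom a (gaussc eps 0) = G1 * eps `^ (- ((a + 1) / 2)).
Proof.
move=> e0; have := gaussmom_norm 0 a0 e0; set m := (a + 1) / 2.
rewrite gausss0 gaussmom_cst0 expr0n/= !addr0 => h.
have E : (eps ^+ 2) `^ m = (eps `^ m) ^+ 2 by rewrite !expr2 powRM ?(ltW e0).
have p0 : 0 < eps `^ m by rewrite powR_gt0.
rewrite powRN; apply: (canRL (mulfK _)); first by rewrite gt_eqF.
apply/eqP; rewrite -(@eqrXn2 _ 2)//; last first.
- exact: gaussmom_ge0.
- by rewrite mulr_ge0 ?gaussmom_ge0 ?(ltW p0).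
- by rewrite exprMn -E h.
Qed.

Lemma gw_line eps x : gw a eps x = gaussc eps 0 x * wt a x.
Proof. by rewrite gaussc0. Qed.

Lemma hankel_line al eps : 0 < eps ->
  \int[mu]_x (gw a eps x * U (al * x)) =
  c0 * gaussmom a (gaussc eps 0) * expR (- (al ^+ 2 / (4 * eps))).
Proof.
move=> e0; have := hankel_gauss a0 hU al e0; rewrite hprod_line.
have -> : \int[mu]_x (gaussc eps 0 x * wt a x * (U (al * x) * U (0 * x))) =
   \int[mu]_x (c0 * (gw a eps x * U (al * x))).
  by apply: eq_Rintegral => x _; rewrite mul0r (bl_U0 hU) gw_line; ring.
rewrite RintZ; last first.
  have := intgZ c0^-1 (intg_hprod a0 hU al 0 e0 (gauss_like_c eps 0)).
  apply: eq_integrable => // x _ /=; rewrite mul0r (bl_U0 hU) gw_line; congr EFin.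
  by field; rewrite gt_eqF.
by rewrite expr2 -!mulrA => /(mulfI (lt0r_neq0 c00)).
Qed.

Lemma mes_U {d} {T : measurableType d} (u : T -> R) : measurable_fun setT u ->
  measurable_fun setT (fun p => U (u p)).
Proof. exact: mes_comp. Qed.

Let gwU eps x y : `|gw a eps x * U y| <= c0 * gw a eps x.
Proof.
by rewrite normrM (ger0_norm (gw_ge0 _ _ _)) mulrC ler_wpM2r ?gw_ge0//; exact: (bl_U hU).
Qed.

(** The integral in z multiplies the Gaussian in x by exp(-(c x)^2 / (4 del)); the integral in x is
    then again a Hankel transform of a Gaussian, with parameter [e']. The bound is uniform in eps
    and del because del e' >= (c/2)^2. *)
Lemma gauss_hprod al c eps del : 0 < c -> 0 < eps -> 0 < del ->
  \int[mu]_z (gw a del z * hprod a U U al (c * z) (gaussc eps 0) 1)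
    <= c0 ^+ 2 * G1 ^+ 2 * (c / 2) `^ (- (a + 1)).
Proof.
move=> cp e0 d0.
have -> : \int[mu]_z (gw a del z * hprod a U U al (c * z) (gaussc eps 0) 1) =
  \int[mu]_z \int[mu]_x (gw a del z * (gw a eps x * (U (al * x) * U (c * z * x)))).
  apply: eq_Rintegral => z _; rewrite hprod_line -RintZ; last exact: (intg_hprod a0 hU al (c * z) e0 (gauss_like_c eps 0)).
  by apply: eq_Rintegral => x _; rewrite (gw_line eps) mulrA.
rewrite (@Rint_swap_dom _ _ (gw a del) (fun x => c0 ^+ 2 * gw a eps x)); first last.
- move=> z x; rewrite normrM (ger0_norm (gw_ge0 _ _ _)) ler_wpM2l ?gw_ge0//.
  rewrite normrM (ger0_norm (gw_ge0 _ _ _)) mulrC ler_wpM2r ?gw_ge0//.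
  by rewrite normrM expr2 ler_pM//; exact: (bl_U hU).
- by move=> x; apply: mulr_ge0; rewrite ?gw_ge0 ?sqr_ge0.
- by move=> x; exact: gw_ge0.
- by apply: intgZ; exact: (intg_gw a0 hU).
- exact: (intg_gw a0 hU).
- apply: mesM; first by apply: mes_gw; mes.
  by apply: mesM; [apply: mes_gw; mes|apply: mesM; apply: mes_U; mes].
pose e' := eps + c ^+ 2 / (4 * del).
have e'0 : 0 < e' by rewrite addr_gt0// divr_gt0 ?exprn_gt0 ?mulr_gt0.
have E : \int[mu]_x \int[mu]_z (gw a del z * (gw a eps x * (U (al * x) * U (c * z * x)))) =
    c0 * gaussmom a (gaussc del 0) * \int[mu]_x (gw a e' x * U (al * x)).
  rewrite -RintZ; last first.
    apply: (intg_le _ (gwU e' ^~ (al * _))); first by apply: mesM; [apply: mes_gw; mes|apply: mes_U; mes].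
    by apply: intgZ; exact: (intg_gw a0 hU).
  apply: eq_Rintegral => x _.
  transitivity (gw a eps x * U (al * x) * \int[mu]_z (gw a del z * U (c * x * z))).
    rewrite -RintZ; last first.
      apply: (intg_le _ (gwU del ^~ (c * x * _))); first by apply: mesM; [apply: mes_gw; mes|apply: mes_U; mes].
      by apply: intgZ; exact: (intg_gw a0 hU).
    by apply: eq_Rintegral => z _; rewrite (mulrAC c z x); ring.
  rewrite hankel_line//.
  have -> : gw a e' x = gw a eps x * expR (- ((c * x) ^+ 2 / (4 * del))).
    rewrite /gw mulrAC -expRD; congr (expR _ * _); rewrite /e'; field.
    by rewrite gt_eqF.
  by ring.
rewrite E hankel_line//.
have G0 e : 0 <= gaussmom a (gaussc e 0) by exact: gaussmom_ge0.
apply: (@le_trans _ _ (c0 ^+ 2 * (gaussmom a (gaussc del 0) * gaussmom a (gaussc e' 0)))).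
  have -> : forall u v w : R, c0 * u * (c0 * v * w) = c0 ^+ 2 * (u * v) * w by move=> u v w; ring.
  rewrite ler_piMr//; first by apply: mulr_ge0; [exact: sqr_ge0|exact: mulr_ge0].
  rewrite expR_le1 oppr_le0; apply: divr_ge0; first exact: sqr_ge0.
  by rewrite mulr_ge0 ?ltW.
rewrite !gaussmom_scale// [X in _ ^+ 2 * X <= _]mulrACA -[G1 * G1]expr2 -powRM ?(ltW d0) ?(ltW e'0)// mulrA.
rewrite ler_wpM2l//; first by rewrite -exprMn sqr_ge0.
rewrite !powRN lef_pV2 ?posrE ?powR_gt0 ?mulr_gt0//.
have c2 : 0 < c / 2 by rewrite divr_gt0.
have -> : (c / 2) `^ (a + 1) = ((c / 2) ^+ 2) `^ ((a + 1) / 2).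
  by rewrite expr2 [RHS]powRM ?(ltW c2)// -powRDp//; congr (_ `^ _); field.
apply: ler_powRl; [by rewrite divr_ge0// addr_ge0|exact: sqr_ge0|].
rewrite /e' mulrDr; have -> : del * (c ^+ 2 / (4 * del)) = (c / 2) ^+ 2 by field; rewrite gt_eqF.
by rewrite lerDr mulr_ge0 ?ltW.
Qed.

(** The Gaussian in z is removed by Fatou's lemma, the integrand being nonnegative by
    [hprod_ge0]. *)
Lemma hprod_schur al c eps : 0 < c -> 0 < eps ->
  (\int[mu]_z (hprod a U U al (c * z) (gaussc eps 0) 1 * wt a z)%:E
    <= (c0 ^+ 2 * G1 ^+ 2 * (c / 2) `^ (- (a + 1)))%:E)%E.
Proof.
move=> cp e0.
set h := fun z => hprod a U U al (c * z) (gaussc eps 0) 1.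
have h0 z : 0 <= h z by exact: (hprod_ge0 a0 hU).
have mh : measurable_fun setT h.
  have -> : h = fun z => \int[mu]_x (gw a eps x * (U (al * x) * U (c * z * x))).
    apply/funext => z; rewrite /h hprod_line.
    by apply: eq_Rintegral => x _; rewrite gw_line.
  apply: (@mes_Rint R _ _ (fun z x => gw a eps x * (U (al * x) * U (c * z * x)))).
  by apply: mesM; [apply: mes_gw; mes|apply: mesM; apply: mes_U; mes].
have hb z : `|h z| <= c0 ^+ 2 * gaussmom a (gaussc eps 0).
  rewrite /h hprod_line.
  have -> : gaussmom a (gaussc eps 0) = \int[mu]_x gw a eps x.
    rewrite /gaussmom Rint_Dp; apply: eq_Rintegral => x _; rewrite gw_line /wt; ring.
  rewrite -RintZ; last exact: (intg_gw a0 hU).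
  apply: Rint_norm_le.
  - exact: (intg_meas (intg_hprod a0 hU al (c * z) e0 (gauss_like_c eps 0))).
  - by apply: intgZ; exact: (intg_gw a0 hU).
  - move=> x; rewrite -gw_line normrM (ger0_norm (gw_ge0 _ _ _)) mulrC ler_wpM2r ?gw_ge0//.
    by rewrite normrM expr2 ler_pM//; exact: (bl_U hU).
have mw : measurable_fun setT (wt a) by apply: mes_wt; mes.
apply: (@fatou_le _ (fun n z => gw a n.+1%:R^-1 z * h z)).
- by move=> n; apply: mesM => //; apply: mes_gw; mes.
- by move=> n z; rewrite mulr_ge0 ?gw_ge0.
- by mes.
- by move=> z; apply: mulr_ge0; [exact: h0|exact: wt_ge0].
- move=> z; right; rewrite -[X in _ --> X]mul1r.
  have -> : (fun n => gw a n.+1%:R^-1 z * h z) =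
      (fun n => expR (- (n.+1%:R^-1 * z ^+ 2)) * (h z * wt a z)).
    by apply/funext => n; rewrite /gw; ring.
  by apply: cvgM; [exact: cvg_gauss_1|exact: cvg_cst].
- move=> n; have d0 : 0 < n.+1%:R^-1 :> R by rewrite invr_gt0.
  have ig : intg (fun z => gw a n.+1%:R^-1 z * h z).
    apply: (intg_le _ _ (intgZ (c0 ^+ 2 * gaussmom a (gaussc eps 0)) (intg_gw a0 hU d0))).
      by apply: mesM => //; apply: mes_gw; mes.
    by move=> z; rewrite normrM (ger0_norm (gw_ge0 _ _ _)) mulrC ler_wpM2r ?gw_ge0.
  by rewrite -RintE// lee_fin; exact: gauss_hprod.
Qed.

End SchurBound.

(** * The forms at two times: L^2 bound, dispersive bound and their interpolation *)

Section Forms.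
Context {R : realType}.
Implicit Types (f g h : R -> R) (x y z t s eps al be b c : R).
Local Notation mu := (@lebesgue_measure R).
Local Notation intg f := (mu.-integrable setT (EFin \o f)).
Local Notation meas2 G := (measurable_fun setT (fun p : R * R => G p.1 p.2)).

Definition Kb a (U : R -> R) (i : bool) x y t : R := if i then Kc a U x y t else Ks a U x y t.

Lemma mes_Kb a U i {d} {T : measurableType d} (u v k : T -> R) : measurable_fun setT U ->
  measurable_fun setT u -> measurable_fun setT v -> measurable_fun setT k ->
  measurable_fun setT (fun p => Kb a U i (u p) (v p) (k p)).
Proof. by case: i => *; [exact: mes_Kc|exact: mes_Ks]. Qed.

Variables (a c0 : R) (U P Q : R -> R).
Hypotheses (a0 : 0 <= a) (hU : bessel_like a c0 U P Q).

Let mU := bl_measurable hU.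
Let c00 : 0 < c0. Proof. exact: (bl_gt0 hU). Qed.
Let mw : measurable_fun setT (wt a). Proof. exact: mes_wt. Qed.
Let w0 x : 0 <= wt a x. Proof. exact: wt_ge0. Qed.

(** The real ([true]) or imaginary ([false]) part of S_a(-t) f for a real function f. *)
Definition Lf (i : bool) t f x : R := \int[mu]_y (f y * wt a y * Kb a U i x y t).

Lemma Kb_le i x y t : `|Kb a U i x y t| <= kap a t * c0.
Proof. by case: i; [exact: (Kc_le hU)|exact: (Ks_le hU)]. Qed.

Lemma Lf_integrable i t f x : nice (wt a) f -> intg (fun y => f y * wt a y * Kb a U i x y t).
Proof.
move=> nf; have [mf _ inf] := nf; apply: (intg_le _ _ (intgZ (kap a t * c0) inf)).
  by apply: mesM; [exact: mesM|apply: mes_Kb; mes].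
move=> y; rewrite normrM normrM (ger0_norm (w0 y)) [leRHS]mulrC ler_wpM2l//.
  by rewrite mulr_ge0.
exact: Kb_le.
Qed.

Lemma Lf_le i t f x : nice (wt a) f ->
  `|Lf i t f x| <= kap a t * c0 * \int[mu]_y (`|f y| * wt a y).
Proof.
move=> nf; have [mf _ inf] := nf; rewrite -RintZ//.
apply: Rint_norm_le; [exact: (intg_meas (Lf_integrable i t x nf))|exact: intgZ|].
move=> y; rewrite normrM normrM (ger0_norm (w0 y)) [leRHS]mulrC ler_wpM2l//.
  by rewrite mulr_ge0.
exact: Kb_le.
Qed.

Lemma measurable_Lf i t f : nice (wt a) f -> measurable_fun setT (Lf i t f).
Proof.
move=> [mf _ _]; apply: (@mes_Rint R _ _ (fun x y => f y * wt a y * Kb a U i x y t)).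
apply: mesM; last by apply: mes_Kb; mes.
by apply: mesM; [apply: (mes_comp (k := f)); mes|apply: mes_wt; mes].
Qed.

Section Eps.
Variable eps : R.
Hypothesis e0 : 0 < eps.

Let igw := intg_gw a0 hU e0.
Local Notation Wker := (Wker a U eps).

Definition WK (i : bool) t s y z : R :=
  \int[mu]_x (gw a eps x * (Kb a U i x y t * Kb a U i x z s)).

Lemma WK_integrable i t s y z :
  intg (fun x => gw a eps x * (Kb a U i x y t * Kb a U i x z s)).
Proof.
apply: (intg_le _ _ (intgZ (kap a t * c0 * (kap a s * c0)) igw)).
  by apply: mesM; [apply: mes_gw; mes|apply: mesM; apply: mes_Kb; mes].
move=> x; rewrite normrM (ger0_norm (gw_ge0 _ _ _)) mulrC ler_wpM2r ?gw_ge0//.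
by rewrite normrM ler_pM//; exact: Kb_le.
Qed.

Lemma WK_le i t s y z :
  `|WK i t s y z| <= kap a t * c0 * (kap a s * c0) * \int[mu]_x gw a eps x.
Proof.
rewrite -RintZ//; apply: Rint_norm_le; [exact: (intg_meas (WK_integrable i t s y z))|exact: intgZ|].
move=> x; rewrite normrM (ger0_norm (gw_ge0 _ _ _)) mulrC ler_wpM2r ?gw_ge0//.
by rewrite normrM ler_pM//; exact: Kb_le.
Qed.

Lemma meas2_WK i t s : meas2 (WK i t s).
Proof.
rewrite /WK; apply: (@mes_Rint R _ _ (fun p x => gw a eps x *
  (Kb a U i x p.1 t * Kb a U i x p.2 s))).
by apply: mesM; [apply: mes_gw; mes|apply: mesM; apply: mes_Kb; mes].
Qed.

Lemma W_WK t s y z : Wker t s y z = WK true t s y z + WK false t s y z.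
Proof.
by rewrite -RintD; [|exact: WK_integrable|exact: WK_integrable];
  apply: eq_Rintegral => x _; rewrite -mulrDr.
Qed.

Lemma Lf_form i t s f g : nice (wt a) f -> nice (wt a) g ->
  \int[mu]_x (gw a eps x * (Lf i t f x * Lf i s g x)) = form (wt a) (WK i t s) f g.
Proof.
move=> nf ng; have [mf _ inf] := nf; have [mg _ ing] := ng.
pose H1 x z := gh a eps x * (g z * wt a z * Kb a U i x z s).
pose H2 x y := gh a eps x * (f y * wt a y * Kb a U i x y t).
have mH1 : meas2 H1.
  apply: mesM; first by apply: mes_gh; mes.
  apply: mesM; last by apply: mes_Kb; mes.
  by apply: mesM; [apply: (mes_comp (k := g)); mes|apply: mes_wt; mes].
have mH2 : meas2 H2.
  apply: mesM; first by apply: mes_gh; mes.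
  apply: mesM; last by apply: mes_Kb; mes.
  by apply: mesM; [apply: (mes_comp (k := f)); mes|apply: mes_wt; mes].
have bH h t' x y : `|gh a eps x * (h y * wt a y * Kb a U i x y t')| <=
    gh a eps x * (kap a t' * c0 * (`|h y| * wt a y)).
  rewrite normrM (ger0_norm (gh_ge0 _ _ _)) ler_wpM2l ?gh_ge0//.
  rewrite normrM normrM (ger0_norm (w0 y)) [leRHS]mulrC ler_wpM2l//.
    by rewrite mulr_ge0.
  exact: Kb_le.
have k0 h t' y : 0 <= kap a t' * c0 * (`|h y| * wt a y).
  by apply: mulr_ge0; [apply: mulr_ge0; [exact: kap_ge0|exact: ltW]|exact: mulr_ge0].
transitivity (\int[mu]_x ((\int[mu]_z H1 x z) * (\int[mu]_y H2 x y))).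
  apply: eq_Rintegral => x _.
  rewrite [X in _ = X * _](RintZ _ (Lf_integrable i s x ng)).
  rewrite [X in _ = _ * X](RintZ _ (Lf_integrable i t x nf)) -gh_sq /Lf; ring.
rewrite (@Rint_bilinear _ H1 H2 (gh a eps) (fun z => kap a s * c0 * (`|g z| * wt a z))
  (fun y => kap a t * c0 * (`|f y| * wt a y)))//; first last.
- by move=> x z; exact: bH.
- by move=> x z; exact: bH.
- by move=> x; exact: gh_ge0.
- exact: intgZ.
- exact: intgZ.
- by apply: eq_integrable igw => // x _ /=; rewrite gh_sq.
- by apply: mes_gh; mes.
apply: eq_Rintegral => z _.
have ii := form_in_integrable mw w0 (meas2_WK i t s) (WK_le i t s) z nf.
rewrite -RintZ//; apply: eq_Rintegral => y _.
transitivity (g z * wt a z * (f y * wt a y) * WK i t s y z); last exact: (esym (mulrA _ _ _)).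
rewrite -RintZ; last exact: WK_integrable.
by apply: eq_Rintegral => x _; rewrite /H1 /H2 -gh_sq; ring.
Qed.

Lemma form_W t s f g : nice (wt a) f -> nice (wt a) g ->
  form (wt a) (Wker t s) f g =
  form (wt a) (WK true t s) f g + form (wt a) (WK false t s) f g.
Proof.
move=> nf ng.
have ii i z := form_in_integrable mw w0 (meas2_WK i t s) (WK_le i t s) z nf.
have io i := form_integrable mw w0 (meas2_WK i t s) (WK_le i t s) nf ng.
rewrite /form -RintD; [|exact: io|exact: io].
apply: eq_Rintegral => z _; rewrite -mulrDr; congr (_ * _).
rewrite -RintD; [|exact: ii|exact: ii].
by apply: eq_Rintegral => y _; rewrite W_WK mulrDr.
Qed.

Lemma LfLf_integrable i t s f g : nice (wt a) f -> nice (wt a) g ->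
  intg (fun x => gw a eps x * (Lf i t f x * Lf i s g x)).
Proof.
move=> nf ng.
apply: (intg_le _ _ (intgZ (kap a t * c0 * (\int[mu]_y (`|f y| * wt a y)) *
   (kap a s * c0 * (\int[mu]_y (`|g y| * wt a y)))) igw)).
  by apply: mesM; [apply: mes_gw; mes|apply: mesM; exact: measurable_Lf].
move=> x; rewrite normrM (ger0_norm (gw_ge0 _ _ _)) mulrC ler_wpM2r ?gw_ge0//.
by rewrite normrM ler_pM//; exact: Lf_le.
Qed.

Lemma form_W_Lf t s f g : nice (wt a) f -> nice (wt a) g ->
  form (wt a) (Wker t s) f g =
  \int[mu]_x (gw a eps x * (Lf true t f x * Lf true s g x + Lf false t f x * Lf false s g x)).
Proof.
move=> nf ng; rewrite form_W// -!Lf_form// -RintD; [|exact: LfLf_integrable|exact: LfLf_integrable].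
by apply: eq_Rintegral => x _; rewrite mulrDr.
Qed.

(** The form is the inner product, in the weight [gw], of the pairs made of the real and imaginary
    parts, so |u.v| <= (|u|^2 + |v|^2) / 2 reduces the L^2 bound to equal times. *)
Lemma form_W_CS t s f g : nice (wt a) f -> nice (wt a) g ->
  `|form (wt a) (Wker t s) f g| <=
  2^-1 * (form (wt a) (Wker t t) f f + form (wt a) (Wker s s) g g).
Proof.
move=> nf ng; rewrite !form_W_Lf//.
have ii t' s' f' g' : nice (wt a) f' -> nice (wt a) g' -> intg (fun x => gw a eps x *
   (Lf true t' f' x * Lf true s' g' x + Lf false t' f' x * Lf false s' g' x)).
  move=> nf' ng'; have := intgD (LfLf_integrable true t' s' nf' ng') (LfLf_integrable false t' s' nf' ng').
  by apply: eq_integrable => // x _ /=; rewrite mulrDr.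
rewrite -RintD; [|exact: ii|exact: ii].
rewrite -RintZ; last by apply: intgD; exact: ii.
apply: Rint_norm_le; [exact: (intg_meas (ii t s f g nf ng))|by apply: intgZ; apply: intgD; exact: ii|].
move=> x; rewrite normrM (ger0_norm (gw_ge0 _ _ _)) -mulrDr mulrCA ler_wpM2l ?gw_ge0//.
move: (Lf true t f x) (Lf true s g x) (Lf false t f x) (Lf false s g x) => p q r u.
rewrite ler_norml; apply/andP; split.
  have := sqr_ge0 (p + q); have := sqr_ge0 (r + u); rewrite !sqrrD !expr2; lra.
have := sqr_ge0 (p - q); have := sqr_ge0 (r - u); rewrite !sqrrB !expr2; lra.
Qed.

(** The Schur constant at c = 1 / (2 |t|): the product of kap^2 = (2 |t|)^(-(a+1)) and
    (c/2)^(-(a+1)) is 2^(a+1), independent of t. *)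
Definition Cdiag : R := c0 ^+ 2 * G1 a ^+ 2 * 2 `^ (a + 1).

Lemma Cdiag_ge0 : 0 <= Cdiag.
Proof. by rewrite /Cdiag -exprMn; apply: mulr_ge0; [exact: sqr_ge0|exact: powR_ge0]. Qed.

(** At equal times b = 0: the sine integral drops out and the cosine integral is nonnegative, so [A]
    dominates the kernel and Schur's test applies to it. *)
Lemma form_W_diag t f : t != 0 -> nice (wt a) f ->
  form (wt a) (Wker t t) f f <= Cdiag * \int[mu]_y (f y ^+ 2 * wt a y).
Proof.
move=> t0 nf; have [mf _ inf] := nf.
have at0 : 0 < 2 * `|t| by rewrite mulr_gt0// normr_gt0.
pose A y z := kap a t ^+ 2 * hprod a U U (y / (2 * `|t|)) (z / (2 * `|t|)) (gaussc eps 0) 1.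
have h0 al be : 0 <= hprod a U U al be (gaussc eps 0) 1 by exact: (hprod_ge0 a0 hU).
have A0 y z : 0 <= A y z by apply: mulr_ge0; [exact: sqr_ge0|exact: h0].
have As y z : A y z = A z y by rewrite /A hprodC.
have mA : meas2 A.
  apply: mesM; first by mes.
  rewrite (_ : (fun p : R * R => _) = (fun p => \int[mu]_x (gw a eps x *
    (U (p.1 / (2 * `|t|) * x) * U (p.2 / (2 * `|t|) * x))))); last first.
    apply/funext => p; rewrite hprod_line.
    by apply: eq_Rintegral => x _; rewrite gw_line.
  apply: (@mes_Rint R _ _ (fun (p : R * R) (x : R) => gw a eps x *
    (U (p.1 / (2 * `|t|) * x) * U (p.2 / (2 * `|t|) * x)))).
  by apply: mesM; [apply: mes_gw; mes|apply: mesM; apply: (mes_comp (k := U)) => //; mes].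
have WA y z : `|Wker t t y z| <= A y z.
  rewrite (W_hprod a0 hU t t y z e0) subrr gausss0.
  have -> : hprod a U U (y / (2 * `|t|)) (z / (2 * `|t|)) (fun _ => 0) 1 = 0.
    rewrite hprod_line; under eq_Rintegral do rewrite !mul0r.
    by rewrite Rintegral_cst// mul0r.
  rewrite mulr0 addr0 !normrM !(ger0_norm (kap_ge0 _ _)) (ger0_norm (h0 _ _)) /A expr2.
  rewrite ler_wpM2l ?mulr_ge0 ?kap_ge0// ler_piMl//.
  by rewrite ler_norml cos_geN1 cos_le1.
have AC y : (\int[mu]_z (A y z * wt a z)%:E <= Cdiag%:E)%E.
  have cp : 0 < (2 * `|t|)^-1 by rewrite invr_gt0.
  have h := hprod_schur a0 hU (y / (2 * `|t|)) cp e0.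
  have E : (\int[mu]_z (A y z * wt a z)%:E = (kap a t ^+ 2)%:E *
     \int[mu]_z (hprod a U U (y / (2 * `|t|)) ((2 * `|t|)^-1 * z) (gaussc eps 0) 1 * wt a z)%:E)%E.
    rewrite -int_ge0Z.
    - by apply: eq_integral => z _; rewrite /A -mulrA (mulrC z).
    - apply: mesM => //.
      have := meas2_1 y mA; move/(mesM (measurable_cst (kap a t ^- 2))).
      have k2 : kap a t ^+ 2 != 0 by rewrite expf_neq0// gt_eqF// powR_gt0.
      by apply: eq_measurable_fun => z _; rewrite /A mulKf// (mulrC z).
    - by move=> z; apply: mulr_ge0; [exact: h0|exact: w0].
    - exact: sqr_ge0.
  rewrite E; apply: (le_trans (lee_wpmul2l _ h)); first by rewrite lee_fin sqr_ge0.
  rewrite -EFinM lee_fin /Cdiag mulrCA ler_wpM2l//.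
    by rewrite -exprMn sqr_ge0.
  rewrite /kap expr2 -powRDp//.
  have -> : - ((a + 1) / 2) + - ((a + 1) / 2) = - (a + 1) by field.
  rewrite -powRM ?(ltW at0) ?divr_ge0 ?(ltW cp)// mulrA divff ?gt_eqF// mul1r.
  by rewrite -(powR_inv1 (ler0n R 2)) -powRrM mulN1r opprK.
have h1 := schur mw w0 mA A0 As Cdiag_ge0 AC mf (nice_sq mw w0 nf).
rewrite -lee_fin; apply: le_trans h1.
have mW := meas2_W hU eps t t.
have mWf : measurable_fun setT (fun z => \int[mu]_y (f y * wt a y * Wker t t y z)).
  apply: (@mes_Rint R _ _ (fun z y => f y * wt a y * Wker t t y z)).
  apply: mesM; last by exact: (meas2C mW).
  by apply: mesM; [apply: (mes_comp (k := f)); mes|apply: mes_wt; mes].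
have mfw : measurable_fun setT (fun z => f z * wt a z) by mes.
have mI := mesM mfw mWf.
apply: (@le_trans _ _ (`|form (wt a) (Wker t t) f f|)%:E); first by rewrite lee_fin ler_norm.
apply: (le_trans (Rint_abs_le mI)).
have nfw z : 0 <= `|f z| * wt a z by apply: mulr_ge0.
apply: ge0_le_integral => //.
- by apply/measurable_EFinP; apply: mes_norm.
- apply: (@mes_int_ge0 R _ _ (fun z y => `|f z| * wt a z * (`|f y| * wt a y * A y z))).
    apply: mesM.
      by apply: mesM; [apply: mes_norm; apply: (mes_comp (k := f)); mes|apply: mes_wt; mes].
    apply: mesM; last exact: (meas2C mA).
    by apply: mesM; [apply: mes_norm; apply: (mes_comp (k := f)); mes|apply: mes_wt; mes].
  by move=> z y; apply: mulr_ge0 => //; apply: mulr_ge0.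
- move=> z _; rewrite normrM normrM (ger0_norm (w0 z)) EFinM.
  have mi : measurable_fun setT (fun y => f y * wt a y * Wker t t y z).
    by apply: mesM; [mes|exact: (meas2_2 z mW)].
  have mAz : measurable_fun setT (fun y => `|f y| * wt a y * A y z).
    by apply: mesM; [mes|exact: (meas2_2 z mA)].
  rewrite int_ge0Z//; last first.
    by move=> y; apply: mulr_ge0.
  apply: lee_wpmul2l; first by rewrite lee_fin.
  apply: (le_trans (Rint_abs_le mi)); apply: int_ge0_le => //.
  + exact: mes_norm.
  + by move=> y; rewrite normrM normrM (ger0_norm (w0 y)) ler_wpM2l// mulr_ge0.
Qed.

Lemma form_W_L2 t s f g : t != 0 -> s != 0 -> nice (wt a) f -> nice (wt a) g ->
  `|form (wt a) (Wker t s) f g| <=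
  Cdiag * (\int[mu]_y (f y ^+ 2 * wt a y) + \int[mu]_y (g y ^+ 2 * wt a y)).
Proof.
move=> t0 s0 nf ng; apply: (le_trans (form_W_CS t s nf ng)).
have f1 := form_W_diag t0 nf; have g1 := form_W_diag s0 ng.
have i0 h : 0 <= \int[mu]_y (h y ^+ 2 * wt a y).
  by apply: Rintegral_ge0 => y _; apply: mulr_ge0; [exact: sqr_ge0|exact: w0].
have h := mulr_ge0 Cdiag_ge0 (addr_ge0 (i0 f) (i0 g)).
have alg (X Y S : R) : X + Y <= S -> 0 <= S -> 2^-1 * (X + Y) <= S.
  move=> XY S0; apply: (le_trans (ler_wpM2l _ XY)); first by rewrite invr_ge0.
  by rewrite ler_piMl// invf_le1// ler1n.
by apply: alg => //; rewrite mulrDr; exact: lerD.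
Qed.

(** The constant of [form_interp]; the added 1 makes the sup bound strictly positive, [G1] being
    only known to be nonnegative. *)
Definition Cdisp (p : R) : R := ((1 + Cdiag) / p + Cdiag / (2 - p)) *
  (c0 ^+ 2 * G1 a + 1) `^ (2 / p - 1).

Lemma Cdisp_ge0 (p : R) : 1 < p -> p < 2 -> 0 <= Cdisp p.
Proof.
move=> p1 p2; have C := Cdiag_ge0.
have p0 : 0 < p by lra.
have p20 : 0 < 2 - p by lra.
apply: mulr_ge0; last exact: powR_ge0.
by apply: addr_ge0; apply: divr_ge0; rewrite ?(ltW p0) ?(ltW p20)//; apply: addr_ge0.
Qed.

Lemma form_W_disp t s f g (p : R) : t != 0 -> s != 0 -> t != s -> 1 < p -> p < 2 ->
  nice (wt a) f -> nice (wt a) g ->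
  `|form (wt a) (Wker t s) f g| <= Cdisp p * `|t - s| `^ (- ((a + 1) / 2 * (2 / p - 1))) *
    ((\int[mu]_y (`|f y| `^ p * wt a y)) * \int[mu]_y (`|g y| `^ p * wt a y)) `^ p^-1.
Proof.
move=> t0 s0 ts p1 p2 nf ng.
have K0 : 0 < c0 ^+ 2 * G1 a + 1.
  by rewrite ltr_pwDr//; apply: mulr_ge0; [exact: sqr_ge0|exact: gaussmom_ge0].
have d0 : 0 < `|t - s| by rewrite normr_gt0 subr_eq0.
have M0 : 0 < (c0 ^+ 2 * G1 a + 1) * `|t - s| `^ (- ((a + 1) / 2)).
  by rewrite mulr_gt0// powR_gt0.
have WM y z : `|Wker t s y z| <= (c0 ^+ 2 * G1 a + 1) * `|t - s| `^ (- ((a + 1) / 2)).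
  apply: (le_trans (W_le a0 hU y z e0 t0 s0 ts)).
  by rewrite ler_wpM2r ?powR_ge0// lerDl.
have L2 f' g' : nice (wt a) f' -> nice (wt a) g' -> _ := @form_W_L2 t s f' g' t0 s0.
have := form_interp mw w0 (meas2_W hU eps t s) M0 WM Cdiag_ge0 L2 p1 p2 nf ng.
by rewrite powRM ?powR_ge0 ?(ltW K0)// -powRrM mulNr mulrA /Cdisp.
Qed.

End Eps.
End Forms.

(** * The truncated operators and the limit *)

Section Truncated.
Context {R : realType}.
Implicit Types (x y z t s eps : R).
Local Notation mu := (@lebesgue_measure R).
Local Notation intg f := (mu.-integrable setT (EFin \o f)).
Local Notation meas2 G := (measurable_fun setT (fun p : R * R => G p.1 p.2)).
Local Notation ind := (@ind R).

(** The lower cut-off avoids the singularity of [kap] at t = 0, the upper one leaves a time interval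
    of finite length. *)
Definition chi n t : R := ind (n.+1%:R^-1 <= `|t|) * ind (`|t| <= n.+1%:R).

Lemma chi_ge0 n t : 0 <= chi n t.
Proof. by rewrite mulr_ge0 ?ind_ge0. Qed.

Lemma chi_le1 n t : chi n t <= 1.
Proof. by rewrite /chi /ind; do 2 case: ifP; rewrite ?mul1r ?mul0r ?mulr1 ?mulr0. Qed.

Lemma chi_neq0 n t : chi n t != 0 -> n.+1%:R^-1 <= `|t|.
Proof. by rewrite /chi /ind; case: ifP => //; rewrite mul0r eqxx. Qed.

Lemma mes_chi n {d} {T : measurableType d} (u : T -> R) : measurable_fun setT u ->
  measurable_fun setT (fun p => chi n (u p)).
Proof. by move=> ?; rewrite /chi; mes. Qed.

Lemma chi_integrable n : intg (chi n).
Proof.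
apply: (intg_le (g := fun t => ind (`|t| <= n.+1%:R))).
- exact: mes_chi.
- move=> t; rewrite ger0_norm ?chi_ge0// /chi ler_piMl ?ind_ge0 ?ind_le1//.
- apply: intg_ge0; first by mes.
    by move=> t; exact: ind_ge0.
  apply: (@le_lt_trans _ _ (mu `[- n.+1%:R, n.+1%:R])); last first.
    by rewrite lebesgue_measure_itv/=; case: ifP => //; rewrite -EFinB ltry.
  rewrite -(setIT `[_, _]%classic) -integral_indic//.
  apply: ge0_le_integral => //.
  - by move=> t _; rewrite lee_fin ind_ge0.
  - by apply/measurable_EFinP; mes.
  - by apply/measurable_EFinP; exact: measurable_indic.
  - move=> t _; rewrite lee_fin /ind indicE ler_norml; case: ifP => // h.
    by rewrite mem_set//= in_itv.
Qed.

Lemma int_diag t : (\int[mu]_s (ind (t <= s) * ind (s <= t))%:E = 0)%E.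
Proof.
rewrite (@eq_integral _ _ _ mu setT (fun s => (\1_[set t] s)%:E)); last first.
  move=> s _; rewrite indicE /ind; congr EFin.
  case: (ltgtP t s) => h; rewrite ?mulr0 ?mul0r ?mulr1.
  - by rewrite memNset//= => e; move: h; rewrite e ltxx.
  - by rewrite memNset//= => e; move: h; rewrite e ltxx.
  - by rewrite mem_set.
by rewrite integral_indic// setIT; exact: lebesgue_measure_set1.
Qed.

Variables (a c0 : R) (U P Q : R -> R).
Hypotheses (a0 : 0 <= a) (hU : bessel_like a c0 U P Q).
Variables (f : R -> R -> R) (B p N : R).
Hypotheses (mf : meas2 f) (nf : forall t, nice (wt a) (f t))
  (fB : forall t, \int[mu]_y (`|f t y| * wt a y) <= B) (p1 : 1 < p) (p2 : p < 2).

Let mU := bl_measurable hU.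
Let c00 : 0 < c0. Proof. exact: (bl_gt0 hU). Qed.
Local Notation L := (Lf a U).

Let beta := (a + 1) / 2 * (2 / p - 1).
Let phi t := (\int[mu]_y (`|f t y| `^ p * wt a y)) `^ p^-1.
Hypotheses (b0 : 0 < beta) (b1 : beta < 1) (N0 : 0 <= N)
  (phiN : (\int[mu]_t (phi t `^ (2 / (2 - beta)))%:E <= N%:E)%E).

Definition Rn (i : bool) n x : R := \int[mu]_t (chi n t * L i t (f t) x).

Lemma measurable_Lft i {d} {T : measurableType d} (u v : T -> R) :
  measurable_fun setT u -> measurable_fun setT v ->
  measurable_fun setT (fun q => L i (u q) (f (u q)) (v q)).
Proof.
move=> mu_ mv; rewrite /Lf.
apply: (@mes_Rint R _ _ (fun q y => f (u q) y * wt a y * Kb a U i (v q) y (u q))).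
have m1 : measurable_fun setT (fun q : T * R => u q.1) by exact: measurableT_comp.
have m2 : measurable_fun setT (fun q : T * R => v q.1) by exact: measurableT_comp.
apply: mesM; last by apply: mes_Kb; mes.
by apply: mesM; [apply: (mes_comp2 mf); mes|apply: mes_wt; mes].
Qed.

(** On the support of the cut-off |t| >= 1/(n+1), which bounds [kap a t] by the first factor; [c0]
    bounds U and [B] the weighted L^1 norms. *)
Let Kn n := (2 / n.+1%:R) `^ (- ((a + 1) / 2)) * c0 * B.

Lemma B_ge0 : 0 <= B.
Proof.
apply: le_trans (fB 0); apply: Rintegral_ge0 => y _.
by apply: mulr_ge0 => //; exact: wt_ge0.
Qed.

Lemma chi_L_le i n t x : `|chi n t * L i t (f t) x| <= chi n t * Kn n.
Proof.
rewrite normrM (ger0_norm (chi_ge0 _ _)).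
have [->|h] := eqVneq (chi n t) 0; first by rewrite !mul0r.
rewrite ler_wpM2l ?chi_ge0//; apply: (le_trans (Lf_le hU i t x (nf t))).
have k0 : 0 <= (2 / n.+1%:R) `^ (- ((a + 1) / 2)) * c0 :> R.
  by apply: mulr_ge0; [exact: powR_ge0|exact: ltW].
rewrite /Kn; apply: ler_pM => //.
- by apply: mulr_ge0; [exact: kap_ge0|exact: ltW].
- by apply: Rintegral_ge0 => y _; apply: mulr_ge0 => //; exact: wt_ge0.
rewrite ler_wpM2r ?(ltW c00)// /kap !powRN.
have n0 : 0 < n.+1%:R^-1 :> R by rewrite invr_gt0.
have t0 : 0 < `|t| by apply: lt_le_trans (chi_neq0 h).
rewrite lef_pV2 ?posrE ?powR_gt0 ?mulr_gt0//; apply: ler_powRl.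
- by rewrite divr_ge0// addr_ge0.
- by rewrite mulr_ge0// ltW.
- by rewrite ler_wpM2l//; exact: chi_neq0 h.
Qed.

Lemma Rn_le i n x : `|Rn i n x| <= Kn n * \int[mu]_t chi n t.
Proof.
rewrite -RintZ; last exact: chi_integrable.
apply: Rint_norm_le.
- by apply: mesM; [apply: mes_chi; mes|apply: measurable_Lft; mes].
- by apply: intgZ; exact: chi_integrable.
- by move=> t; rewrite (mulrC (Kn n)); exact: chi_L_le.
Qed.

Lemma measurable_Rn i n : measurable_fun setT (Rn i n).
Proof.
apply: (@mes_Rint R _ _ (fun x t => chi n t * L i t (f t) x)).
by apply: mesM; [apply: mes_chi; mes|apply: measurable_Lft; mes].
Qed.

Section Eps.
Variable (n : nat) (eps : R).
Hypothesis e0 : 0 < eps.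

Let igw := intg_gw a0 hU e0.
Let A i t s := \int[mu]_x (gw a eps x * (L i t (f t) x * L i s (f s) x)).

Lemma Rn_integrable i : intg (fun x => gw a eps x * Rn i n x ^+ 2).
Proof.
apply: (intg_le _ _ (intgZ ((Kn n * \int[mu]_t chi n t) ^+ 2) igw)).
  by apply: mesM; [apply: mes_gw; mes|apply: mesX; exact: measurable_Rn].
move=> x; rewrite normrM (ger0_norm (gw_ge0 _ _ _)) mulrC ler_wpM2r ?gw_ge0//.
by rewrite normrX !expr2; apply: ler_pM => //; exact: Rn_le.
Qed.

Lemma measurable_chi_form i : meas2 (fun t s => chi n t * (chi n s * A i t s)).
Proof.
apply: mesM; first by apply: mes_chi; mes.
apply: mesM; first by apply: mes_chi; mes.
apply: (@mes_Rint R _ _ (fun (q : R * R) (x : R) => gw a eps x * (L i q.1 (f q.1) x * L i q.2 (f q.2) x))).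
by apply: mesM; [apply: mes_gw; mes|apply: mesM; apply: measurable_Lft; mes].
Qed.

Lemma chi_form_le i t s : `|chi n t * (chi n s * A i t s)| <=
  (chi n t * Kn n) * (chi n s * (Kn n * \int[mu]_x gw a eps x)).
Proof.
have iA : intg (fun x => gw a eps x * (L i t (f t) x * L i s (f s) x)).
  exact: (LfLf_integrable a0 hU e0).
have -> : chi n t * (chi n s * A i t s) =
   \int[mu]_x (chi n t * chi n s * (gw a eps x * (L i t (f t) x * L i s (f s) x))).
  by rewrite RintZ// mulrA.
have -> : (chi n t * Kn n) * (chi n s * (Kn n * \int[mu]_x gw a eps x)) =
   \int[mu]_x (chi n t * Kn n * (chi n s * Kn n) * gw a eps x).
  by rewrite RintZ// !mulrA.
apply: Rint_norm_le; [by have := intgZ (chi n t * chi n s) iA; exact: intg_meas|exact: intgZ|].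
move=> x.
have -> : chi n t * chi n s * (gw a eps x * (L i t (f t) x * L i s (f s) x)) =
   (chi n t * L i t (f t) x) * (chi n s * L i s (f s) x) * gw a eps x by ring.
rewrite normrM (ger0_norm (gw_ge0 _ _ _)) ler_wpM2r ?gw_ge0// normrM.
by apply: ler_pM => //; exact: chi_L_le.
Qed.

Lemma Rn_energy i : \int[mu]_x (gw a eps x * Rn i n x ^+ 2) =
  \int[mu]_t \int[mu]_s (chi n t * (chi n s * A i t s)).
Proof.
pose H x t := gh a eps x * (chi n t * L i t (f t) x).
have mH : meas2 H.
  apply: mesM; first by apply: mes_gh; mes.
  by apply: mesM; [apply: mes_chi; mes|apply: measurable_Lft; mes].
have K0 : 0 <= Kn n.
  rewrite /Kn; apply: mulr_ge0; last exact: B_ge0.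
  by apply: mulr_ge0; [exact: powR_ge0|exact: ltW].
have ic x : intg (fun t => chi n t * L i t (f t) x).
  apply: (intg_le _ (fun t => chi_L_le i n t x)).
    by apply: mesM; [apply: mes_chi; mes|apply: measurable_Lft; mes].
  have := intgZ (Kn n) (chi_integrable n).
  by apply: eq_integrable => // t _ /=; rewrite mulrC.
transitivity (\int[mu]_x ((\int[mu]_t H x t) * (\int[mu]_s H x s))).
  by apply: eq_Rintegral => x _; rewrite (RintZ _ (ic x)) -gh_sq /Rn; ring.
rewrite (@Rint_bilinear _ H H (gh a eps) (fun t => Kn n * chi n t) (fun t => Kn n * chi n t))//; first last.
- by move=> x t; rewrite normrM (ger0_norm (gh_ge0 _ _ _)) ler_wpM2l ?gh_ge0// (mulrC (Kn n)); exact: chi_L_le.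
- by move=> x t; rewrite normrM (ger0_norm (gh_ge0 _ _ _)) ler_wpM2l ?gh_ge0// (mulrC (Kn n)); exact: chi_L_le.
- by move=> t; rewrite mulr_ge0 ?chi_ge0.
- by move=> t; rewrite mulr_ge0 ?chi_ge0.
- by move=> t; exact: gh_ge0.
- by apply: intgZ; exact: chi_integrable.
- by apply: intgZ; exact: chi_integrable.
- by apply: eq_integrable igw => // x _ /=; rewrite gh_sq.
- by apply: mes_gh; mes.
apply: eq_Rintegral => t _; apply: eq_Rintegral => s _.
rewrite mulrA -RintZ; last exact: (LfLf_integrable a0 hU e0).
by apply: eq_Rintegral => x _; rewrite /H -gh_sq; ring.
Qed.

Let G t s := chi n t * (chi n s * A true t s) + chi n t * (chi n s * A false t s).

Definition Cen : R := Cdisp a c0 p * (2 * (2 / (1 - beta) + 3)).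

Lemma phi_ge0 t : 0 <= phi t. Proof. exact: powR_ge0. Qed.

(** The dispersive bound requires distinct times, and at t = s the singular power is 0 by
    convention. The diagonal value is kept as a separate term supported on a null set, which
    [int_diag] discards after integration in s. *)
Lemma chi_form_le_riesz t s : `|G t s| <= Cdisp a c0 p * (phi t * phi s * `|t - s| `^ (- beta)) +
  `|G t t| * (ind (t <= s) * ind (s <= t)).
Proof.
have C0 := Cdisp_ge0 a c0 p1 p2.
have D0 : 0 <= Cdisp a c0 p * (phi t * phi s * `|t - s| `^ (- beta)).
  by apply: mulr_ge0 => //; rewrite !mulr_ge0 ?powR_ge0.
have [->|ts] := eqVneq t s.
  by rewrite lexx /ind !mulr1 lerDr; apply: mulr_ge0 => //; rewrite !mulr_ge0 ?powR_ge0.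
have i0 : 0 <= `|G t t| * (ind (t <= s) * ind (s <= t)) by rewrite !mulr_ge0 ?ind_ge0.
apply: (@le_trans _ _ (Cdisp a c0 p * (phi t * phi s * `|t - s| `^ (- beta)))); last by rewrite lerDl.
have -> : G t s = chi n t * chi n s * form (wt a) (Wker a U eps t s) (f t) (f s).
  rewrite (form_W_Lf a0 hU e0)// /G.
  have -> : \int[mu]_x (gw a eps x * (L true t (f t) x * L true s (f s) x + L false t (f t) x * L false s (f s) x))
    = A true t s + A false t s.
    rewrite -RintD; [|exact: (LfLf_integrable a0 hU e0)|exact: (LfLf_integrable a0 hU e0)].
    by apply: eq_Rintegral => x _; rewrite mulrDr.
  by rewrite -!mulrDr mulrA.
have [h|ht] := eqVneq (chi n t) 0; first by rewrite h !mul0r normr0.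
have [h|hs] := eqVneq (chi n s) 0; first by rewrite h mulr0 mul0r normr0.
have tn0 u : chi n u != 0 -> u != 0.
  move=> /chi_neq0 h; rewrite -normr_gt0; apply: lt_le_trans h.
  by rewrite invr_gt0.
have h := form_W_disp a0 hU e0 (tn0 _ ht) (tn0 _ hs) ts p1 p2 (nf t) (nf s).
rewrite normrM; apply: (le_trans (ler_piMl _ _)) => //.
  by rewrite normrM !(ger0_norm (chi_ge0 _ _)); apply: mulr_ile1; rewrite ?chi_ge0 ?chi_le1.
apply: (le_trans h); rewrite powRM ?powR_ge0//; last 2 first.
- by apply: Rintegral_ge0 => y _; apply: mulr_ge0; [exact: powR_ge0|exact: wt_ge0].
- by apply: Rintegral_ge0 => y _; apply: mulr_ge0; [exact: powR_ge0|exact: wt_ge0].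
by rewrite -mulrA [X in _ * X]mulrC /phi /beta.
Qed.

Lemma measurable_phi : measurable_fun setT phi.
Proof.
apply: mes_pow; apply: (@mes_Rint R _ _ (fun t y => `|f t y| `^ p * wt a y)).
by apply: mesM; [mes|apply: mes_wt; mes].
Qed.

Let D t s := phi t * phi s * `|t - s| `^ (- beta).

Lemma measurable_riesz : meas2 D.
Proof.
have m1 : measurable_fun setT (fun q : R * R => phi q.1) by apply: (mes_comp (k := phi)); [exact: measurable_phi|mes].
have m2 : measurable_fun setT (fun q : R * R => phi q.2) by apply: (mes_comp (k := phi)); [exact: measurable_phi|mes].
by apply: mesM; [exact: (mesM m1 m2)|apply: mes_pow; apply: mes_norm; mes].
Qed.

Lemma energy_le : \int[mu]_x (gw a eps x * (Rn true n x ^+ 2 + Rn false n x ^+ 2)) <=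
  Cen * N `^ (2 - beta).
Proof.
have mA := measurable_chi_form.
have mG : meas2 G by apply: mesD; exact: mA.
pose K1 := Kn n * \int[mu]_x gw a eps x.
have ichi (k : R) : intg (fun s => chi n s * k).
  have := intgZ k (chi_integrable n).
  by apply: eq_integrable => // s _ /=; rewrite mulrC.
have mAt i t : measurable_fun setT (fun s => chi n t * (chi n s * A i t s)).
  exact: (@meas2_1 _ (fun t s => chi n t * (chi n s * A i t s)) t (mA i)).
have iin i t : intg (fun s => chi n t * (chi n s * A i t s)).
  have h := intgZ (chi n t * Kn n) (ichi K1).
  exact: (intg_le (mAt i t) (chi_form_le i t) h).
have iout i : intg (fun t => \int[mu]_s (chi n t * (chi n s * A i t s))).
  apply: (intg_le (g := fun t => chi n t * (Kn n * \int[mu]_s (chi n s * K1)))).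
  - exact: mes_Rint (mA i).
  - move=> t; rewrite mulrA -RintZ; last exact: ichi.
    apply: Rint_norm_le; [exact: mAt|by apply: intgZ; exact: ichi|].
    by move=> s; exact: chi_form_le.
  - exact: ichi.
(* It is the sum of the real and imaginary energies that is a double integral of forms with kernel
   [Wker], hence the joint estimate. *)
have E : \int[mu]_x (gw a eps x * (Rn true n x ^+ 2 + Rn false n x ^+ 2)) =
    \int[mu]_t \int[mu]_s G t s.
  transitivity (\int[mu]_x (gw a eps x * Rn true n x ^+ 2) + \int[mu]_x (gw a eps x * Rn false n x ^+ 2)).
    rewrite -RintD; [|exact: Rn_integrable|exact: Rn_integrable].
    by apply: eq_Rintegral => x _; rewrite mulrDr.
  rewrite !Rn_energy -RintD; [|exact: iout|exact: iout].
  by apply: eq_Rintegral => t _; rewrite -RintD; [|exact: iin|exact: iin].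
have D0 t s : 0 <= D t s by rewrite /D !mulr_ge0 ?powR_ge0.
have C0 := Cdisp_ge0 a c0 p1 p2.
have hls_ : (\int[mu]_t \int[mu]_s (D t s)%:E <= _)%E := hls b0 b1 N0 measurable_phi phi_ge0 phiN.
have G_le' t s : `|G t s| <= Cdisp a c0 p * D t s + `|G t t| * (ind (t <= s) * ind (s <= t)) := chi_form_le_riesz t s.
have mD := measurable_riesz.
rewrite E -lee_fin; clearbody G D.
apply: (@le_trans _ _ (`|\int[mu]_t \int[mu]_s G t s|)%:E); first by rewrite lee_fin ler_norm.
apply: (le_trans (Rint_abs_le (mes_Rint mG))).
apply: (@le_trans _ _ (\int[mu]_t ((Cdisp a c0 p)%:E * \int[mu]_s (D t s)%:E))%E).
  apply: ge0_le_integral => //.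
  - by apply/measurable_EFinP; apply: mes_norm; exact: mes_Rint.
  - by apply: measurable_funeM; exact: mes_int_ge0.
  - move=> t _; have mGt := meas2_1 t mG; have mDt := meas2_1 t mD.
    apply: (le_trans (Rint_abs_le mGt)).
    rewrite -int_ge0Z//.
    apply: (@le_trans _ _ (\int[mu]_s (Cdisp a c0 p * D t s + `|G t t| * (ind (t <= s) * ind (s <= t)))%:E)%E).
      by apply: int_ge0_le => //; mes.
    have dg0 s : 0 <= ind (t <= s) * ind (s <= t) by rewrite mulr_ge0 ?ind_ge0.
    rewrite int_ge0D; [|by mes|by mes|by move=> s; exact: mulr_ge0|by move=> s; exact: mulr_ge0].
    by rewrite [X in (_ + X)%E]int_ge0Z ?int_diag ?mule0 ?adde0//; mes.
rewrite ge0_integralZl//; last 2 first.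
- exact: mes_int_ge0.
- by move=> t _; apply: integral_ge0 => s _; rewrite lee_fin.
apply: (le_trans (lee_wpmul2l _ hls_)); first by rewrite lee_fin.
by rewrite -EFinM lee_fin /Cen !mulrA.
Qed.

End Eps.
End Truncated.

(** * Removal of the Gaussian and of the time cut-off *)

Section Limit.
Context {R : realType}.
Implicit Types (x y z t s eps : R) (u v : R -> R).
Local Notation mu := (@lebesgue_measure R).
Local Notation intg f := (mu.-integrable setT (EFin \o f)).
Local Notation meas2 G := (measurable_fun setT (fun p : R * R => G p.1 p.2)).
Local Notation ind := (@ind R).

(* [fine] sends an infinite or undefined integral to [0]. *)
Lemma Rint_eq0_or_integrable u : measurable_fun setT u ->
  \int[mu]_t u t = 0 \/ intg u.
Proof.
move=> mu_; have mE : measurable_fun setT (EFin \o u) by exact/measurable_EFinP.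
have [h|h] := pselect (intg u); [by right|left].
have H : (\int[mu]_x `|(EFin \o u) x| = +oo)%E.
  apply/eqP; rewrite -leye_eq leNgt; apply/negP => hlt; apply: h.
  by apply/integrableP; split.
have E : (\int[mu]_x `|(EFin \o u) x| =
    \int[mu]_x ((EFin \o u)^\+ x) + \int[mu]_x ((EFin \o u)^\- x))%E.
  rewrite -ge0_integralD//; last 2 first.
  - exact: measurable_funepos.
  - exact: measurable_funeneg.
  apply: eq_integral => x _.
  by have := congr1 (@^~ x) (fune_abse (EFin \o u)).
rewrite /Rintegral integralE -/(EFin \o u).
have pos : (0 <= \int[mu]_x ((EFin \o u)^\+ x))%E by apply: integral_ge0 => x _.
have neg : (0 <= \int[mu]_x ((EFin \o u)^\- x))%E by apply: integral_ge0 => x _.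
move: E H pos neg; rewrite /comp.
case: (\int[mu]_x _)%E => [r| |] //.
all: case: (\int[mu]_x _)%E => [r'| |] //.
all: case: (\int[mu]_x _)%E => [r''| |] //.
Qed.

Lemma Rint_chi_cvg u : measurable_fun setT u -> (u 0 = 0) -> intg u ->
  \int[mu]_t (chi n t * u t) @[n --> \oo] --> \int[mu]_t u t.
Proof.
move=> mu_ u0 iu.
have iabs := intg_norm iu.
have b n t : `|chi n t * u t| <= `|u t|.
  by rewrite normrM (ger0_norm (chi_ge0 _ _)) ler_piMl ?chi_le1.
have mc n : measurable_fun setT (fun t => chi n t * u t) by apply: mesM => //; apply: mes_chi; mes.
have ic n : intg (fun t => chi n t * u t) by apply: (intg_le (mc n) (b n)).
have h : (\int[mu]_t (chi n t * u t)%:E)%E @[n --> \oo] --> (\int[mu]_t (u t)%:E)%E.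
  apply: (@dominated_cvg _ _ _ mu setT measurableT (fun n t => (chi n t * u t)%:E)
    (fun t => (u t)%:E) (fun t => `|u t|%:E)) => //.
  - by move=> n; apply/measurable_EFinP; exact: mc.
  - move=> t _; apply: cvg_EFin; first exact: nearW.
    (* Every cut-off vanishes at t = 0, in agreement with u 0 = 0. *)
    have [->|t0] := eqVneq t 0; first by rewrite u0; under eq_fun do rewrite mulr0; exact: cvg_cst.
    apply: cvg_near_cst.
    have h0 : 0 < `|t| by rewrite normr_gt0.
    near=> n.
    have h1 : n.+1%:R^-1 <= `|t|.
      rewrite invf_ple ?posrE//; apply: (@le_trans _ _ n%:R); last by rewrite ler_nat.
      near: n; exact: nbhs_infty_ger.
    have h2 : `|t| <= n.+1%:R.
      apply: (@le_trans _ _ n%:R); last by rewrite ler_nat.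
      near: n; exact: nbhs_infty_ger.
    by rewrite /= /chi h1 h2 /ind !mul1r.
  - by move=> n t _; rewrite lee_fin.
rewrite -(RintE iu) in h.
have : (\int[mu]_t (chi n t * u t))%:E @[n --> \oo] --> (\int[mu]_t u t)%:E.
  by under eq_fun do rewrite (RintE (ic _)).
by move/fine_cvg.
Unshelve. all: by end_near.
Qed.

(** At t = 0 the operator is the identity and not an integral against the kernel; a single time does
    not affect the integral. *)
Lemma Rint_eq_off0 u v : measurable_fun setT v -> (forall t, t != 0 -> u t = v t) ->
  \int[mu]_t u t = \int[mu]_t v t.
Proof.
move=> mv uv; rewrite /Rintegral; congr fine.
have m0 : measurable ([set: R] `\ 0) by exact: measurableD.
have mv' : measurable_fun ([set: R] `\ 0) (fun t => (v t)%:E).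
  by apply: measurable_funTS; exact/measurable_EFinP.
have E : {in [set: R] `\ 0, (fun t => (u t)%:E) =1 (fun t => (v t)%:E)}.
  by move=> t /set_mem [_ /eqP t0]; rewrite uv.
rewrite -(integral_setD1 m0); last by apply: eq_measurable_fun mv' => t ht; rewrite E.
by rewrite -(integral_setD1 m0 mv'); apply: eq_integral.
Qed.

Variables (a c0 : R) (U P Q : R -> R).
Hypotheses (a0 : 0 <= a) (hU : bessel_like a c0 U P Q).
Variables (f h : R -> R -> R) (B p N c : R).
Hypotheses (mf : meas2 f) (nf : forall t, nice (wt a) (f t))
  (fB : forall t, \int[mu]_y (`|f t y| * wt a y) <= B).
Hypotheses (mh : meas2 h) (nh : forall t, nice (wt a) (h t))
  (hB : forall t, \int[mu]_y (`|h t y| * wt a y) <= B).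
Hypotheses (p1 : 1 < p) (p2 : p < 2) (c1 : c ^+ 2 = 1).

Let mU := bl_measurable hU.
Local Notation L := (Lf a U).

Let beta := (a + 1) / 2 * (2 / p - 1).
Let phi (g : R -> R -> R) t := (\int[mu]_y (`|g t y| `^ p * wt a y)) `^ p^-1.
Hypotheses (b0 : 0 < beta) (b1 : beta < 1) (N0 : 0 <= N)
  (phifN : (\int[mu]_t (phi f t `^ (2 / (2 - beta)))%:E <= N%:E)%E)
  (phihN : (\int[mu]_t (phi h t `^ (2 / (2 - beta)))%:E <= N%:E)%E).

(** With f, h the real and imaginary parts of F and c = -1 this is the real part of S_a(-t) F; with
    f, h exchanged and c = 1 it is the imaginary part. The indicator sets the value 0 at t = 0. *)
Definition ufh t x : R := ind (0 < `|t|) * (L true t (f t) x + c * L false t (h t) x).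
Definition Tfh x : R := \int[mu]_t ufh t x.

Lemma measurable_ufh {d} {T : measurableType d} (k v : T -> R) :
  measurable_fun setT k -> measurable_fun setT v ->
  measurable_fun setT (fun q => ufh (k q) (v q)).
Proof.
move=> mk mv; apply: mesM; first by mes.
by apply: mesD; [exact: (measurable_Lft hU mf)|apply: mesM; [mes|exact: (measurable_Lft hU mh)]].
Qed.

Lemma measurable_Tfh : measurable_fun setT Tfh.
Proof. by apply: (@mes_Rint R _ _ (fun x t => ufh t x)); apply: measurable_ufh; mes. Qed.

Lemma chi_ufh n x : \int[mu]_t (chi n t * ufh t x) = Rn a U f true n x + c * Rn a U h false n x.
Proof.
have ichi (K : R) : intg (fun t => chi n t * K).
  have := intgZ K (chi_integrable n).
  by apply: eq_integrable => // t _ /=; rewrite mulrC.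
have i1 : intg (fun t => chi n t * L true t (f t) x).
  apply: (intg_le _ (chi_L_le a0 hU nf fB true n ^~ x) (ichi _)).
  by apply: mesM; [apply: mes_chi; mes|apply: (measurable_Lft hU mf); mes].
have i2 : intg (fun t => chi n t * L false t (h t) x).
  apply: (intg_le _ (chi_L_le a0 hU nh hB false n ^~ x) (ichi _)).
  by apply: mesM; [apply: mes_chi; mes|apply: (measurable_Lft hU mh); mes].
rewrite /Rn -(RintZ _ i2) -RintD//; last exact: intgZ.
apply: eq_Rintegral => t _; rewrite /ufh.
have [h0|h0] := eqVneq (chi n t) 0; first by rewrite h0 !mul0r mulr0 addr0.
have -> : 0 < `|t| by apply: lt_le_trans (chi_neq0 h0); rewrite invr_gt0.
by rewrite /ind mul1r; ring.
Qed.

Lemma Tn_energy n eps : 0 < eps ->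
  (\int[mu]_x (gw a eps x * (\int[mu]_t (chi n t * ufh t x)) ^+ 2)%:E <=
    (4 * (Cen a c0 p * N `^ (2 - beta)))%:E)%E.
Proof.
move=> e0.
have hf := energy_le a0 hU mf nf fB p1 p2 b0 b1 N0 phifN n e0.
have hh := energy_le a0 hU mh nh hB p1 p2 b0 b1 N0 phihN n e0.
have If i := Rn_integrable a0 hU mf nf fB n e0 i.
have Ih i := Rn_integrable a0 hU mh nh hB n e0 i.
have IF : intg (fun x => gw a eps x * (Rn a U f true n x ^+ 2 + Rn a U f false n x ^+ 2)).
  by have := intgD (If true) (If false); apply: eq_integrable => // x _ /=; rewrite mulrDr.
have IH : intg (fun x => gw a eps x * (Rn a U h true n x ^+ 2 + Rn a U h false n x ^+ 2)).
  by have := intgD (Ih true) (Ih false); apply: eq_integrable => // x _ /=; rewrite mulrDr.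
(* [energy_le] controls real and imaginary energies only together, so the full energies of f and of
   h are both used. The factor 4 is 2 from (r1 + c r2)^2 <= 2 (r1^2 + r2^2) times these two
   energies. *)
have I2 := intgZ 2 (intgD IF IH).
apply: (@le_trans _ _ (\int[mu]_x (2 * (gw a eps x * (Rn a U f true n x ^+ 2 + Rn a U f false n x ^+ 2) +
    gw a eps x * (Rn a U h true n x ^+ 2 + Rn a U h false n x ^+ 2)))%:E)%E).
  apply: int_ge0_le.
  - apply: mesM; first by apply: mes_gw; mes.
    apply: mesX; apply: (@mes_Rint R _ _ (fun x t => chi n t * ufh t x)).
    by apply: mesM; [apply: mes_chi; mes|apply: measurable_ufh; mes].
  - exact: (intg_meas I2).
  - by move=> x; rewrite mulr_ge0 ?gw_ge0 ?sqr_ge0.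
  - move=> x; rewrite chi_ufh -mulrDr [leRHS]mulrCA ler_wpM2l ?gw_ge0//.
    move: (Rn a U f true n x) (Rn a U h false n x) (Rn a U f false n x) (Rn a U h true n x) => r1 r2 r3 r4.
    have -> : (r1 + c * r2) ^+ 2 = r1 ^+ 2 + c ^+ 2 * r2 ^+ 2 + 2 * (r1 * (c * r2)) by ring.
    have h1 : 2 * (r1 * (c * r2)) <= r1 ^+ 2 + c ^+ 2 * r2 ^+ 2.
      have := sqr_ge0 (r1 - c * r2).
      have -> : (r1 - c * r2) ^+ 2 = r1 ^+ 2 + c ^+ 2 * r2 ^+ 2 - 2 * (r1 * (c * r2)) by ring.
      by rewrite subr_ge0.
    rewrite c1 mul1r in h1 *.
    apply: (@le_trans _ _ (2 * (r1 ^+ 2 + r2 ^+ 2))).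
      by rewrite [leRHS]mulr_natl [leRHS]mulr2n lerD2l.
    by rewrite ler_wpM2l// addrA lerD2r -addrA lerDl addr_ge0 ?sqr_ge0.
rewrite -(RintE I2) lee_fin (RintZ _ (intgD IF IH)) (RintD IF IH).
apply: (le_trans (ler_wpM2l _ (lerD hf hh))) => //.
rewrite le_eqVlt; apply/orP; left; apply/eqP; rewrite -/beta.
by move: (Cen _ _ _ * _) => E; ring.
Qed.

(** The Gaussian parameter 1/(n+1) and the time cut-off go to the limit together. At each x the time
    integral either converges absolutely and is the limit of its truncations, or is 0 by default. *)
Lemma Tfh_energy :
  (\int[mu]_x (wt a x * Tfh x ^+ 2)%:E <= (4 * (Cen a c0 p * N `^ (2 - beta)))%:E)%E.
Proof.
apply: (@fatou_le _ (fun n x => gw a n.+1%:R^-1 x * (\int[mu]_t (chi n t * ufh t x)) ^+ 2)).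
- move=> n; apply: mesM; first by apply: mes_gw; mes.
  apply: mesX; apply: (@mes_Rint R _ _ (fun x t => chi n t * ufh t x)).
  by apply: mesM; [apply: mes_chi; mes|apply: measurable_ufh; mes].
- by move=> n x; rewrite mulr_ge0 ?gw_ge0 ?sqr_ge0.
- by apply: mesM; [apply: mes_wt; mes|apply: mesX; exact: measurable_Tfh].
- by move=> x; rewrite mulr_ge0 ?wt_ge0 ?sqr_ge0.
- move=> x.
  have mu_ : measurable_fun setT (fun t => ufh t x) by apply: measurable_ufh; mes.
  have [T0|iu] := Rint_eq0_or_integrable mu_.
    by left; rewrite /Tfh T0 expr0n/= mulr0.
  right; have u0 : ufh 0 x = 0 by rewrite /ufh normr0 ltxx /ind mul0r.
  have hc := Rint_chi_cvg mu_ u0 iu.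
  apply: cvgM; last by rewrite expr2; under eq_fun do rewrite expr2; exact: cvgM.
  by rewrite -[X in _ --> X]mul1r; apply: cvgM; [exact: cvg_gauss_1|exact: cvg_cst].
- by move=> n; apply: Tn_energy; rewrite invr_gt0.
Qed.

End Limit.

(** * Functions of the class [S^+] *)

Section Caratheodory.
Context {R : realType}.
Implicit Types (x y z t s : R).
Local Notation mu := (@lebesgue_measure R).
Local Notation intg f := (mu.-integrable setT (EFin \o f)).
Local Notation meas2 G := (measurable_fun setT (fun p : R * R => G p.1 p.2)).
Local Notation ind := (@ind R).

Lemma measurable_caratheodory (g : R -> R -> R) :
  (forall t, measurable_fun setT (g ^~ t)) -> (forall x t, {for t, continuous (g x)}) ->
  meas2 g.
Proof.
move=> mg cg.
(* [G n] interpolates [g] by piecewise constants in [t] on a grid of mesh [1/N] in [[-N, N[] *)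
pose N (n : nat) : R := n.+1%:R.
pose G n (q : R * R) := \sum_(k < n.+1 * (2 * n.+1))
  (ind (k%:R <= N n * (q.2 + N n)) * ind (N n * (q.2 + N n) < k.+1%:R)
    * g q.1 (k%:R / N n - N n)).
apply: (@measurable_fun_cvg _ _ _ setT G).
  move=> n; apply: measurable_sum => k; apply: mesM; first by mes.
  by apply: (mes_comp (k := g ^~ (k%:R / N n - N n))) => //; mes.
move=> [x t] _ /=.
(* The left end of the grid cell containing t; once n >= |t| this cell is among those summed in
   [G n] and is the only one to contribute. *)
pose tau n : R := (Num.truncn (N n * (t + N n)))%:R / N n - N n.
have N0 n : 0 < N n by rewrite /N.
have big : \forall n \near \oo, `|t| <= n%:R by exact: nbhs_infty_ger.
have tr : \forall n \near \oo, 0 <= N n * (t + N n) /\ N n * (t + N n) < N n * (2 * N n).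
  near=> n; have h : `|t| <= n%:R by near: n.
  have h' : n%:R < N n by rewrite /N ltr_nat.
  move: h; rewrite ler_norml => /andP[h1 h2].
  split; first by rewrite mulr_ge0 ?ltW//; lra.
  by rewrite ltr_pM2l//; lra.
have taut : tau n @[n --> \oo] --> t.
  apply: (@squeeze_cvgr _ _ _ _ (fun n => t - (N n)^-1) (fun _ => t)).
  - near=> n; have [h _] : 0 <= N n * (t + N n) /\ N n * (t + N n) < N n * (2 * N n) by near: n.
    have /andP[h1 h2] := truncn_itv h.
    rewrite /tau; apply/andP; split.
      rewrite -(ler_pM2r (N0 n)) !mulrBl divfK ?gt_eqF// mulVf ?gt_eqF//.
      move: h2; rewrite -natr1 mulrDr; lra.
    by rewrite lerBlDr ler_pdivrMr// [leRHS]mulrC.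
  - rewrite -[X in _ --> X]subr0; apply: cvgB; first exact: cvg_cst.
    exact: cvg_harmonic.
  - exact: cvg_cst.
have E : \forall n \near \oo, g x (tau n) = G n (x, t).
  near=> n; have [h h'] : 0 <= N n * (t + N n) /\ N n * (t + N n) < N n * (2 * N n) by near: n.
  have /andP[h1 h2] := truncn_itv h.
  have kn : (Num.truncn (N n * (t + N n)) < n.+1 * (2 * n.+1))%N.
    rewrite -(ltr_nat R); apply: le_lt_trans h1 _.
    by rewrite !natrM.
  rewrite /G (bigD1 (Ordinal kn))//= h1 h2 /ind !mul1r big1 ?addr0// => k kk.
  case: ifP => h3; last by rewrite !mul0r.
  case: ifP => h4; last by rewrite mulr0 mul0r.
  exfalso; move/eqP: kk; apply; apply/val_inj => /=.
  apply/eqP; rewrite eqn_leq; apply/andP; split.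
    by rewrite -ltnS -(ltr_nat R); exact: le_lt_trans h3 h2.
  by rewrite -ltnS -(ltr_nat R); exact: le_lt_trans h1 h4.
apply: cvg_trans (near_eq_cvg E) _.
have h : g x (tau n) @[n --> \oo] --> g x t by apply: continuous_cvg; [exact: cg|exact: taut].
exact: h.
Unshelve. all: by end_near.
Qed.

End Caratheodory.

(** * Decay, continuity and measurability of the real components of F *)

Section Components.
Context {R : realType}.
Implicit Types (x y z t s a : R).
Local Notation mu := (@lebesgue_measure R).
Local Notation intg f := (mu.-integrable setT (EFin \o f)).
Local Notation meas2 G := (measurable_fun setT (fun p : R * R => G p.1 p.2)).
Local Notation ind := (@ind R).

Lemma cabs_ge (z : cplx R) : `|z.1| <= cabs z /\ `|z.2| <= cabs z.
Proof.
rewrite /cabs -!sqrtr_sqr; split; rewrite ler_wsqrtr//.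
- by rewrite lerDl sqr_ge0.
- by rewrite lerDr sqr_ge0.
Qed.

Lemma cabs_ge0 (z : cplx R) : 0 <= cabs z.
Proof. exact: sqrtr_ge0. Qed.

(** Since y^a <= (1 + y^2)^(a/2), an order m >= a + 2 leaves at most (1 + y^2)^(-1), integrable on
    the half-line. *)
Lemma integrable_wt_decay a (m : nat) : 0 <= a -> a + 2 <= m%:R ->
  intg (fun y => (1 + y ^+ 2) `^ (- (m%:R / 2)) * wt a y).
Proof.
move=> a0 am.
have one (y : R) : 1 <= 1 + y ^+ 2 by rewrite lerDl sqr_ge0.
have pos (y : R) : 0 < 1 + y ^+ 2 by rewrite (lt_le_trans ltr01 (one y)).
have mq : measurable_fun setT (fun y : R => (1 + y ^+ 2)^-1) by mes.
apply: (intg_le (g := fun y => ind (0 <= y) * (1 + y ^+ 2)^-1)).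
- by apply: mesM; [mes|apply: mes_wt; mes].
- move=> y; rewrite normrM (ger0_norm (powR_ge0 _ _)) (ger0_norm (wt_ge0 _ _)) /wt /ind.
  case: ltP => y0; last by rewrite mul0r mulr0 mulr_ge0 ?invr_ge0 ?(ltW (pos y))//; case: ifP.
  rewrite (ltW y0) !mul1r.
  have h : y `^ a <= (1 + y ^+ 2) `^ (a / 2).
    have -> : y `^ a = (y ^+ 2) `^ (a / 2).
      by rewrite expr2 powRM ?(ltW y0)// -powRDp//; congr (_ `^ _); field.
    by apply: ler_powRl; rewrite ?divr_ge0 ?sqr_ge0// lerDr.
  apply: (le_trans (ler_wpM2l (powR_ge0 _ _) h)); rewrite -powRDp//.
  rewrite -(powR_inv1 (ltW (pos y))); apply: ler_powR => //; lra.
- apply: intg_ge0.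
  + by mes.
  + by move=> y; rewrite mulr_ge0 ?invr_ge0 ?(ltW (pos y))//; rewrite /ind; case: ifP.
  + have -> : (\int[mu]_y (ind (0 <= y) * (1 + y ^+ 2)^-1)%:E =
      \int[mu]_(y in `[0%R, +oo[) ((oneDsqr y)^-1)%:E)%E.
      rewrite [RHS]integral_mkcond; apply: eq_integral => y _.
      rewrite patchE mem_setE in_itv/= andbT /ind.
      by case: (0 <= y); rewrite ?mul1r ?mul0r.
    by rewrite integral0y_oneDsqr ltry.
Qed.

Variables (F : R -> R -> cplx R) (hF : inSplus F).

(** Time comes first here, unlike in [F]. The class constrains F only for y > 0, hence the extension
    by 0. *)
Definition component (j : bool) t y : R := ind (0 < y) * (if j then (F y t).1 else (F y t).2).

Lemma comp_le (m : nat) : exists2 M : R, 0 <= M & forall j t y,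
  `|component j t y| <= M * (1 + y ^+ 2) `^ (- (m%:R / 2)).
Proof.
have [_ /(_ m)[M HM]] := hF.
exists `|M| => // j t y; rewrite /component normrM norm_ind /ind.
case: ltP => y0; last by rewrite mul0r mulr_ge0 ?powR_ge0.
rewrite mul1r; apply: (@le_trans _ _ (cabs (F y t))).
  by case: j; [exact: (cabs_ge _).1|exact: (cabs_ge _).2].
have := HM 0%N 0%N (leq0n _) y t y0; rewrite /= => h.
have pos : 0 < 1 + y ^+ 2 :> R by rewrite ltr_pwDl// sqr_ge0.
have pos' : 0 < 1 + y ^+ 2 + t ^+ 2 :> R by rewrite ltr_pwDl// sqr_ge0.
apply: (@le_trans _ _ (`|M| / (1 + y ^+ 2 + t ^+ 2) `^ (m%:R / 2))).
  by rewrite ler_pdivlMr ?powR_gt0// mulrC; apply: (le_trans h); exact: ler_norm.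
rewrite powRN ler_wpM2l// lef_pV2 ?posrE ?powR_gt0//.
by apply: ler_powRl; rewrite ?divr_ge0 ?(ltW pos)// lerDl sqr_ge0.
Qed.

Lemma Splus_continuous j x t : 0 < x ->
  {for x, continuous (fun y => if j then (F y t).1 else (F y t).2)} /\
  {for t, continuous (fun s => if j then (F x s).1 else (F x s).2)}.
Proof.
(* The empty word of derivatives: joint continuity of F itself. *)
move=> x0; have [/(_ [::] x t x0)[_ [_ cF]] _] := hF.
have cF' : (fun p : R * R => F p.1 p.2) q @[q --> (x, t)] --> F x t by exact: cF.
have pc (G : R * R -> cplx R) : G q @[q --> (x, t)] --> F x t ->
   (if j then (G q).1 else (G q).2) @[q --> (x, t)] --> (if j then (F x t).1 else (F x t).2).
  by move=> cG; case: j; [apply: (cvg_comp _ _ cG); exact: cvg_fst|apply: (cvg_comp _ _ cG); exact: cvg_snd].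
have H := pc _ cF'.
split.
- have h : (fun y => (y, t)) @ x --> (x, t).
    exact: (@cvg_pair _ _ _ (nbhs x) (nbhs x) (nbhs t) _ _ _ id (fun=> t) cvg_id (cvg_cst t)).
  exact: (cvg_comp _ _ h H).
- have h : (fun s => (x, s)) @ t --> (x, t).
    exact: (@cvg_pair _ _ _ (nbhs t) (nbhs x) (nbhs t) _ _ _ (fun=> x) id (cvg_cst x) cvg_id).
  exact: (cvg_comp _ _ h H).
Qed.

Lemma measurable_comp1 j t : measurable_fun setT (component j t).
Proof.
rewrite (_ : component j t = (fun y => if j then (F y t).1 else (F y t).2) \_ (`]0%R, +oo[%classic : set R)).
  apply/(measurable_restrictT _ _).1; first exact: measurable_Dp.
  by apply: measurable_fun_pos => x x0; have [] := Splus_continuous j t x0.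
by apply/funext => y; rewrite patch_Dp.
Qed.

Lemma meas2_comp j : meas2 (component j).
Proof.
have h := @measurable_caratheodory R (fun y t => component j t y).
apply: (mes_comp2 (k := fun y t => component j t y) (h _ _)); mes.
- by move=> t; exact: measurable_comp1.
- move=> x t; have [x0|x0] := ltP 0 x; last first.
    rewrite (_ : (component j)^~ x = fun=> 0); first exact: cvg_cst.
    by apply/funext => s; rewrite /component /ind ltNge x0/= mul0r.
  have [_ c] := Splus_continuous j t x0.
  by rewrite /component /ind x0/=; apply: continuousM1 => //; exact: cvg_cst.
Qed.

Lemma nice_comp a : 0 <= a -> exists B : R, forall j t,
  nice (wt a) (component j t) /\ \int[mu]_y (`|component j t y| * wt a y) <= B.
Proof.
move=> a0.
have [m am] : exists m : nat, a + 2 <= m%:R.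
  by exists (Num.truncn (a + 2)).+1; rewrite ltW// truncnS_gt.
have [M M0 HM] := comp_le m.
have iw := integrable_wt_decay a0 am.
exists (M * \int[mu]_y ((1 + y ^+ 2) `^ (- (m%:R / 2)) * wt a y)) => j t.
have b y : `|component j t y| * wt a y <= M * ((1 + y ^+ 2) `^ (- (m%:R / 2)) * wt a y).
  by rewrite mulrA ler_wpM2r ?wt_ge0.
have mcw : measurable_fun setT (fun y => `|component j t y| * wt a y).
  by apply: mesM; [apply: mes_norm; exact: measurable_comp1|apply: mes_wt; mes].
have nb y : `|(`|component j t y| * wt a y)| <= M * ((1 + y ^+ 2) `^ (- (m%:R / 2)) * wt a y).
  by rewrite ger0_norm//; apply: mulr_ge0 => //; exact: wt_ge0.
have ii := intg_le mcw nb (intgZ M iw).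
split; first split.
- exact: measurable_comp1.
- exists M => y; apply: (le_trans (HM j t y)); rewrite ler_piMr//.
  rewrite powRN invf_le1 ?powR_gt0 ?ltr_pwDl ?sqr_ge0//.
  have := @ler_powRl R (m%:R / 2) 1 (1 + y ^+ 2); rewrite powR1; apply => //.
  by rewrite lerDl sqr_ge0.
- exact: ii.
- by rewrite -RintZ//; apply: Rint_le => //; exact: intgZ.
Qed.

End Components.

(** * Identification of T_a(F) with the real operators, comparison of norms, conclusion *)

Section Final.
Context {R : realType}.
Implicit Types (x y z t s a : R).
Local Notation mu := (@lebesgue_measure R).
Local Notation intg f := (mu.-integrable setT (EFin \o f)).
Local Notation meas2 G := (measurable_fun setT (fun p : R * R => G p.1 p.2)).
Local Notation ind := (@ind R).

Lemma Sker_Kb a x y t : 0 <= a -> 0 < x -> 0 < y -> t != 0 ->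
  Sker a x y (- t) = (Kb a (besU a) true x y t, Kb a (besU a) false x y t).
Proof.
move=> a0 x0 y0 t0; rewrite /Sker normrN.
have t1 : 0 < 2 * `|t| by rewrite mulr_gt0// normr_gt0.
have w0 : 0 < x * y / (2 * `|t|) by rewrite divr_gt0// mulr_gt0.
rewrite -mulrA (besselJ_besU a0 w0) /Kb /Kc /Ks /kap oppr_gt0.
case: ltgtP t0 => // h _; rewrite /Defs.cscale /cmul /cexpi /=.
- rewrite [X in (_, _ * X)]addrC -sinD -cosD ltr0_norm//.
  have -> : - ((a + 1) * pi / 4) + (x ^+ 2 + y ^+ 2) / (4 * - t) = phase a x y t.
    by rewrite /phase ltr0_sg// mulrN invrN; ring.
  by [].
- rewrite [X in (_, _ * X)]addrC -sinD -cosD gtr0_norm//.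
  have -> : (a + 1) * pi / 4 + - ((x ^+ 2 + y ^+ 2) / (4 * t)) = phase a x y t.
    by rewrite /phase gtr0_sg//; ring.
  by [].
Qed.

Lemma Lnorm2_le a (K : R) (G : R -> cplx R) (T1 T2 : R -> R) : 0 <= K ->
  measurable_fun setT T1 -> measurable_fun setT T2 ->
  (forall x, 0 < x -> (G x).1 = T1 x /\ (G x).2 = T2 x) ->
  (\int[mu]_x (wt a x * T1 x ^+ 2)%:E <= K%:E)%E ->
  (\int[mu]_x (wt a x * T2 x ^+ 2)%:E <= K%:E)%E ->
  (Lnorm_a a 2 G <= ((2 * K) `^ 2^-1)%:E)%E.
Proof.
move=> K0 m1 m2 GT h1 h2; rewrite /Lnorm_a -poweR_EFin.
have mw : measurable_fun setT (wt a) by apply: mes_wt; mes.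
have E : (\int[mu]_(x in `]0%R, +oo[) ((cabs (G x)) `^ 2 * x `^ a)%:E =
  \int[mu]_x (wt a x * T1 x ^+ 2 + wt a x * T2 x ^+ 2)%:E)%E.
  rewrite int_Dp; apply: eq_integral => x _; congr EFin.
  rewrite /wt /ind; case: ltP => x0; last by rewrite !mul0r addr0.
  have [E1 E2] := GT _ x0.
  rewrite (powR_mulrn 2 (cabs_ge0 _)) /cabs sqr_sqrtr ?addr_ge0 ?sqr_ge0// E1 E2; ring.
apply: gt0_ler_poweR; rewrite ?invr_ge0//.
- rewrite in_itv/= leey andbT; apply: integral_ge0 => x _.
  by rewrite lee_fin mulr_ge0 ?powR_ge0.
- by rewrite in_itv/= leey andbT lee_fin mulr_ge0.
rewrite E int_ge0D.
- by apply: (le_trans (leeD h1 h2)); rewrite -EFinD lee_fin mulr_natl mulr2n.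
- by mes.
- by mes.
- by move=> x; apply: mulr_ge0; [exact: wt_ge0|exact: sqr_ge0].
- by move=> x; apply: mulr_ge0; [exact: wt_ge0|exact: sqr_ge0].
Qed.

Section F.
Variables (a : R) (F : R -> R -> cplx R).
Hypotheses (a0 : 0 <= a) (hF : inSplus F).

Let hU := bessel_like_bes a0.
Local Notation L := (Lf a (besU a)).
Local Notation f1 := (component F true).
Local Notation f2 := (component F false).

Lemma Sop_Lf x t : 0 < x -> t != 0 ->
  (Sop a (- t) (fun y => F y t) x).1 = L true t (f1 t) x + -1 * L false t (f2 t) x /\
  (Sop a (- t) (fun y => F y t) x).2 = L true t (f2 t) x + 1 * L false t (f1 t) x.
Proof.
move=> x0 t0; have [B hB] := nice_comp hF a0.
have n j : nice (wt a) (component F j t) by exact: (hB j t).1.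
rewrite /Sop oppr_eq0 (negbTE t0) /cint /=; split.
- rewrite -(RintZ (-1)); last exact: (Lf_integrable hU).
  rewrite -RintD; [|exact: (Lf_integrable hU)|by apply: intgZ; exact: (Lf_integrable hU)].
  rewrite Rint_Dp; apply: eq_Rintegral => y _.
  rewrite /component /wt {1}/ind; case: ltP => y0; last by rewrite /ind !mul0r !mulr0 addr0.
  by rewrite (Sker_Kb a0 x0 y0 t0)/= /ind !mul1r; ring.
- rewrite -(RintZ 1); last exact: (Lf_integrable hU).
  rewrite -RintD; [|exact: (Lf_integrable hU)|by apply: intgZ; exact: (Lf_integrable hU)].
  rewrite Rint_Dp; apply: eq_Rintegral => y _.
  rewrite /component /wt {1}/ind; case: ltP => y0; last by rewrite /ind !mul0r !mulr0 addr0.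
  by rewrite (Sker_Kb a0 x0 y0 t0)/= /ind !mul1r; ring.
Qed.

Lemma Top_Tfh x : 0 < x ->
  (Top a F x).1 = Tfh a (besU a) f1 f2 (-1) x /\
  (Top a F x).2 = Tfh a (besU a) f2 f1 1 x.
Proof.
move=> x0; rewrite /Top /cint /= /Tfh; split; apply: Rint_eq_off0.
- by apply: (measurable_ufh hU (-1) (meas2_comp hF true) (meas2_comp hF false)); mes.
- by move=> t t0; rewrite (Sop_Lf x0 t0).1 /ufh normr_gt0 t0 /ind mul1r.
- by apply: (measurable_ufh hU 1 (meas2_comp hF false) (meas2_comp hF true)); mes.
- by move=> t t0; rewrite (Sop_Lf x0 t0).2 /ufh normr_gt0 t0 /ind [RHS]mul1r.
Qed.

Lemma Lnorm2_Top (K : R) : 0 <= K ->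
  (\int[mu]_x (wt a x * Tfh a (besU a) f1 f2 (-1) x ^+ 2)%:E <= K%:E)%E ->
  (\int[mu]_x (wt a x * Tfh a (besU a) f2 f1 1 x ^+ 2)%:E <= K%:E)%E ->
  (Lnorm_a a 2 (Top a F) <= ((2 * K) `^ 2^-1)%:E)%E.
Proof.
move=> K0; apply: Lnorm2_le => //.
- exact: (measurable_Tfh hU (-1) (meas2_comp hF true) (meas2_comp hF false)).
- exact: (measurable_Tfh hU 1 (meas2_comp hF false) (meas2_comp hF true)).
- exact: Top_Tfh.
Qed.

Lemma phi_comp_le (p q' : R) j : 1 < p -> 0 < q' ->
  (\int[mu]_t (((\int[mu]_y (`|component F j t y| `^ p * wt a y)) `^ p^-1) `^ q')%:E <=
   \int[mu]_t poweR (Lnorm_a a p (fun y => F y t)) q')%E.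
Proof.
move=> p1 q0; have p0 : 0 < p by exact: lt_trans p1.
have [B hB] := nice_comp hF a0.
have mw : measurable_fun setT (wt a) by apply: mes_wt; mes.
have mc i : meas2 (component F i) by exact: meas2_comp.
(* This is |F|^p y^a written through the components, which are jointly measurable on the plane; it
   gives the measurability in t of the spatial norm of F. *)
pose H t y := (component F true t y ^+ 2 + component F false t y ^+ 2) `^ (p / 2) * wt a y.
have mH : meas2 H.
  apply: mesM; last by apply: mes_wt; mes.
  by apply: mes_pow; apply: mesD; apply: mesX; exact: mc.
have H0 t y : 0 <= H t y by apply: mulr_ge0; [exact: powR_ge0|exact: wt_ge0].
have HE t : (\int[mu]_(y in `]0%R, +oo[) ((cabs (F y t)) `^ p * y `^ a)%:E = \int[mu]_y (H t y)%:E)%E.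
  rewrite int_Dp; apply: eq_integral => y _; congr EFin; rewrite /H /component /wt /ind.
  case: ltP => y0; last by rewrite !mul0r mulr0.
  rewrite !mul1r /cabs; congr (_ * _).
  rewrite -[X in X `^ (p / 2)]sqr_sqrtr ?addr_ge0 ?sqr_ge0//.
  rewrite expr2 powRM ?sqrtr_ge0//; set S := Num.sqrt _.
  have := sqrtr_ge0 ((F y t).1 ^+ 2 + (F y t).2 ^+ 2); rewrite -/S le_eqVlt => /predU1P[<-|S0].
    by rewrite !powR0 ?mul0r// ?gt_eqF// divr_gt0.
  by rewrite -powRDp//; congr (_ `^ _); field.
have IH0 t : (0 <= \int[mu]_y (H t y)%:E)%E by apply: integral_ge0 => y _; rewrite lee_fin.
have nn (e : \bar R) : (0 <= e)%E -> (e \in `[0, +oo%E]).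
  by move=> e0; rewrite in_itv/= leey andbT.
apply: ge0_le_integral => //.
- by move=> t _; rewrite lee_fin powR_ge0.
- apply/measurable_EFinP; apply: mes_pow; apply: mes_pow.
  apply: (@mes_Rint R _ _ (fun t y => `|component F j t y| `^ p * wt a y)).
  by apply: mesM; [apply: mes_pow; apply: mes_norm; exact: mc|apply: mes_wt; mes].
- rewrite /Lnorm_a; under eq_fun do rewrite HE.
  apply: (measurableT_comp (measurable_poweR q')).
  by apply: (measurableT_comp (measurable_poweR p^-1)); exact: mes_int_ge0.
- move=> t _; rewrite -!poweR_EFin /Lnorm_a HE.
  have n := (hB j t).1.
  have iE : intg (fun y => `|component F j t y| `^ p * wt a y).
    by apply: nice_pow => //; exact: wt_ge0.
  have I0 : (0 <= (\int[mu]_y (`|component F j t y| `^ p * wt a y))%:E)%E.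
    rewrite lee_fin; apply: Rintegral_ge0 => y _.
    by apply: mulr_ge0; [exact: powR_ge0|exact: wt_ge0].
  apply: gt0_ler_poweR; rewrite ?(ltW q0)//; try by apply: nn; exact: poweR_ge0.
  apply: gt0_ler_poweR; rewrite ?invr_ge0 ?(ltW p0)//; try by apply: nn.
  rewrite (RintE iE); apply: int_ge0_le.
  + exact: (intg_meas iE).
  + exact: (meas2_1 t mH).
  + by move=> y; apply: mulr_ge0; [exact: powR_ge0|exact: wt_ge0].
  + move=> y; rewrite /H ler_wpM2r ?wt_ge0//.
    have -> : `|component F j t y| `^ p = (component F j t y ^+ 2) `^ (p / 2).
      rewrite -(real_normK (num_real _)) expr2 powRM//.
      have := normr_ge0 (component F j t y); rewrite le_eqVlt => /predU1P[<-|c0].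
        by rewrite !powR0 ?mul0r// ?gt_eqF// divr_gt0.
      by rewrite -powRDp//; congr (_ `^ _); field.
    apply: ler_powRl; rewrite ?divr_ge0 ?(ltW p0) ?sqr_ge0//.
    by case: (j); rewrite ?lerDl ?lerDr sqr_ge0.
Qed.

End F.
End Final.

Theorem theoremT (R : realType) (a q r : R) :
  0 <= a -> admissible a q r ->
  exists C : R, 0 < C /\
    forall F : R -> R -> cplx R, inSplus F ->
      (Lnorm_a a 2 (Top a F) <= C%:E * mixnorm a (conjexp q) (conjexp r) F)%E.
Proof.
move=> a0 [r2 [ra qr]].
pose beta := (a + 1) * (2^-1 - r^-1).
have r0 : 0 < r by lra.
have b0 : 0 < beta.
  rewrite /beta mulr_gt0//; first by lra.
  by rewrite subr_gt0 ltf_pV2 ?posrE.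
(* For a > 1 this is the upper bound on r; for a <= 1 it follows from (a+1)/2 <= 1 and r > 0. *)
have b1 : beta < 1.
  rewrite /beta; have [a1|a1] := ltP 1 a.
    have := ra a1; rewrite ltr_pdivlMr ?subr_gt0// => h.
    have : (a - 1) / (2 * (a + 1)) < r^-1.
      by rewrite ltr_pdivrMr ?mulr_gt0 ?addr_gt0 ?(lt_trans ltr01 a1)// mulrC ltr_pdivlMr// mulrC.
    rewrite ltr_pdivrMr ?mulr_gt0 ?addr_gt0 ?(lt_trans ltr01 a1)// => h'.
    have -> : (a + 1) * (2^-1 - r^-1) = (a + 1) / 2 - (a + 1) / r by ring.
    lra.
  have : 0 < (a + 1) / r by rewrite divr_gt0//; lra.
  have -> : (a + 1) * (2^-1 - r^-1) = (a + 1) / 2 - (a + 1) / r by ring.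
  lra.
have qE : q = 2 / beta.
  (* At q = 0 the quotient 2/q would be 0 by convention, against beta > 0. *)
  have q0 : q != 0 by apply/negP => /eqP q0; move: qr; rewrite q0 invr0 mulr0 -/beta; lra.
  by rewrite /beta -qr; field.
set p := conjexp r; set q' := conjexp q.
have pE : p = r / (r - 1) by [].
have p1 : 1 < p by rewrite pE ltr_pdivlMr; lra.
have p2 : p < 2 by rewrite pE ltr_pdivrMr; lra.
have q'E : q' = 2 / (2 - beta).
  by rewrite /q' /conjexp qE; field; apply/andP; split; lra.
(* The decay exponent of the interpolated bound at p = r' is 2/q. *)
have bE : (a + 1) / 2 * (2 / p - 1) = beta.
  by rewrite pE /beta; field; apply/andP; split; lra.
pose K0 := 4 * Cen a (bcoef a 0) p.
have C0 : 0 <= Cen a (bcoef a 0) p.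
  rewrite /Cen bE; apply: mulr_ge0; first exact: Cdisp_ge0.
  by rewrite mulr_ge0// addr_ge0// divr_ge0//; lra.
(* The factor 2 adds the real and the imaginary part of T F, the 4 in [K0] comes from [Tfh_energy],
   and the added 1 makes the constant positive. *)
exists ((2 * K0) `^ 2^-1 + 1); split; first by rewrite ltr_wpDl ?powR_ge0.
move=> F hF.
have q'0 : 0 < q' by rewrite q'E divr_gt0//; lra.
have Y0 : (0 <= \int[@lebesgue_measure R]_(t in [set: R]) poweR (Lnorm_a a p (fun y => F y t)) q')%E.
  by apply: integral_ge0 => t _; exact: poweR_ge0.
have h1 := phi_comp_le a0 hF true p1 q'0.
have h2 := phi_comp_le a0 hF false p1 q'0.
rewrite /mixnorm -/p -/q'.
move: Y0 h1 h2; case: (\int[_]_(t in _) _)%E => [N| |] N0 h1 h2.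
- rewrite lee_fin in N0.
  have [B hB] := nice_comp hF a0.
  have hU := bessel_like_bes a0.
  have cc : (-1 : R) ^+ 2 = 1 by rewrite sqrrN expr1n.
  have mc i := meas2_comp hF i.
  have nn i t := (hB i t).1.
  have nB i t := (hB i t).2.
  have b0' := b0; have b1' := b1; rewrite -bE in b0' b1'.
  rewrite q'E -bE in h1 h2.
  have e1 := Tfh_energy a0 hU (mc true) (nn true) (nB true) (mc false) (nn false) (nB false) p1 p2 cc b0' b1' N0 h1 h2.
  have e2 := Tfh_energy a0 hU (mc false) (nn false) (nB false) (mc true) (nn true) (nB true) p1 p2 (expr1n R 2) b0' b1' N0 h2 h1.
  have KN : 0 <= 4 * (Cen a (bcoef a 0) p * N `^ (2 - (a + 1) / 2 * (2 / p - 1))).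
    by apply: mulr_ge0 => //; apply: mulr_ge0 => //; exact: powR_ge0.
  apply: (le_trans (Lnorm2_Top a0 hF KN e1 e2)).
  rewrite poweR_EFin -EFinM lee_fin bE.
  have -> : 2 * (4 * (Cen a (bcoef a 0) p * N `^ (2 - beta))) = 2 * K0 * N `^ (2 - beta).
    by rewrite /K0; ring.
  have K00 : 0 <= 2 * K0 by apply: mulr_ge0 => //; apply: mulr_ge0.
  rewrite (powRM _ K00 (powR_ge0 _ _)) -powRrM.
  (* The square root of N^(2-beta) is N^(1/q'), the mixed norm itself. *)
  have -> : (2 - beta) * 2^-1 = q'^-1 by rewrite q'E invf_div.
  by rewrite ler_wpM2r ?powR_ge0// lerDl.
(* An infinite mixed norm makes the right-hand side infinite, the constant being positive. *)
- rewrite poweRyr ?invr_eq0 ?gt_eqF// gt0_muley ?leey// lte_fin.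
  by rewrite ltr_wpDl ?powR_ge0.
- by [].
Qed.
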